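(* For any bounded domain $\Omega\subset\mathbb{R}^3$ with $C^2$ boundary, $$\min\{\mu_1(\Omega),-\mu_{-1}(\Omega)\}\ \ge\ \bigg(\frac{4\pi}{3|\Omega|}\bigg)^{1/3},$$ where $|\Omega|$ is the volume of $\Omega$, and $\mu_1(\Omega)$ and $\mu_{-1}(\Omega)$ are the first positive and the first negative curl eigenvalues of $\Omega$.
   Context: A domain is a connected open set. Let $\Omega\subset\mathbb{R}^3$ be a bounded domain with $C^2$ boundary and outward unit normal $N$. Let $\mathcal{H}_\Omega$ be the (finite-dimensional) space of harmonic fields tangent to the boundary, i.e. vector fields $h\in L^2(\Omega;\mathbb{R}^3)$ with $\operatorname{div}h=0$ and $\operatorname{curl}h=0$ in $\Omega$ and $h\cdot N=0$ on $\partial\Omega$ (in the sense of traces). Let $$\mathcal{K}(\Omega)=\Big\{v\in L^2(\Omega;\mathbb{R}^3):\ \operatorname{div}v=0,\ v\cdot N=0\text{ on }\partial\Omega,\ \int_\Omega v\cdot h\,dx=0\ \text{for all }h\in\mathcal{H}_\Omega\Big\}.$$ By a classical result of Giga and Yoshida, curl defines a self-adjoint operator on $\mathcal{K}(\Omega)$ with compact resolvent and dense domain $\mathcal{D}_\Omega=\{v\in\mathcal{K}(\Omega):\operatorname{curl}v\in\mathcal{K}(\Omega)\}$. Its eigenvalues (infinitely many positive and infinitely many negative, tending to $\pm\infty$, repeated according to multiplicity) are labelled $$\cdots\le\mu_{-2}(\Omega)\le\mu_{-1}(\Omega)<0<\mu_1(\Omega)\le\mu_2(\Omega)\le\cdots.$$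 $\mu_1(\Omega)$ is the first positive curl eigenvalue and $\mu_{-1}(\Omega)$ the first negative curl eigenvalue. *)

(* Defs.v *)
From HB Require Import structures.
From mathcomp Require Import all_boot all_order all_algebra.
From mathcomp Require Import all_classical all_reals all_analysis.

Set Implicit Arguments.
Unset Strict Implicit.
Unset Printing Implicit Defensive.

Import Order.TTheory GRing.Theory Num.Theory.
Import numFieldNormedType.Exports.

Local Open Scope classical_set_scope.
Local Open Scope ring_scope.

Section Defs.
Context {R : realType}.

(* R^3; its library norm is the sup norm, which is used only for the topology
   and for boundedness.  Euclidean quantities go through dot3 below. *)
Local Notation R3 := (R * R * R)%type.

(* measurableTypeR R is R with the display under which the library declares
   lebesgue_measure; the underlying type is convertible to R3. *)
Definition vol3 : {measure set (measurableTypeR R * measurableTypeR R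
                                * measurableTypeR R) -> \bar R} :=
  ((@lebesgue_measure R \x @lebesgue_measure R) \x @lebesgue_measure R)%E.

Definition coord3 (i : 'I_3) (x : R3) : R :=
  match val i with 0%N => x.1.1 | 1%N => x.1.2 | _ => x.2 end.

Definition basis3 (i : 'I_3) : R3 :=
  ((val i == 0%N)%:R, (val i == 1%N)%:R, (val i == 2%N)%:R).

Definition dot3 (x y : R3) : R := \sum_(i < 3) coord3 i x * coord3 i y.

Definition partial (i : 'I_3) (f : R3 -> R) (x : R3) : R := 'D_(basis3 i) f x.

Local Notation i0 := (@Ordinal 3 0 isT).
Local Notation i1 := (@Ordinal 3 1 isT).
Local Notation i2 := (@Ordinal 3 2 isT).

Definition grad (f : R3 -> R) (x : R3) : R3 :=
  (partial i0 f x, partial i1 f x, partial i2 f x).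

Definition curl (v : R3 -> R3) (x : R3) : R3 :=
  let d i j := partial i (coord3 j \o v) x in
  (d i1 i2 - d i2 i1, d i2 i0 - d i0 i2, d i0 i1 - d i1 i0).

Fixpoint Ck (k : nat) (f : R3 -> R) : Prop :=
  continuous f /\
  match k with
  | 0%N => True
  | k'.+1 => forall i : 'I_3,
      (forall x, derivable f x (basis3 i)) /\ Ck k' (partial i f)
  end.

Definition test_fun (U : set R3) (phi : R3 -> R) : Prop :=
  [/\ forall k, Ck k phi,
      compact (closure [set x | phi x != 0])
    & closure [set x | phi x != 0] `<=` U].

Definition test_field (U : set R3) (phi : R3 -> R3) : Prop :=
  forall i, test_fun U (coord3 i \o phi).

(* Near each boundary point p, Omega is the negativity set of a C^2 defining
   function rho with nonzero gradient.  As Omega is open, rho p = 0, and the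
   outward normal is grad rho / |grad rho|.  Taking rho defined on the whole
   space is no restriction (cut off near p). *)
Definition C2_boundary (Omega : set R3) : Prop :=
  forall p, (closure Omega `\` interior Omega) p ->
  exists rho : R3 -> R,
    [/\ Ck 2 rho, grad rho p != 0
      & \forall x \near p, Omega x <-> rho x < 0].

Definition bounded_C2_domain (Omega : set R3) : Prop :=
  [/\ open Omega, connected Omega, bounded_set Omega & C2_boundary Omega].

(* Only the values on Omega matter: each component is extended by 0. *)
Definition L2_field (Omega : set R3) (v : R3 -> R3) : Prop :=
  forall i, (coord3 i \o v) \_ Omega \in Lfun vol3 2%:E.

Definition inner (Omega : set R3) (v w : R3 -> R3) : R :=
  \int[vol3]_(x in Omega) dot3 (v x) (w x).

Definition div_free (Omega : set R3) (v : R3 -> R3) : Prop :=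
  forall phi, test_fun Omega phi -> inner Omega v (grad phi) = 0.

(* The normal trace of an L^2 field v with L^2 divergence is the functional
   phi |-> \int_Omega (v . grad phi + (div v) phi); this says that it vanishes
   for a divergence-free v.  The test functions phi are not required to vanish
   on the boundary of Omega. *)
Definition tangent_to_boundary (Omega : set R3) (v : R3 -> R3) : Prop :=
  forall phi, test_fun setT phi -> inner Omega v (grad phi) = 0.

(* curl v = w in Omega, in the sense of distributions *)
Definition weak_curl (Omega : set R3) (v w : R3 -> R3) : Prop :=
  forall phi, test_field Omega phi ->
    inner Omega v (curl phi) = inner Omega w phi.

Definition harmonic_field (Omega : set R3) (h : R3 -> R3) : Prop :=
  [/\ L2_field Omega h, div_free Omega h, weak_curl Omega h (fun=> 0)
    & tangent_to_boundary Omega h].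

Definition K_space (Omega : set R3) (v : R3 -> R3) : Prop :=
  [/\ L2_field Omega v, div_free Omega v, tangent_to_boundary Omega v
    & forall h, harmonic_field Omega h -> inner Omega v h = 0].

Definition curl_domain (Omega : set R3) (v : R3 -> R3) : Prop :=
  K_space Omega v /\ exists2 w, K_space Omega w & weak_curl Omega v w.

(* The eigenfield is nonzero as an element of L^2(Omega). *)
Definition curl_eigenvalue (Omega : set R3) (mu : R) : Prop :=
  exists v : R3 -> R3,
    [/\ curl_domain Omega v,
        ~ {ae vol3, forall x, Omega x -> v x = 0}
      & weak_curl Omega v (fun x => mu *: v x)].

Definition first_positive_curl_eigenvalue (Omega : set R3) (mu : R) : Prop :=
  [/\ 0 < mu, curl_eigenvalue Omega mu
    & forall nu, 0 < nu -> curl_eigenvalue Omega nu -> mu <= nu].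

Definition first_negative_curl_eigenvalue (Omega : set R3) (mu : R) : Prop :=
  [/\ mu < 0, curl_eigenvalue Omega mu
    & forall nu, nu < 0 -> curl_eigenvalue Omega nu -> nu <= mu].

End Defs.

(* Main.v *)
Require Import Defs.
From HB Require Import structures.
From mathcomp Require Import all_boot all_order all_algebra.
From mathcomp Require Import all_classical all_reals all_analysis.
From mathcomp Require Import measurable_realfun ring lra.
Import Order.TTheory GRing.Theory Num.Theory.
Import numFieldNormedType.Exports.
Local Open Scope classical_set_scope.
Local Open Scope ring_scope.

Set Implicit Arguments.
Unset Strict Implicit.
Unset Printing Implicit Defensive.

(** Let [r] be the radius of the ball with the same volume as [Omega]. The theorem
    says that [|mu| r >= 1] for every curl eigenvalue [mu], which holds because
    the inverse of the curl has norm at most [r] on L^2.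

    The inverse of the curl is the Biot-Savart integral, with the kernel
    [(x - y) / (4 pi |x - y|^3)]. A field [phi] with compact support in [Omega] is
    the Biot-Savart integral of [curl phi] plus a gradient, and a tangent field
    [v] is orthogonal to gradients. Hence [4 pi <v, phi>] is bounded by the double
    integral of [|v(y)| |curl phi(x)| |x - y|^(-2)], which Young's inequality
    splits into a part with [|v(y)|^2] and a part with [|curl phi(x)|^2]. In both
    the integral of [|x - y|^(-2)] over [Omega] remains; by rearrangement
    ([bathtub]) it is largest for the ball centred at the other point, where it is
    [4 pi r]. The result is [bilinear_estimate]:
      [|<v, phi>| <= r / 2 * (|v|^2 + |curl phi|^2)].
    To keep all integrands bounded, [1 / |z|] is replaced by
    [(|z|^2 + e^2)^(-1/2)]; the divergence of the regularized kernel is an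
    approximate identity ([mollify]), and [e] tends to [0] at the end.

    Let now [v] be an eigenfield. The residual of its projection on the closure of
    the fields [curl phi + grad psi], with [phi] compactly supported in [Omega], is
    harmonic and tangent, hence orthogonal to [v], hence zero ([K_space_approx]);
    so [v] is a limit of such fields. Since [v] and [curl phi] are orthogonal to
    [grad psi], in the limit [|v|^2 = <v, curl phi> = mu <v, phi>] and
    [|curl phi| <= |v|], so the bilinear estimate gives
    [|v|^2 <= |mu| r |v|^2] ([curl_eigenvalue_bound]). *)

(** * Continuity and derivatives of pointwise operations *)

Section ContinuousPointwise.
Context {R : realType} {T : topologicalType}.
Implicit Types f g : T -> R.

Lemma cont_cst (c : R) : continuous (fun _ : T => c).
Proof. by move=> x; exact: cvg_cst. Qed.

Lemma cont_add f g : continuous f -> continuous g ->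
  continuous (fun x => f x + g x).
Proof. by move=> cf cg x; apply: cvgD; [exact: cf|exact: cg]. Qed.

Lemma cont_opp f : continuous f -> continuous (fun x => - f x).
Proof. by move=> cf x; apply: cvgN; exact: cf. Qed.

Lemma cont_sub f g : continuous f -> continuous g ->
  continuous (fun x => f x - g x).
Proof. by move=> cf cg; apply: cont_add => //; exact: cont_opp. Qed.

Lemma cont_mul f g : continuous f -> continuous g ->
  continuous (fun x => f x * g x).
Proof. by move=> cf cg x; apply: cvgM; [exact: cf|exact: cg]. Qed.

Lemma cont_pow f n : continuous f -> continuous (fun x => f x ^+ n).
Proof.
move=> cf; elim: n => [|n IH].
  by have -> : (fun x => f x ^+ 0) = (fun=> 1) by []; exact: cont_cst.
have -> : (fun x => f x ^+ n.+1) = (fun x => f x * f x ^+ n).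
  by apply/funext => x; rewrite exprS.
exact: cont_mul.
Qed.

Lemma cont_inv f : continuous f -> (forall x, f x != 0) ->
  continuous (fun x => (f x)^-1).
Proof. by move=> cf f0 x; apply: cvgV; [exact: f0|exact: cf]. Qed.

Lemma cont_comp (h : R -> R) f : continuous h -> continuous f ->
  continuous (fun x => h (f x)).
Proof. by move=> ch cf x; apply: continuous_comp; [exact: cf|exact: ch]. Qed.

End ContinuousPointwise.

Section DerivePointwise.
Context {R : realType} {V : normedModType R}.
Implicit Types (f g : V -> R) (x v : V).

Lemma derive_pt_add f g x v a b : is_derive x v f a -> is_derive x v g b ->
  is_derive x v (fun y => f y + g y) (a + b).
Proof. by move=> df dg; exact: is_deriveD. Qed.

Lemma derive_pt_sub f g x v a b : is_derive x v f a -> is_derive x v g b ->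
  is_derive x v (fun y => f y - g y) (a - b).
Proof. by move=> df dg; exact: is_deriveB. Qed.

Lemma derive_pt_opp f x v a : is_derive x v f a ->
  is_derive x v (fun y => - f y) (- a).
Proof. by move=> df; exact: is_deriveN. Qed.

Lemma derive_pt_mul f g x v a b : is_derive x v f a -> is_derive x v g b ->
  is_derive x v (fun y => f y * g y) (f x * b + g x * a).
Proof. by move=> df dg; exact: is_deriveM. Qed.

Lemma derive_pt_scale c f x v a : is_derive x v f a ->
  is_derive x v (fun y => c * f y) (c * a).
Proof. by move=> df; exact: is_deriveZ. Qed.

Lemma derive_pt_eq f x v a b : is_derive x v f a -> a = b -> is_derive x v f b.
Proof. by move=> df <-. Qed.

Lemma derive_pt_pow f n x v a : is_derive x v f a ->
  is_derive x v (fun y => f y ^+ n) (n%:R * f x ^+ n.-1 * a).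
Proof.
move=> df; elim: n => [|n IH].
  have := is_derive_cst (1 : R) x v => /derive_pt_eq; apply.
  by rewrite !mul0r.
have -> : (fun y => f y ^+ n.+1) = (fun y => f y * f y ^+ n).
  by apply/funext => y; rewrite exprS.
have /derive_pt_eq := derive_pt_mul df IH; apply.
by case: n {IH} => [|n] /=; rewrite -?[in RHS]natr1 ?exprS ?expr0; ring.
Qed.

(** A directional derivative is the ordinary derivative at [0] along a line,
    which makes the one-variable chain rule and mean value theorem available. *)
Lemma derive_pt_line f x v a :
  is_derive x v f a <-> is_derive (0 : R) 1 (fun t : R => f (t *: v + x)) a.
Proof.
have E : (fun h : R => h^-1 *: (f (h *: v + x) - f x)) =
    (fun h : R => h^-1 *: (f ((h *: (1 : R) + 0) *: v + x) - f (0 *: v + x))).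
  apply/funext => h; rewrite addr0 scale0r add0r.
  by rewrite (_ : h *: (1 : R) = h) //; exact: mulr1.
split=> -[dv <-].
  split; first by rewrite /derivable -E.
  by rewrite /derive -E.
split; first by rewrite /derivable E.
by rewrite /derive E.
Qed.

Lemma derive_pt_comp (h : R -> R) f x v a b :
  is_derive (f x) 1 h a -> is_derive x v f b ->
  is_derive x v (fun y => h (f y)) (a * b).
Proof.
move=> dh /derive_pt_line df; apply/derive_pt_line.
apply: (@is_derive1_comp _ h (fun t => f (t *: v + x))) => //.
by rewrite scale0r add0r.
Qed.

End DerivePointwise.

(** * Measurability of open sets *)

Section Measurability.
Context {R : realType}.
Local Notation R3 := (R * R * R)%type.
(* [T3] is convertible to [R3]; [R3] carries the topology and [T3] the product
   sigma-algebra on which the volume is defined. *)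
Local Notation T1 := (measurableTypeR R).
Local Notation T3 := (T1 * T1 * T1)%type.

(** An open set is the union of the countably many cubes that it contains among
    those with rational centre and with half-side [n.+1%:R^-1]. *)
Lemma open_measurable3 (A : set R3) : open A -> measurable (A : set T3).
Proof.
move=> oA.
pose box (q : rat * rat * rat) (n : nat) : set R3 :=
  (ball (ratr q.1.1 : R) (n.+1%:R^-1) `*` ball (ratr q.1.2 : R) (n.+1%:R^-1))
    `*` ball (ratr q.2 : R) (n.+1%:R^-1).
pose I := [set p : (rat * rat * rat) * nat | box p.1 p.2 `<=` A].
have -> : A = \bigcup_(p in I) box p.1 p.2.
  apply/seteqP; split=> [x Ax|x [p Ip]]; last by apply: Ip.
  have /nbhs_ballP[e /= e0 eA] := oA x Ax.
  have [n ne] : exists n : nat, n.+1%:R^-1 < e / 2.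
    have /ltr_add_invr[n] : 0 < e / 2 by rewrite divr_gt0.
    by rewrite add0r; exists n.
  have n0 : 0 < n.+1%:R^-1 :> R by rewrite invr_gt0.
  have aux (t : R) : exists q : rat, ball t (n.+1%:R^-1) (ratr q).
    have := @dense_rat R (ball t n.+1%:R^-1).
    case; [by exists t; exact: ballxx|exact: ball_open|].
    by move=> _ [] /[swap] [[q _ <-]] bq; exists q.
  have [q1 h1] := aux x.1.1; have [q2 h2] := aux x.1.2.
  have [q3 h3] := aux x.2.
  exists ((q1, q2, q3), n); last first.
    by split => /=; [split => /=; apply/ball_sym|apply/ball_sym].
  move=> y [[/= b1 b2] b3]; apply: eA.
  have tr (a b c : R) : ball a n.+1%:R^-1 b -> ball b n.+1%:R^-1 c -> ball a e c.
    move=> ab bc; apply: (@le_ball _ _ _ (n.+1%:R^-1 + n.+1%:R^-1)).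
      by rewrite (splitr e) lerD// ltW.
    exact: ball_triangle bc.
  by split; [split; [apply: tr h1 _|apply: tr h2 _]|apply: tr h3 _].
rewrite bigcup_mkcond; apply: countable_bigcupT_measurable => // p.
case: ifP => // _; apply: measurableX; first apply: measurableX.
all: exact: open_measurable (ball_open _ _).
Qed.
End Measurability.

(** * One-dimensional integrals *)

Section OneDim.
Context {R : realType}.
Local Notation mu := (@lebesgue_measure R).

Lemma is_derive_continuous (F f : R -> R) :
  (forall x : R, is_derive x 1 F (f x)) -> continuous F.
Proof.
move=> dF x; apply: differentiable_continuous; apply/derivable1_diffP.
exact: (@ex_derive _ _ _ _ _ _ _ (dF x)).
Qed.

Lemma FTC2_derive (F f : R -> R) (a b : R) : a <= b ->
  (forall x : R, is_derive x 1 F (f x)) -> continuous f ->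
  (\int[mu]_(x in `[a, b]) (f x)%:E = (F b - F a)%:E)%E.
Proof.
rewrite le_eqVlt => /predU1P[<-|ab] dF cf.
  by rewrite set_itv1 integral_set1 subrr.
have cF := @is_derive_continuous F f dF.
rewrite (@continuous_FTC2 _ f F)//.
- exact: continuous_subspaceT.
- split=> [x _| |].
  + exact: (@ex_derive _ _ _ _ _ _ _ (dF x)).
  + exact/cvg_at_right_filter/cF.
  + exact/cvg_at_left_filter/cF.
- by move=> x _; rewrite derive1E; exact: derive_val.
Qed.

(** The left side is the area of a disc of squared radius [r], by vertical
    sections; it is computed with the substitution [t = c + s sin theta]. *)
Lemma integral_half_disc (c r : R) :
  (\int[mu]_t (2 * Num.sqrt (r - (t - c) ^+ 2))%:E = (pi * Num.max r 0)%:E)%E.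
Proof.
have [r0|r0] := leP r 0.
  rewrite mulr0 integral0_eq// => t _.
  by rewrite ler0_sqrtr ?mulr0// subr_le0 (le_trans r0)// sqr_ge0.
pose s := Num.sqrt r; have s0 : 0 < s by rewrite sqrtr_gt0.
have rs : r = s ^+ 2 by rewrite sqr_sqrtr// ltW.
have pi0 := pi_gt0 R.
pose F x := c + s * sin x; pose G t := 2 * Num.sqrt (r - (t - c) ^+ 2).
have dF (x : R) : is_derive x 1 F (s * cos x).
  have /derive_pt_eq := derive_pt_add (is_derive_cst c x 1)
    (derive_pt_scale s (is_derive_sin x)); apply.
  by rewrite add0r.
have F'E : F^`()%classic = (fun x => s * cos x).
  by apply/funext => x; rewrite derive1E; exact: derive_val.
have cF : continuous F by exact: (is_derive_continuous dF).
have cF' : continuous F^`()%classic.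
  by rewrite F'E; apply: cont_mul; [exact: cont_cst|exact: continuous_cos].
have cG : continuous G.
  apply: cont_mul; first exact: cont_cst.
  apply: (cont_comp (@sqrt_continuous R)).
  apply: cont_sub; first exact: cont_cst.
  by apply: cont_pow; apply: cont_sub; [move=> ?|exact: cont_cst].
have Fa : F (- (pi / 2)) = c - s by rewrite /F sinN sin_pihalf mulrN1.
have Fb : F (pi / 2) = c + s by rewrite /F sin_pihalf mulr1.
transitivity (\int[mu]_(t in `[(c - s)%R, (c + s)%R]) (G t)%:E)%E.
  rewrite [RHS]integral_mkcond; apply: eq_integral => t _.
  rewrite patchE; case: ifPn => // /negP; rewrite inE/= in_itv/= => tcs.
  rewrite ler0_sqrtr ?mulr0// subr_le0 rs.
  have [h1|h1] := ltP t (c - s); first by nra.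
  have [h2|h2] := ltP (c + s) t; first by nra.
  by exfalso; apply: tcs; apply/andP.
have ab : - (pi / 2) <= pi / 2 :> R by lra.
have incF : {in `[- (pi / 2), pi / 2] &, {homo F : x y / x < y}}.
  by move=> x y xI yI xy; rewrite /F ltrD2l ltr_pM2l// ltr_sin.
have LRF : derivable_oo_LRcontinuous F (- (pi / 2)) (pi / 2).
  split=> [x _| |].
  + exact: (@ex_derive _ _ _ _ _ _ _ (dF x)).
  + exact/cvg_at_right_filter/cF.
  + exact/cvg_at_left_filter/cF.
rewrite -Fa -Fb (integration_by_substitution_increasing ab incF _ _ _ LRF);
  last 4 first.
- by move=> x _; exact: cF'.
- by apply/cvg_ex; eexists; apply/cvg_at_right_filter/cF'.
- by apply/cvg_ex; eexists; apply/cvg_at_left_filter/cF'.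
- exact: continuous_subspaceT.
pose H x := r * (x + sin x * cos x).
transitivity (\int[mu]_(x in `[(- (pi / 2))%R, (pi / 2)%R])
    (2 * r * cos x ^+ 2)%:E)%E.
  apply: eq_integral => x /[1!inE]/=; rewrite in_itv/= => xI.
  congr EFin; rewrite F'E.
  have cx : 0 <= cos x by exact: cos_ge0_pihalf.
  change (G (F x) * (s * cos x) = 2 * r * cos x ^+ 2).
  rewrite /G /F; have -> : r - (c + s * sin x - c) ^+ 2 = (s * cos x) ^+ 2.
    by rewrite rs exprMn cos2sin2; ring.
  by rewrite sqrtr_sqr ger0_norm ?mulr_ge0 ?(ltW s0)// rs; ring.
have dH (x : R) : is_derive x 1 H (2 * r * cos x ^+ 2).
  have /derive_pt_eq := derive_pt_scale r (derive_pt_add (is_derive_id x 1)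
    (derive_pt_mul (is_derive_sin x) (is_derive_cos x))); apply.
  have -> : 2 * r * cos x ^+ 2 = r * (2 * cos x ^+ 2) by ring.
  congr (r * _); have := cos2Dsin2 x; rewrite !expr2 => h.
  by rewrite mulrN -[X in X + _]h; ring.
have cH : continuous (fun x : R => 2 * r * cos x ^+ 2).
  apply: cont_mul; first exact: cont_cst.
  by apply: cont_pow; exact: continuous_cos.
rewrite (FTC2_derive ab dH cH).
congr EFin; rewrite /H cosN cos_pihalf !mulr0; lra.
Qed.

End OneDim.

(** * The volume of balls *)

Section Volume.
Context {R : realType}.
Local Notation R3 := (R * R * R)%type.
Local Notation T1 := (measurableTypeR R).
Local Notation T3 := (T1 * T1 * T1)%type.
Local Notation mu := (@lebesgue_measure R).

(** [vol3] is by definition [vol3s]; the measures [leb], [vol2] and [vol3s] have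
    in addition the sigma-finite structure that Fubini's theorem requires. *)
Definition leb : {sigma_finite_measure set T1 -> \bar R} := @lebesgue_measure R.

(** The squared Euclidean length; [`|z|] is the sup norm. *)
Definition sq3 (z : R3) : R := z.1.1 ^+ 2 + z.1.2 ^+ 2 + z.2 ^+ 2.

Definition eball (y : R3) (r : R) : set R3 := [set x | sq3 (x - y) < r ^+ 2].

Lemma norm_prod_le (U V : normedZmodType R) (x : U * V) :
  `|x.1| <= `|x| /\ `|x.2| <= `|x|.
Proof. by rewrite prod_normE !le_max !lexx orbT. Qed.

Lemma norm_coord_le (x : R3) :
  [/\ `|x.1.1| <= `|x|, `|x.1.2| <= `|x| & `|x.2| <= `|x|].
Proof.
have [h1 h2] := norm_prod_le x; have [h3 h4] := norm_prod_le x.1.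
by split=> //; apply: le_trans h1.
Qed.

Let I (n : nat) : set T1 := `[(- n%:R)%R, n%:R : R]%classic.

Let mI n : measurable (I n). Proof. exact: measurable_itv. Qed.

Let I_lty n : (leb (I n) < +oo)%E.
Proof.
have -> : leb (I n) = mu `[(- n%:R)%R, n%:R : R]%classic by [].
by rewrite lebesgue_measure_itv/=; case: ifP; rewrite -?EFinB ltry.
Qed.

Let itv_nat (t M : R) : `|t| <= M -> I (Num.truncn M).+1 t.
Proof.
move=> tM; rewrite /I/= in_itv/= -ler_norml; apply: (le_trans tM).
by apply/ltW; exact: truncnS_gt.
Qed.

Definition vol2 : set (T1 * T1)%type -> \bar R := (leb \x leb)%E.
HB.instance Definition _ := Measure.on vol2.

Let I2_lty n : (vol2 (I n `*` I n) < +oo)%E.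
Proof. by rewrite /vol2 product_measure1E// lte_mul_pinfty ?ge0_fin_numE ?I_lty. Qed.

Let sigma_finite_vol2 : sigma_finite setT vol2.
Proof.
exists (fun n => I n `*` I n) => [|n].
  apply/seteqP; split=> // x _; exists (Num.truncn `|x|).+1 => //.
  by have [h1 h2] := norm_prod_le (x : R * R); split; exact: itv_nat.
by split; [exact: measurableX|exact: I2_lty].
Qed.
HB.instance Definition _ :=
  Measure_isSigmaFinite.Build _ _ _ vol2 sigma_finite_vol2.

Definition vol3s : set T3 -> \bar R := (vol2 \x leb)%E.
HB.instance Definition _ := Measure.on vol3s.

Let cube_lty n : (vol3s ((I n `*` I n) `*` I n) < +oo)%E.
Proof.
rewrite /vol3s product_measure1E//; last exact: measurableX.
by rewrite lte_mul_pinfty ?ge0_fin_numE ?I2_lty ?I_lty.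
Qed.

Let sigma_finite_vol3 : sigma_finite setT vol3s.
Proof.
exists (fun n => (I n `*` I n) `*` I n) => [|n].
  apply/seteqP; split=> // x _; exists (Num.truncn `|x|).+1 => //.
  have [h1 h2 h3] := norm_coord_le x.
  by split; [split|]; exact: itv_nat.
by split; [apply: measurableX => //; exact: measurableX|exact: cube_lty].
Qed.
HB.instance Definition _ :=
  Measure_isSigmaFinite.Build _ _ _ vol3s sigma_finite_vol3.

Lemma vol3E : (vol3 : set T3 -> \bar R) = vol3s. Proof. by []. Qed.

Lemma fst_cont (U V : topologicalType) : continuous (@fst U V).
Proof. by move=> x; exact: cvg_fst. Qed.

Lemma snd_cont (U V : topologicalType) : continuous (@snd U V).
Proof. by move=> x; exact: cvg_snd. Qed.

Lemma cont_c0 : continuous (fun x : R3 => x.1.1).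
Proof.
by move=> x; apply: (@continuous_comp _ _ _ fst fst); exact: fst_cont.
Qed.

Lemma cont_c1 : continuous (fun x : R3 => x.1.2).
Proof.
move=> x; apply: (@continuous_comp _ _ _ fst snd); first exact: fst_cont.
exact: snd_cont.
Qed.

Lemma cont_c2 : continuous (fun x : R3 => x.2).
Proof. exact: snd_cont. Qed.

Lemma sq3_cont (y : R3) : continuous (fun x : R3 => sq3 (x - y)).
Proof.
apply: cont_add; first apply: cont_add; apply: cont_pow; apply: cont_sub.
all: (exact: cont_c0 || exact: cont_c1 || exact: cont_c2 || exact: cont_cst).
Qed.

Lemma eball_open (y : R3) (r : R) : open (eball y r).
Proof.
by apply: open_comp (@open_lt _ (r ^+ 2)) => x _; exact: sq3_cont.
Qed.

Lemma eball_measurable (y : R3) (r : R) : measurable (eball y r : set T3).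
Proof. by apply: open_measurable3; exact: eball_open. Qed.

Lemma measure_sqr_lt (c r : R) :
  mu [set t | (t - c) ^+ 2 < r] = (2 * Num.sqrt r)%:E.
Proof.
have [r0|r0] := leP r 0.
  rewrite (_ : [set _ | _] = set0) ?measure0 ?ler0_sqrtr ?mulr0//.
  by apply/seteqP; split=> // t /=; rewrite ltNge (le_trans r0)// sqr_ge0.
have s0 : 0 < Num.sqrt r by rewrite sqrtr_gt0.
have rs : r = (Num.sqrt r) ^+ 2 by rewrite sqr_sqrtr// ltW.
rewrite (_ : [set _ | _] = `]c - Num.sqrt r, c + Num.sqrt r[%classic).
  rewrite lebesgue_measure_itv/= lte_fin ifT; last by lra.
  by rewrite -EFinB; congr EFin; ring.
move: (Num.sqrt r) s0 rs => s s0 ->.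
apply/seteqP; split=> t /=; rewrite in_itv/=.
  by move=> h; apply/andP; split; nra.
by move=> /andP[h1 h2]; nra.
Qed.

(** Sections parallel to the third axis are intervals; integrating their lengths
    along the second axis gives the areas of discs. *)
Lemma vol3_eball (y : R3) (r : R) : 0 <= r ->
  vol3 (eball y r) = (4 / 3 * pi * r ^+ 3)%:E.
Proof.
move=> r0.
change ((\int[vol2]_p leb (xsection (eball y r) p))%E =
  (4 / 3 * pi * r ^+ 3)%:E).
pose f (p : T1 * T1) : R :=
  2 * Num.sqrt (r ^+ 2 - (p.1 - y.1.1) ^+ 2 - (p.2 - y.1.2) ^+ 2).
transitivity (\int[leb \x leb]_p (f p)%:E)%E.
  apply: eq_integral => p _ /=.
  rewrite /f -(measure_sqr_lt y.2); congr (leb _).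
  have E t : sq3 ((p, t) - y) =
      (t - y.2) ^+ 2 + (p.1 - y.1.1) ^+ 2 + (p.2 - y.1.2) ^+ 2.
    by rewrite /sq3/=; ring.
  apply/seteqP; split=> t /=; rewrite /xsection/= inE /eball/= E.
    by move=> h; rewrite /=; lra.
  by rewrite /=; lra.
have mf : measurable_fun setT f.
  apply: measurable_funM; first exact: measurable_cst.
  apply: (measurableT_comp (continuous_measurable_fun (@sqrt_continuous R))).
  apply: measurable_funB; first apply: measurable_funB => //.
  - by apply: measurable_funX; apply: measurable_funB => //; exact: measurable_fst.
  - by apply: measurable_funX; apply: measurable_funB => //; exact: measurable_snd.
rewrite fubini_tonelli1/=; last 2 first.
- exact/measurable_EFinP.
- by move=> p; rewrite lee_fin mulr_ge0// sqrtr_ge0.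
rewrite /fubini_F.
transitivity (\int[leb]_a (pi * Num.max (r ^+ 2 - (a - y.1.1) ^+ 2) 0)%:E)%E.
  apply: eq_integral => a _.
  exact: (integral_half_disc y.1.2 (r ^+ 2 - (a - y.1.1) ^+ 2)).
transitivity (\int[mu]_(a in `[(y.1.1 - r)%R, (y.1.1 + r)%R])
   (pi * (r ^+ 2 - (a - y.1.1) ^+ 2))%:E)%E.
  rewrite [RHS]integral_mkcond; apply: eq_integral => t _.
  rewrite patchE; case: ifPn => [|/negP]; rewrite inE/= in_itv/=.
    by move=> /andP[h1 h2]; congr (pi * _)%:E; apply/max_idPl; nra.
  move=> tcs; rewrite (_ : Num.max _ _ = 0) ?mulr0//; apply/max_idPr.
  have [h1|h1] := ltP t (y.1.1 - r); first by nra.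
  have [h2|h2] := ltP (y.1.1 + r) t; first by nra.
  by exfalso; apply: tcs; apply/andP.
have ab : y.1.1 - r <= y.1.1 + r by lra.
pose F t := pi * (r ^+ 2 * t - 3^-1 * (t - y.1.1) ^+ 3).
have dF (x : R) : is_derive x 1 F (pi * (r ^+ 2 - (x - y.1.1) ^+ 2)).
  have /derive_pt_eq := derive_pt_scale pi (derive_pt_sub
    (derive_pt_scale (r ^+ 2) (is_derive_id x 1)) (derive_pt_scale 3^-1
      (derive_pt_pow 3 (derive_pt_sub (is_derive_id x 1)
        (is_derive_cst y.1.1 x 1))))); apply.
  by rewrite /=; field.
have cF : continuous (fun t : R => pi * (r ^+ 2 - (t - y.1.1) ^+ 2)).
  apply: cont_mul; first exact: cont_cst.
  apply: cont_sub; first exact: cont_cst.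
  by apply: cont_pow; apply: cont_sub; [move=> ?|exact: cont_cst].
by rewrite (FTC2_derive ab dF cF) /F; congr EFin; field.
Qed.

Lemma bounded_vol3_lty (A : set R3) : measurable (A : set T3) ->
  bounded_set A -> (vol3 A < +oo)%E.
Proof.
move=> mA [M [_ bA]].
have /bA {}bA : M < `|M| + 1 by rewrite (le_lt_trans (ler_norm M))// ltrDl.
rewrite vol3E; apply: le_lt_trans (cube_lty (Num.truncn (`|M| + 1)).+1).
apply: le_measure; rewrite ?inE//.
  by apply: measurableX => //; exact: measurableX.
move=> x /bA xM.
have [h1 h2 h3] := norm_coord_le x.
by split; [split|]; apply: itv_nat; apply: le_trans xM.
Qed.

End Volume.

(** * Real-valued integrals and Fubini's theorem *)

Section RealIntegral.
Context d (T : measurableType d) (R : realType).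
Variable mu : {measure set T -> \bar R}.
Implicit Types f g h : T -> R.

(** Real-valued integrals over the whole space keep the bookkeeping of
    finiteness out of the algebra. *)
Definition itg f := mu.-integrable setT (EFin \o f).

Lemma itg_meas f : itg f -> measurable_fun setT f.
Proof. by move/measurable_int/measurable_EFinP. Qed.

Lemma itgD f g : itg f -> itg g -> itg (fun x => f x + g x).
Proof. by move=> hf hg; have := integrableD measurableT hf hg. Qed.

Lemma itgZ c f : itg f -> itg (fun x => c * f x).
Proof. by move=> hf; have := integrableZl measurableT c hf. Qed.

Lemma itgN f : itg f -> itg (fun x => - f x).
Proof.
move=> /(itgZ (-1)); congr (mu.-integrable _ _).
by apply/funext => x /=; rewrite mulN1r.
Qed.

Lemma itgB f g : itg f -> itg g -> itg (fun x => f x - g x).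
Proof. by move=> hf hg; apply: itgD => //; exact: itgN. Qed.

Lemma itg_sum (I : Type) (s : seq I) (P : pred I) (F : I -> T -> R) :
  (forall i, P i -> itg (F i)) -> itg (fun x => \sum_(i <- s | P i) F i x).
Proof.
move=> hF; have := @integrable_sum _ T R mu setT measurableT I s P
  (fun i => EFin \o F i) hF.
by congr (mu.-integrable _ _); apply/funext => x /=; rewrite sumEFin.
Qed.

Lemma itg_le f g : measurable_fun setT f -> (forall x, `|f x| <= g x) ->
  itg g -> itg f.
Proof.
move=> mf fg; apply: le_integrable => //; first exact/measurable_EFinP.
by move=> x _ /=; rewrite lee_fin (le_trans (fg x))// ler_norm.
Qed.

Lemma itg_norm f : itg f -> itg (fun x => `|f x|).
Proof. by move=> hf; exact: (integrable_norm hf). Qed.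

Lemma itg_bdM (M : R) h f : measurable_fun setT h -> (forall x, `|h x| <= M) ->
  itg f -> itg (fun x => h x * f x).
Proof.
move=> mh hM hf; apply: (@itg_le _ (fun x => M * `|f x|)).
- by apply: measurable_funM => //; exact: itg_meas.
- by move=> x; rewrite normrM ler_wpM2r.
- exact/itgZ/itg_norm.
Qed.

Lemma itg_eq f g : f =1 g -> itg f -> itg g.
Proof. by move=> /funext ->. Qed.

Lemma rintE f : itg f -> (\int[mu]_x (f x)%:E = (\int[mu]_x f x)%R%:E)%E.
Proof. by move=> hf; rewrite /Rintegral fineK//; exact: integrable_fin_num. Qed.

Lemma rintD f g : itg f -> itg g ->
  \int[mu]_x (f x + g x) = \int[mu]_x f x + \int[mu]_x g x.
Proof. by move=> hf hg; exact: RintegralD. Qed.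

Lemma rintB f g : itg f -> itg g ->
  \int[mu]_x (f x - g x) = \int[mu]_x f x - \int[mu]_x g x.
Proof. by move=> hf hg; exact: RintegralB. Qed.

Lemma rintZ c f : itg f -> \int[mu]_x (c * f x) = c * \int[mu]_x f x.
Proof. by move=> hf; exact: RintegralZl. Qed.

Lemma rint0 : \int[mu]_x (0 : R) = 0.
Proof. by rewrite /Rintegral integral0. Qed.

Lemma rint_sum (I : Type) (s : seq I) (P : pred I) (F : I -> T -> R) :
  (forall i, P i -> itg (F i)) ->
  \int[mu]_x (\sum_(i <- s | P i) F i x) = \sum_(i <- s | P i) \int[mu]_x F i x.
Proof.
move=> hF; elim: s => [|i s IH].
  rewrite big_nil -[RHS]rint0; apply: eq_Rintegral => x _; exact: big_nil.
rewrite big_cons; case: ifP => Pi.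
  rewrite -IH -rintD//; [|exact: hF|exact: itg_sum].
  by apply: eq_Rintegral => x _; rewrite big_cons Pi.
by rewrite -IH; apply: eq_Rintegral => x _; rewrite big_cons Pi.
Qed.

Lemma rint_le f g : itg f -> itg g -> (forall x, f x <= g x) ->
  \int[mu]_x f x <= \int[mu]_x g x.
Proof. by move=> hf hg fg; apply: le_Rintegral. Qed.

Lemma rint_ge0 f : (forall x, 0 <= f x) -> 0 <= \int[mu]_x f x.
Proof. by move=> f0; exact: Rintegral_ge0. Qed.

Lemma rint_norm_le f g : itg f -> itg g -> (forall x, `|f x| <= g x) ->
  `|\int[mu]_x f x| <= \int[mu]_x g x.
Proof.
move=> hf hg fg; apply: (le_trans (le_normr_Rintegral _ _)) => //.
by apply: rint_le => //; exact: itg_norm.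
Qed.

Lemma itg_fin (A : set T) (M : R) f : measurable A -> (mu A < +oo)%E ->
  measurable_fun setT f -> (forall x, `|f x| <= M) ->
  (forall x, ~ A x -> f x = 0) -> itg f.
Proof.
move=> mA Afin mf fM f0; apply: (@itg_le _ (fun x => `|M| * \1_A x)) => //.
  move=> x; rewrite indicE; case: (boolP (x \in A)) => [_|/negP].
    by rewrite mulr1 (le_trans (fM x))// ler_norm.
  by rewrite inE mulr0 => /f0 ->; rewrite normr0.
apply: itgZ; apply/integrableP; split.
  by apply/measurable_EFinP; exact: measurable_indic.
under eq_integral do rewrite /= ger0_norm//.
by rewrite integral_indic// setIT.
Qed.

End RealIntegral.

Section FubiniReal.
Context d1 d2 (T1 : measurableType d1) (T2 : measurableType d2) (R : realType).
Variables (m1 : {sigma_finite_measure set T1 -> \bar R})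
  (m2 : {sigma_finite_measure set T2 -> \bar R}).

Lemma itg_rint (M : R) (K : T1 * T2 -> R) (g : T1 -> R) (f : T2 -> R) :
  measurable_fun setT K -> (forall z, `|K z| <= M) -> itg m1 g -> itg m2 f ->
  itg (m1 \x m2)%E (fun z => K z * (g z.1 * f z.2)) /\
  itg m1 (fun y => g y * \int[m2]_x (K (y, x) * f x)).
Proof.
move=> mK KM ig iF.
pose H (z : T1 * T2) := K z * (g z.1 * f z.2).
have mH : measurable_fun setT H.
  apply: measurable_funM => //; apply: measurable_funM.
    by apply: measurableT_comp (itg_meas ig) _; exact: measurable_fst.
  by apply: measurableT_comp (itg_meas iF) _; exact: measurable_snd.
have mKy y : measurable_fun setT (fun x => K (y, x)).
  by apply: measurableT_comp mK _; exact: measurable_pair1.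
have iy y : itg m2 (fun x => K (y, x) * f x) by apply: (@itg_bdM _ _ _ _ M).
have iH : (m1 \x m2)%E.-integrable setT (EFin \o H).
  apply/integrable12ltyP; first exact/measurable_EFinP.
  apply: (@le_lt_trans _ _
    (\int[m1]_y (`|M| * \int[m2]_x `|f x| * `|g y|)%:E)%E); last first.
    by rewrite rintE ?ltry//; apply: itgZ; exact: itg_norm.
  apply: ge0_le_integral => //.
  - by move=> y _; apply: integral_ge0.
  - apply: (measurable_fun_fubini_tonelli_F (fun z => `|(H z)%:E|%E)) => //.
    by do 2 apply: measurableT_comp => //.
  - apply/measurable_EFinP; apply: measurable_funM => //.
    by apply: measurableT_comp => //; exact: itg_meas ig.
  - move=> y _; rewrite /=.
    rewrite (_ : (fun x => _) = fun x => (`|H (y, x)|)%:E)//.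
    have iHy : itg m2 (fun x => H (y, x)).
      by apply: itg_eq (itgZ (g y) (iy y)) => x; rewrite /H/=; ring.
    rewrite rintE; last exact: itg_norm.
    rewrite lee_fin mulrAC -rintZ; last exact: itg_norm.
    apply: rint_le; [exact: itg_norm|by apply: itgZ; exact: itg_norm|move=> x].
    rewrite /H !normrM mulrA ler_wpM2r// ler_wpM2r//.
    by rewrite (le_trans (KM _))// ler_norm.
have FE y : (\int[m2]_x (EFin \o H) (y, x) =
    (g y * \int[m2]_x (K (y, x) * f x))%:E)%E.
  rewrite -(rintZ (g y) (iy y)) -rintE; last exact: itgZ.
  by apply: eq_integral => x _; rewrite /H/=; congr EFin; ring.
split=> //; have := integrable_fubini_F iH; congr (m1.-integrable _ _).
by apply/funext => y; rewrite /fubini_F FE.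
Qed.

End FubiniReal.

Section FubiniSwap.
Context d1 d2 (T1 : measurableType d1) (T2 : measurableType d2) (R : realType).
Variables (m1 : {sigma_finite_measure set T1 -> \bar R})
  (m2 : {sigma_finite_measure set T2 -> \bar R}).

(** Fubini's theorem applies because [M |g y| |f x|] dominates the product
    integrand. *)
Lemma rint_swap (M : R) (K : T1 * T2 -> R) (g : T1 -> R) (f : T2 -> R) :
  measurable_fun setT K -> (forall z, `|K z| <= M) -> itg m1 g -> itg m2 f ->
  [/\ itg m1 (fun y => g y * \int[m2]_x (K (y, x) * f x)),
      itg m2 (fun x => f x * \int[m1]_y (K (y, x) * g y))
    & \int[m1]_y (g y * \int[m2]_x (K (y, x) * f x)) =
      \int[m2]_x (f x * \int[m1]_y (K (y, x) * g y))].
Proof.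
move=> mK KM ig iF.
have [iH i1] := itg_rint mK KM ig iF.
have [_ i2] := @itg_rint _ _ _ _ _ m2 m1 M (fun z => K (z.2, z.1)) f g
  (measurableT_comp mK (measurable_fun_pair (@measurable_snd _ _ _ _)
    (@measurable_fst _ _ _ _))) (fun z => KM _) iF ig.
have mKy y : measurable_fun setT (fun x => K (y, x)).
  by apply: measurableT_comp mK _; exact: measurable_pair1.
have mKx x : measurable_fun setT (fun y => K (y, x)).
  by apply: measurableT_comp mK _; exact: measurable_pair2.
have iy y : itg m2 (fun x => K (y, x) * f x) by apply: (@itg_bdM _ _ _ _ M).
have ix x : itg m1 (fun y => K (y, x) * g y) by apply: (@itg_bdM _ _ _ _ M).
pose H (z : T1 * T2) := K z * (g z.1 * f z.2).
have FE y : (\int[m2]_x (EFin \o H) (y, x) =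
    (g y * \int[m2]_x (K (y, x) * f x))%:E)%E.
  rewrite -(rintZ (g y) (iy y)) -rintE; last exact: itgZ.
  by apply: eq_integral => x _; rewrite /H/=; congr EFin; ring.
have GE x : (\int[m1]_y (EFin \o H) (y, x) =
    (f x * \int[m1]_y (K (y, x) * g y))%:E)%E.
  rewrite -(rintZ (f x) (ix x)) -rintE; last exact: itgZ.
  by apply: eq_integral => y _; rewrite /H/=; congr EFin; ring.
split=> //; have := Fubini iH; rewrite -/H.
under eq_integral do rewrite FE.
under [X in _ = X]eq_integral do rewrite GE.
by rewrite !rintE// => -[].
Qed.

End FubiniSwap.

(** * Integrals of partial derivatives *)

Section LineDerivative.
Context {R : realType} {V : normedModType R}.

Lemma derive_along_line (f df : V -> R) (v x : V) (t : R) :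
  (forall y, is_derive y v f (df y)) ->
  is_derive t 1 (fun s : R => f (s *: v + x)) (df (t *: v + x)).
Proof.
move=> dF; apply: (derive_pt_line _ _ _ _).2.
have -> : (fun h : R => f ((h *: (1 : R) + t) *: v + x)) =
    (fun h : R => f (h *: v + (t *: v + x))).
  apply/funext => h; rewrite addrA -scalerDl.
  by rewrite (_ : h *: (1 : R) = h)//; exact: mulr1.
exact: (derive_pt_line _ _ _ _).1 (dF _).
Qed.

Lemma MVT_line (f df : V -> R) (v x : V) (h : R) : 0 < h ->
  (forall y, is_derive y v f (df y)) ->
  exists2 t, 0 <= t <= h & f (h *: v + x) - f x = h * df (t *: v + x).
Proof.
move=> h0 dF.
have dg s := derive_along_line x s dF.
have [t] := MVT h0 (fun s _ => dg s)
  (continuous_subspaceT (is_derive_continuous dg)).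
rewrite in_itv/= scale0r add0r subr0 => /andP[/ltW t0 /ltW th] ->.
by exists t; [rewrite t0 th|rewrite mulrC].
Qed.

End LineDerivative.

Section IntegrationR3.
Context {R : realType}.
Local Notation R3 := (R * R * R)%type.
Local Notation T1 := (measurableTypeR R).
Local Notation T3 := (T1 * T1 * T1)%type.

Lemma cont_measurable3 (f : R3 -> R) : continuous f ->
  measurable_fun setT (f : T3 -> R).
Proof.
move=> cf; apply: (measurability _ (RGenOpens.measurableE R)).
move=> _ [_ [a [b ->] <-]]; rewrite setTI; apply: open_measurable3.
by move/continuousP: cf; apply; exact: interval_open.
Qed.

Definition bounded_support (f : R3 -> R) :=
  exists M, forall x, M < `|x| -> f x = 0.

Lemma compact_box (M : R) : compact [set x : R3 | `|x| <= M].
Proof.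
have -> : [set x : R3 | `|x| <= M] =
    (`[(- M)%R, M]%classic `*` `[(- M)%R, M]%classic) `*` `[(- M)%R, M]%classic.
  apply/seteqP; split=> x /=; rewrite !in_itv/= -!ler_norml.
    move=> xM; have [h1 h2 h3] := norm_coord_le x.
    by split; [split|]; apply: le_trans xM.
  by move=> [[h1 h2] h3]; rewrite prod_normE /= prod_normE /= !ge_max h1 h2 h3.
by apply: compact_setX; [apply: compact_setX|]; exact: segment_compact.
Qed.

Lemma cont_bounded_on (f : R3 -> R) (M : R) : continuous f ->
  exists2 B, 0 <= B & forall x, `|x| <= M -> `|f x| <= B.
Proof.
move=> cf.
have /compact_bounded [B [_ fB]] := continuous_compact
  (continuous_subspaceT cf) (compact_box (M := M)).
exists (`|B| + 1) => [|x xM]; first by rewrite addr_ge0.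
by apply: fB; [rewrite (le_lt_trans (ler_norm B))// ltrDl|exists x].
Qed.

Lemma cont_bounded (f : R3 -> R) : continuous f -> bounded_support f ->
  exists2 B, 0 <= B & forall x, `|f x| <= B.
Proof.
move=> cf [M fM]; have [B B0 fB] := cont_bounded_on M cf.
exists B => // x; have [/fM ->|/fB//] := ltP M `|x|.
by rewrite normr0.
Qed.

Lemma box_measurable (M : R) : measurable ([set x : R3 | `|x| <= M] : set T3).
Proof.
rewrite (_ : [set _ | _] = ~` [set x : R3 | M < `|x|]); last first.
  by apply/seteqP; split=> x /=; rewrite leNgt => /negP.
apply: measurableC; apply: open_measurable3.
by apply: open_comp (@open_gt _ M) => x _; exact: norm_continuous.
Qed.

Lemma box_lty (M : R) : (vol3 ([set x : R3 | (`|x| <= M)%R] : set T3) < +oo)%E.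
Proof.
apply: bounded_vol3_lty; first exact: box_measurable.
exists M; split; first exact: num_real.
by move=> y My x /= xM; rewrite (le_trans xM)// ltW.
Qed.

Lemma itg_cont (f : R3 -> R) : continuous f -> bounded_support f ->
  itg vol3 f.
Proof.
move=> cf bf; have [B B0 fB] := cont_bounded cf bf; have [M fM] := bf.
apply: (@itg_fin _ T3 R vol3 [set x : R3 | `|x| <= M] B f) => //.
- exact: box_measurable.
- exact: box_lty.
- exact: cont_measurable3.
- by move=> x /negP; rewrite -ltNge => /fM.
Qed.

Lemma leb_shift (a : R) (A : set T1) : measurable A ->
  leb ((fun t : T1 => t + a) @^-1` A) = leb A.
Proof.
move=> mA; have ms : measurable_fun setT (fun t : T1 => t + a : T1).
  by apply: measurable_funD => //; exact: measurable_cst.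
pose m := [the measure _ _ of pushforward (leb) (fun t : T1 => t + a : T1)].
rewrite -[RHS]/(lebesgue_measure A) (@lebesgue_measure_unique _ (m ms))//.
move=> _ [[b c] _ <-]; rewrite /m /= /pushforward.
have -> : (fun t => t + a) @^-1` `]b, c]%classic = `]b - a, c - a]%classic.
  by apply/seteqP; split=> t /=; rewrite !in_itv/= => /andP[? ?]; apply/andP; split; lra.
rewrite -[RHS]/(lebesgue_measure _) !lebesgue_measure_itv/= !lte_fin.
rewrite ltrD2r; case: ifP => // _.
by rewrite -!EFinB; congr EFin; ring.
Qed.

Lemma measurable_shift1 (a : R) : measurable_fun setT (fun t : T1 => t + a : T1).
Proof. by apply: measurable_funD => //; exact: measurable_cst. Qed.

Definition shift3 (a : R3) (x : T3) : T3 := (x : R3) + a.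

Lemma measurable_shift3 (a : R3) : measurable_fun setT (shift3 a).
Proof.
apply: measurable_fun_pair; first apply: measurable_fun_pair.
- apply: (measurableT_comp (measurable_shift1 a.1.1)).
  by apply: measurableT_comp => //; exact: measurable_fst.
- apply: (measurableT_comp (measurable_shift1 a.1.2)).
  by apply: measurableT_comp; [exact: measurable_snd|exact: measurable_fst].
- by apply: (measurableT_comp (measurable_shift1 a.2)); exact: measurable_snd.
Qed.

(** A measure on a product is determined by its values on rectangles, so the
    product of translation-invariant measures is translation invariant. *)
Lemma vol3_shift (a : R3) (A : set T3) : measurable A ->
  vol3 (shift3 a @^-1` A) = vol3 A.
Proof.
have ms2 : measurable_fun setT (fun p : T1 * T1 => (p.1 + a.1.1, p.2 + a.1.2) : T1 * T1).
  apply: measurable_fun_pair.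
    by apply: (measurableT_comp (measurable_shift1 a.1.1)); exact: measurable_fst.
  by apply: (measurableT_comp (measurable_shift1 a.1.2)); exact: measurable_snd.
have E2 (B : set (T1 * T1)) : measurable B ->
    vol2 ((fun p : T1 * T1 => (p.1 + a.1.1, p.2 + a.1.2)) @^-1` B) = vol2 B.
  move=> mB; pose m := [the measure _ _ of pushforward (vol2 : set (T1 * T1) -> \bar R)
    (fun p : T1 * T1 => (p.1 + a.1.1, p.2 + a.1.2) : T1 * T1)].
  apply/esym; apply: (@product_measure_unique _ _ _ _ _ leb leb (m ms2)) => //.
  move=> C D mC mD; rewrite /m/= /pushforward.
  rewrite -(leb_shift a.1.1 mC) -(leb_shift a.1.2 mD).
  rewrite -[LHS]/((leb \x leb)%E (((fun t : T1 => t + a.1.1) @^-1` C) `*`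
    ((fun t : T1 => t + a.1.2) @^-1` D))) product_measure1E//.
  - by rewrite -[X in measurable X]setTI; exact: (measurable_shift1 a.1.1).
  - by rewrite -[X in measurable X]setTI; exact: (measurable_shift1 a.1.2).
move=> mA; pose m := [the measure _ _ of pushforward (vol3s : set T3 -> \bar R)
  (shift3 a)].
apply/esym; apply: (@product_measure_unique _ _ _ _ _ vol2 leb
  (m (measurable_shift3 a))) => //.
move=> C D mC mD; rewrite /m/= /pushforward.
rewrite -(leb_shift a.2 mD) -(E2 _ mC).
rewrite -[LHS]/((vol2 \x leb)%E (((fun p : T1 * T1 =>
  (p.1 + a.1.1, p.2 + a.1.2)) @^-1` C) `*`
    ((fun t : T1 => t + a.2) @^-1` D))) product_measure1E//.
- by rewrite -[X in measurable X]setTI; exact: ms2.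
- by rewrite -[X in measurable X]setTI; exact: (measurable_shift1 a.2).
Qed.

Lemma rint_shift (f : R3 -> R) (a : R3) : itg vol3 f ->
  itg vol3 (fun x => f (x + a)) ->
  \int[vol3]_x f (x + a) = \int[vol3]_x f x.
Proof.
move=> iF ifa; have mf := itg_meas iF; rewrite /Rintegral; congr fine.
pose m := [the measure _ _ of pushforward (vol3s : set T3 -> \bar R)
  (shift3 a)].
transitivity (\int[m (measurable_shift3 a)]_x (f x)%:E)%E.
  rewrite integral_pushforward//.
  - exact: measurable_shift3.
  - exact/measurable_EFinP.
by apply: eq_measure_integral => A mA _; exact: vol3_shift.
Qed.

Lemma norm_basis3 (j : 'I_3) : `|basis3 j : R3| <= 1.
Proof.
rewrite prod_normE /= prod_normE /= !ge_max.
by rewrite !ger0_norm ?ler0n// !lern1 !leq_b1.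
Qed.

Lemma is_derive_partial (f : R3 -> R) (j : 'I_3) :
  (forall x, derivable f x (basis3 j)) ->
  forall x, is_derive x (basis3 j) f (partial j f x).
Proof. by move=> df x; apply/derivableP. Qed.

Lemma support_partial (f : R3 -> R) (j : 'I_3) (M : R) :
  (forall x, M < `|x| -> f x = 0) ->
  forall x, M < `|x| -> partial j f x = 0.
Proof.
move=> fM x xM; rewrite /partial -(derive_cst (0 : R) x (basis3 j)).
apply: near_eq_derive.
near=> y; rewrite fM//; near: y.
by apply: (open_nbhs_nbhs); split=> //; apply: open_comp (@open_gt _ M) => z _;
  exact: norm_continuous.
Unshelve. all: by end_near. Qed.

Lemma bounded_support_partial (f : R3 -> R) (j : 'I_3) :
  bounded_support f -> bounded_support (partial j f).
Proof. by move=> [M fM]; exists M; exact: support_partial. Qed.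

(** The difference quotients of [f] in a coordinate direction have integral
    zero by translation invariance, are uniformly bounded with a common bounded
    support, and converge to the partial derivative. *)
Lemma rint_partial (f : R3 -> R) (j : 'I_3) :
  continuous f -> bounded_support f ->
  (forall x, derivable f x (basis3 j)) -> continuous (partial j f) ->
  \int[vol3]_x partial j f x = 0.
Proof.
move=> cf bf df cdf; have bdf := bounded_support_partial j bf.
have [B B0 fB] := cont_bounded cdf bdf.
have [M fM] := bf.
have iF := itg_cont cf bf.
pose h (n : nat) : R := n.+1%:R^-1.
have h0 n : 0 < h n by rewrite invr_gt0.
have h1 n : h n <= 1 by rewrite invf_le1// ler1n.
have csh (n : nat) : continuous (fun x : R3 => f (x + h n *: basis3 j)).
  move=> x; apply: (@continuous_comp _ _ _ (fun x : R3 => x + h n *: basis3 j) f).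
    by apply: cvgD; [exact: cvg_id|exact: cvg_cst].
  exact: cf.
have nsh n (x : R3) : M + 1 < `|x| -> M < `|x + h n *: basis3 j|.
  move=> xM; have := ler_normB (x + h n *: basis3 j) (h n *: basis3 j).
  rewrite addrK normrZ (ger0_norm (ltW (h0 n))).
  have : h n * `|basis3 j : R3| <= 1 * 1.
    by apply: ler_pM => //; [exact: ltW|exact: norm_basis3].
  lra.
have ish n : itg vol3 (fun x => f (x + h n *: basis3 j)).
  apply: itg_cont => //; exists (M + 1) => x /nsh xM.
  by rewrite fM.
pose q n (x : R3) := (h n)^-1 * (f (x + h n *: basis3 j) - f x).
have iq n : itg vol3 (q n) by apply: itgZ; apply: itgB.
have q0 n : \int[vol3]_x q n x = 0.
  rewrite rintZ; last exact: itgB.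
  by rewrite rintB// rint_shift// subrr mulr0.
have qB n x : `|q n x| <= B * \1_[set x : R3 | `|x| <= M + 1] x.
  rewrite indicE; case: (boolP (x \in _)) => [_|/negP].
    have [t _ E] := MVT_line x (h0 n) (is_derive_partial df).
    by rewrite /q [x + _]addrC E mulKf ?gt_eqF// mulr1.
  rewrite inE/= => /negP; rewrite -ltNge mulr0 /q => xM.
  rewrite fM ?nsh// fM ?subrr ?mulr0 ?normr0//.
  by rewrite (lt_trans _ xM)// ltrDl.
have qc x : q ^~ x @ \oo --> partial j f x.
  have := df x; rewrite /derivable => /cvg_dnbhs_at_right /cvg_at_rightP.
  move=> /(_ h (conj h0 (@cvg_harmonic R))).
  rewrite -/(derive _ _ _) -/(partial j f x); apply: cvg_trans.
  apply: near_eq_cvg; near=> n => /=.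
  by rewrite /q [x + _]addrC.
have [||||| _ _] := @dominated_convergence _ T3 R vol3 setT measurableT
  (fun n => EFin \o q n) (EFin \o partial j f)
  (EFin \o (fun x => B * \1_[set x : R3 | `|x| <= M + 1] x)).
- by move=> n; apply/measurable_EFinP; exact: itg_meas.
- by apply/measurable_EFinP; exact: cont_measurable3.
- by apply: aeW => x _; apply: cvg_EFin; [exact: nearW|exact: qc].
- apply: itgZ; apply/integrableP; split.
    by apply/measurable_EFinP; apply: measurable_indic; exact: box_measurable.
  under eq_integral do rewrite /= ger0_norm//.
  by rewrite integral_indic// ?setIT ?box_lty//; exact: box_measurable.
- by apply: aeW => x n _; rewrite lee_fin; exact: qB.
move=> H; rewrite /Rintegral.
rewrite (_ : (\int[vol3]_x (partial j f x)%:E)%E = 0%E)//.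
apply: (cvg_unique _ H) => //.
have E n : (\int[vol3]_x (EFin \o q n) x = 0)%E by rewrite rintE// q0.
by rewrite (_ : [sequence _]_n = fun=> 0%E); [exact: cvg_cst|apply/funext].
Unshelve. all: by end_near. Qed.

End IntegrationR3.

(** * Functions of class C^k *)

Section CkCalculus.
Context {R : realType}.
Local Notation R3 := (R * R * R)%type.
Implicit Types (f g : R3 -> R) (i j : 'I_3).

Lemma Ck_cont k f : Ck k f -> continuous f. Proof. by case: k => [[]|k []]. Qed.

Lemma CkS k f : Ck k.+1 f -> Ck k f.
Proof.
elim: k f => [|k IH] f [cf Hf]; first by split.
by split=> // i; have [di Hi] := Hf i; split=> //; exact: IH.
Qed.

Lemma Ck_der k f i : Ck k.+1 f -> forall x, derivable f x (basis3 i).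
Proof. by case=> _ /(_ i)[]. Qed.

Lemma Ck_isder k f i : Ck k.+1 f ->
  forall x, is_derive x (basis3 i) f (partial i f x).
Proof. by move=> /Ck_der df x; exact: is_derive_partial. Qed.

Lemma Ck_partial k f i : Ck k.+1 f -> Ck k (partial i f).
Proof. by case=> _ /(_ i)[]. Qed.

Lemma CkS_intro k f (df : 'I_3 -> R3 -> R) : continuous f ->
  (forall i x, is_derive x (basis3 i) f (df i x)) -> (forall i, Ck k (df i)) ->
  Ck k.+1 f.
Proof.
move=> cf dF Hk; split=> // i.
split=> [x|]; first exact: (@ex_derive _ _ _ _ _ _ _ (dF i x)).
have -> // : partial i f = df i.
by apply/funext => x; rewrite /partial; exact: (@derive_val _ _ _ _ _ _ _ (dF i x)).
Qed.

Lemma partial_val f i (a : R) x : is_derive x (basis3 i) f a ->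
  partial i f x = a.
Proof. by move=> h; rewrite /partial; exact: (@derive_val _ _ _ _ _ _ _ h). Qed.

Lemma Ck_cst k (c : R) : Ck k (fun=> c : R).
Proof.
elim: k c => [|k IH] c; first by split=> //; exact: cont_cst.
apply: (@CkS_intro _ _ (fun _ _ => 0)) => //; exact: cont_cst.
Qed.

Lemma Ck_add k f g : Ck k f -> Ck k g -> Ck k (fun x => f x + g x).
Proof.
elim: k f g => [|k IH] f g Hf Hg.
  by split=> //; apply: cont_add; [exact: (Ck_cont Hf)|exact: (Ck_cont Hg)].
apply: (@CkS_intro _ _ (fun i x => partial i f x + partial i g x)).
- by apply: cont_add; [exact: (Ck_cont Hf)|exact: (Ck_cont Hg)].
- move=> i x; exact: (derive_pt_add (Ck_isder i Hf x) (Ck_isder i Hg x)).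
- by move=> i; apply: IH; exact: Ck_partial.
Qed.

Lemma Ck_mul k f g : Ck k f -> Ck k g -> Ck k (fun x => f x * g x).
Proof.
elim: k f g => [|k IH] f g Hf Hg.
  by split=> //; apply: cont_mul; [exact: (Ck_cont Hf)|exact: (Ck_cont Hg)].
apply: (@CkS_intro _ _ (fun i x => f x * partial i g x + g x * partial i f x)).
- by apply: cont_mul; [exact: (Ck_cont Hf)|exact: (Ck_cont Hg)].
- move=> i x; exact: (derive_pt_mul (Ck_isder i Hf x) (Ck_isder i Hg x)).
- move=> i; apply: Ck_add; apply: IH;
    by [exact: CkS|exact: Ck_partial].
Qed.

Lemma Ck_scale k (c : R) f : Ck k f -> Ck k (fun x => c * f x).
Proof. by move=> Hf; apply: Ck_mul => //; exact: Ck_cst. Qed.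

Lemma Ck_opp k f : Ck k f -> Ck k (fun x => - f x).
Proof.
move=> /(Ck_scale (-1)); congr (Ck k _).
by apply/funext => x; rewrite mulN1r.
Qed.

Lemma Ck_pow k f n : Ck k f -> Ck k (fun x => f x ^+ n).
Proof.
move=> Hf; elim: n => [|n IH]; first exact: (Ck_cst k 1).
have -> : (fun x => f x ^+ n.+1) = (fun x => f x * f x ^+ n).
  by apply/funext => x; rewrite exprS.
exact: Ck_mul.
Qed.

Lemma coord3D i (x y : R3) : coord3 i (x + y) = coord3 i x + coord3 i y.
Proof. by rewrite /coord3; case: (val i) => [|[|]]. Qed.

Lemma coord3B i (x y : R3) : coord3 i (x - y) = coord3 i x - coord3 i y.
Proof. by rewrite /coord3; case: (val i) => [|[|]]. Qed.

Lemma coord3Z i (c : R) (x : R3) : coord3 i (c *: x) = c * coord3 i x.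
Proof. by rewrite /coord3; case: (val i) => [|[|]]. Qed.

Lemma coord3_basis i j : coord3 i (basis3 j : R3) = (i == j)%:R.
Proof.
rewrite /coord3 /basis3; case: i j => [[|[|[|?]]] ?] [[|[|[|?]]] ?] //=.
Qed.

Lemma cont_coord3 i : continuous (@coord3 R i).
Proof.
case: i => [[|[|[|?]]] ?] //; [exact: cont_c0|exact: cont_c1|exact: cont_c2].
Qed.

Lemma is_derive_coord3 i (c x v : R3) :
  is_derive x v (fun y : R3 => coord3 i (y - c)) (coord3 i v).
Proof.
apply: (derive_pt_line _ _ _ _).2.
have -> : (fun t : R => coord3 i (t *: v + x - c)) =
    (fun t : R => coord3 i v * t + (coord3 i x - coord3 i c)).
  by apply/funext => t; rewrite coord3B coord3D coord3Z; ring.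
have /derive_pt_eq := derive_pt_add (derive_pt_scale (coord3 i v)
  (is_derive_id (0 : R) 1)) (is_derive_cst (coord3 i x - coord3 i c) (0 : R) 1).
by apply; rewrite mulr1 addr0.
Qed.

Lemma Ck_coord3 k i (c : R3) : Ck k (fun y : R3 => coord3 i (y - c)).
Proof.
have cc : continuous (fun y : R3 => coord3 i (y - c)).
  have -> : (fun y : R3 => coord3 i (y - c)) = (fun y => coord3 i y - coord3 i c).
    by apply/funext => y; rewrite coord3B.
  by apply: cont_sub; [exact: cont_coord3|exact: cont_cst].
case: k => [|k]; first by split.
apply: (@CkS_intro _ _ (fun j _ => coord3 i (basis3 j))) => //.
- by move=> j x; exact: is_derive_coord3.
- by move=> j; exact: Ck_cst.
Qed.

Lemma sum3 (F : 'I_3 -> R) : \sum_(i < 3) F i =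
  F (@Ordinal 3 0 isT) + F (@Ordinal 3 1 isT) + F (@Ordinal 3 2 isT).
Proof.
rewrite !big_ord_recl big_ord0 addr0 addrA; congr (_ + _ + _); congr F;
  exact: val_inj.
Qed.

Lemma sq3E (z : R3) : sq3 z = \sum_(i < 3) coord3 i z ^+ 2.
Proof. by rewrite sum3. Qed.

Lemma is_derive_sq3 (c x v : R3) :
  is_derive x v (fun y : R3 => sq3 (y - c)) (2 * dot3 (x - c) v).
Proof.
have /derive_pt_eq := derive_pt_add (derive_pt_add
  (derive_pt_pow 2 (is_derive_coord3 (@Ordinal 3 0 isT) c x v))
  (derive_pt_pow 2 (is_derive_coord3 (@Ordinal 3 1 isT) c x v)))
  (derive_pt_pow 2 (is_derive_coord3 (@Ordinal 3 2 isT) c x v)).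
by apply; rewrite /dot3 sum3/=; ring.
Qed.

Lemma dot3_basis (z : R3) j : dot3 z (basis3 j) = coord3 j z.
Proof.
rewrite /dot3 (bigD1 j)//= coord3_basis eqxx mulr1 big1 ?addr0// => i ij.
by rewrite coord3_basis (negPf ij) mulr0.
Qed.

Lemma Ck_sq3 k (c : R3) : Ck k (fun y : R3 => sq3 (y - c)).
Proof.
apply: Ck_add; first apply: Ck_add; apply: Ck_pow.
- exact: (Ck_coord3 k (@Ordinal 3 0 isT) c).
- exact: (Ck_coord3 k (@Ordinal 3 1 isT) c).
- exact: (Ck_coord3 k (@Ordinal 3 2 isT) c).
Qed.

Definition rsqrt (t : R) : R := (Num.sqrt t)^-1.

Lemma rsqrt_gt0 (t : R) : 0 < t -> 0 < rsqrt t.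
Proof. by move=> t0; rewrite invr_gt0 sqrtr_gt0. Qed.

Lemma rsqrt_sqr (t : R) : 0 < t -> rsqrt t ^+ 2 = t^-1.
Proof. by move=> t0; rewrite exprVn sqr_sqrtr// ltW. Qed.

Lemma is_derive_rsqrt (t : R) : 0 < t ->
  is_derive t 1 rsqrt (- 2^-1 * rsqrt t ^+ 3).
Proof.
move=> t0; have s0 : Num.sqrt t != 0 by rewrite gt_eqF// sqrtr_gt0.
have /derive_pt_eq := is_deriveV s0 (is_derive1_sqrt t0).
apply; rewrite /rsqrt /GRing.scale/= -!exprVn; field.
exact: s0.
Qed.

(** The derivative of [f^(-1/2)] is [-1/2 f' (f^(-1/2))^3], so smoothness
    propagates by induction on the order. *)
Lemma Ck_rsqrt k f : Ck k f -> (forall x, 0 < f x) ->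
  Ck k (fun x => rsqrt (f x)).
Proof.
move=> Hf f0; have cf := Ck_cont Hf.
have cs : continuous (fun x => rsqrt (f x)).
  apply: cont_inv; last by move=> x; rewrite gt_eqF// sqrtr_gt0.
  exact: (cont_comp (@sqrt_continuous R) cf).
elim: k Hf => [|k IH] Hf; first by split.
apply: (@CkS_intro _ _ (fun i x => - 2^-1 * rsqrt (f x) ^+ 3 * partial i f x)).
- exact: cs.
- move=> i x; apply: (derive_pt_comp (is_derive_rsqrt (f0 x))).
  exact: (Ck_isder i Hf x).
- move=> i; apply: Ck_mul; last exact: Ck_partial.
  by apply: Ck_scale; apply: Ck_pow; apply: IH; exact: CkS.
Qed.

Lemma Ck_inv k f : Ck k f -> (forall x, 0 < f x) -> Ck k (fun x => (f x)^-1).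
Proof.
move=> Hf f0; have -> : (fun x => (f x)^-1) = (fun x => rsqrt (f x) ^+ 2).
  by apply/funext => x; rewrite rsqrt_sqr.
by apply: Ck_pow; exact: Ck_rsqrt.
Qed.

End CkCalculus.

(** * Cutoff functions and the regularized kernel *)

Section FlatFunctions.
Context {R : realType}.

(** Up to sign, all the derivatives of [exp (-1/t)] are combinations of the
    functions [t^(-n) exp (-1/t)], which vanish to infinite order at [0]. *)
Definition flat (n : nat) (t : R) : R :=
  if 0 < t then t^-1 ^+ n * expR (- t^-1) else 0.

Lemma flat_ge0 n t : 0 <= flat n t.
Proof.
rewrite /flat; case: ifP => // t0.
by rewrite mulr_ge0 ?expR_ge0// exprn_ge0// invr_ge0 ltW.
Qed.

Lemma flat_gt0 n t : 0 < t -> 0 < flat n t.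
Proof.
move=> t0; rewrite /flat t0 mulr_gt0 ?expR_gt0// exprn_gt0// invr_gt0//.
Qed.

Lemma flat_le0 n t : t <= 0 -> flat n t = 0.
Proof. by rewrite /flat leNgt => /negPf ->. Qed.

Lemma flat_bound n t : 0 < t -> flat n t <= (n.+2)`!%:R * t ^+ 2.
Proof.
move=> t0; rewrite /flat t0 expRN.
have s0 : 0 < t^-1 by rewrite invr_gt0.
rewrite ler_pdivrMr ?expR_gt0//.
have := expR_ge1Dxn n.+1 (ltW s0).
have F0 : 0 < (n.+2)`!%:R :> R by rewrite ltr0n fact_gt0.
move=> /(le_trans (_ : t^-1 ^+ n.+2 / (n.+2)`!%:R <= _)) H.
have {}H : t^-1 ^+ n.+2 / (n.+2)`!%:R <= expR t^-1.
  by apply: H; rewrite lerDr.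
move: H; rewrite ler_pdivrMr// mulrC => H.
apply: le_trans (_ : t ^+ 2 * ((n.+2)`!%:R * expR t^-1) <= _); last first.
  by rewrite mulrCA mulrA.
rewrite -ler_pdivrMl ?exprn_gt0//; apply: le_trans H.
by rewrite -exprVn -exprD.
Qed.

Lemma is_derive_flat n (t : R) :
  is_derive t 1 (flat n) (flat n.+2 t - n%:R * flat n.+1 t).
Proof.
have [t0|t0|->] := ltgtP t 0.
- rewrite !flat_le0 ?ltW// mulr0 subr0.
  have dc := is_derive_cst (0 : R) t (1 : R).
  apply: (near_eq_is_derive _ dc).
  by near=> y; rewrite flat_le0//; apply: ltW; near: y; exact: lt_nbhsl.
- have := @is_deriveV _ id t 1 1; rewrite gt_eqF// => /(_ isT (is_derive_id t 1)).
  move=> dV; have /derive_pt_eq := derive_pt_mul (derive_pt_pow n dV)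
    (@derive_pt_comp R _ expR (fun y : R => - y^-1) t 1 _ _
      (is_derive_expR (- t^-1)) (derive_pt_opp dV)).
  move=> /(_ (flat n.+2 t - n%:R * flat n.+1 t)) H.
  apply: (near_eq_is_derive _ (H _)).
    by near=> y; rewrite /flat ifT//; near: y; exact: lt_nbhsr.
  rewrite /flat t0 /GRing.scale/= -exprVn.
  by case: n {H} => [|n] /=; rewrite ?expr0 -?natr1 !exprS; ring.
- rewrite !flat_le0// mulr0 subr0.
  suff H : (fun h : R => h^-1 *: (flat n (h *: (1 : R) + 0) - flat n 0)) @ 0^' --> (0 : R).
    split; first by apply/cvg_ex; exists 0.
    exact: (cvg_lim _ H).
  apply/cvgr0Pnorm_le => e e0; near=> h.
  rewrite addr0 (flat_le0 n (lexx 0)) subr0.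
  rewrite (_ : h *: (1 : R) = h); last exact: mulr1.
  have F0 : 0 < (n.+2)`!%:R :> R by rewrite ltr0n fact_gt0.
  have he : `|h| <= e / (n.+2)`!%:R.
    near: h; apply: dnbhs0_le; rewrite divr_gt0//.
  have [h0|h0] := ltP 0 h; last by rewrite flat_le0// scaler0 normr0 ltW.
  rewrite normrZ !ger0_norm ?flat_ge0 ?invr_ge0 ?(ltW h0)//.
  rewrite ler_pdivrMl//; apply: le_trans (flat_bound n h0) _.
  rewrite gtr0_norm// ler_pdivlMr// in he.
  by rewrite expr2 mulrCA ler_pM2l// mulrC.
Unshelve. all: by end_near. Qed.

Lemma cont_flat n : continuous (flat n).
Proof. exact: is_derive_continuous (is_derive_flat n). Qed.

End FlatFunctions.

Section Cutoff.
Context {R : realType}.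
Local Notation R3 := (R * R * R)%type.

Lemma Ck_flat k n (f : R3 -> R) : Ck k f -> Ck k (fun x => flat n (f x)).
Proof.
elim: k n => [|k IH] n Hf.
  by split=> //; exact: (cont_comp (@cont_flat R n) (Ck_cont Hf)).
apply: (@CkS_intro _ _ _
  (fun i x => (flat n.+2 (f x) - n%:R * flat n.+1 (f x)) * partial i f x)).
- exact: (cont_comp (@cont_flat R n) (Ck_cont Hf)).
- move=> i x; apply: (derive_pt_comp (is_derive_flat n (f x))).
  exact: (Ck_isder i Hf x).
- move=> i; apply: Ck_mul; last exact: Ck_partial.
  by apply: Ck_add; [|apply: Ck_opp; apply: Ck_scale]; apply: IH; exact: CkS.
Qed.

(** With [a] positive exactly inside the large ball and [b] positive exactly
    outside the small closed one, [a / (a + b)] is a cutoff function. *)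
Lemma cutoff_exists (D : R) : 0 < D -> exists chi : R3 -> R,
  [/\ forall k, Ck k chi, forall x, sq3 x <= D ^+ 2 -> chi x = 1
    & forall x, (2 * D) ^+ 2 <= sq3 x -> chi x = 0].
Proof.
move=> D0.
pose a (x : R3) : R := flat 0 ((2 * D) ^+ 2 - sq3 (x - 0)).
pose b (x : R3) : R := flat 0 (sq3 (x - 0) - D ^+ 2).
have ab0 x : 0 < a x + b x.
  have [h|h] := ltP (sq3 (x - 0)) ((2 * D) ^+ 2).
    by rewrite ltr_wpDr ?flat_ge0// flat_gt0// subr_gt0.
  rewrite ltr_wpDl ?flat_ge0// flat_gt0// subr_gt0 (lt_le_trans _ h)//.
  by nra.
have Ca k : Ck k a.
  by apply: Ck_flat; apply: Ck_add; [exact: Ck_cst|apply: Ck_opp; exact: Ck_sq3].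
have Cb k : Ck k b.
  by apply: Ck_flat; apply: Ck_add; [exact: Ck_sq3|exact: Ck_cst].
exists (fun x => a x * (a x + b x)^-1); split=> [k|x h|x h].
- by apply: Ck_mul => //; apply: Ck_inv => //; exact: Ck_add.
- have -> : b x = 0 by rewrite /b flat_le0// subr0 subr_le0.
  rewrite addr0 divff// gt_eqF//; have := ab0 x.
  by rewrite {1}(_ : b x = 0) ?addr0// /b flat_le0// subr0 subr_le0.
- by rewrite {1}/a flat_le0 ?mul0r// subr0 subr_le0.
Qed.

End Cutoff.

Section Kernel.
Context {R : realType}.
Local Notation R3 := (R * R * R)%type.
Variable (e : R).
Hypothesis e0 : 0 < e.
Implicit Types (c x z : R3) (i j : 'I_3).

Lemma sq3_ge0 z : 0 <= sq3 z.
Proof. by rewrite /sq3 !addr_ge0 ?sqr_ge0. Qed.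

(** The Coulomb potential [1 / |z|], regularized at scale [e] so that all kernels
    are smooth and bounded. Then [kerv] is minus its gradient, the kernel of the
    Biot-Savart law, and [kerd i j] is the derivative of [kerv j] along
    [basis3 i]. *)
Definition ker (z : R3) : R := rsqrt (sq3 z + e ^+ 2).
Definition kerv j (z : R3) : R := coord3 j z * ker z ^+ 3.
Definition kerd i j (z : R3) : R :=
  (i == j)%:R * ker z ^+ 3 - 3 * (coord3 i z * coord3 j z) * ker z ^+ 5.

Lemma ker_arg_gt0 z : 0 < sq3 z + e ^+ 2.
Proof. by rewrite ltr_wpDl ?sq3_ge0// exprn_gt0. Qed.

Lemma ker_gt0 z : 0 < ker z. Proof. by rewrite rsqrt_gt0// ker_arg_gt0. Qed.

Lemma ker_sqr z : ker z ^+ 2 * (sq3 z + e ^+ 2) = 1.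
Proof. by rewrite rsqrt_sqr ?mulVf// ?gt_eqF// ker_arg_gt0. Qed.

Lemma ker_le z : ker z <= e^-1.
Proof.
rewrite -ler_sqr ?nnegrE ?invr_ge0 ?(ltW e0) ?(ltW (ker_gt0 z))//.
rewrite rsqrt_sqr ?ker_arg_gt0// exprVn lef_pV2 ?posrE ?exprn_gt0 ?ker_arg_gt0//.
by rewrite lerDr sq3_ge0.
Qed.

Lemma Ck_ker k c : Ck k (fun y => ker (y - c)).
Proof.
apply: Ck_rsqrt; last by move=> x; exact: ker_arg_gt0.
by apply: Ck_add; [exact: Ck_sq3|exact: Ck_cst].
Qed.

Lemma Ck_kerv k j c : Ck k (fun y => kerv j (y - c)).
Proof.
by apply: Ck_mul; [exact: Ck_coord3|apply: Ck_pow; exact: Ck_ker].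
Qed.

Lemma Ck_kerd k i j c : Ck k (fun y => kerd i j (y - c)).
Proof.
apply: Ck_add.
  by apply: Ck_mul; [exact: Ck_cst|apply: Ck_pow; exact: Ck_ker].
apply: Ck_opp; apply: Ck_mul; last by apply: Ck_pow; exact: Ck_ker.
by apply: Ck_scale; apply: Ck_mul; exact: Ck_coord3.
Qed.

Lemma is_derive_ker i c x :
  is_derive x (basis3 i) (fun y => ker (y - c))
    (- (coord3 i (x - c) * ker (x - c) ^+ 3)).
Proof.
have /derive_pt_eq := @derive_pt_comp R _ rsqrt
  (fun y : R3 => sq3 (y - c) + e ^+ 2) x (basis3 i) _ _
  (is_derive_rsqrt (ker_arg_gt0 (x - c)))
  (derive_pt_add (is_derive_sq3 c x (basis3 i)) (is_derive_cst (e ^+ 2) x _)).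
by apply; rewrite dot3_basis addr0 -/(ker _); field.
Qed.

Lemma is_derive_kerv i j c x :
  is_derive x (basis3 i) (fun y => kerv j (y - c)) (kerd i j (x - c)).
Proof.
have /derive_pt_eq := derive_pt_mul (is_derive_coord3 j c x (basis3 i))
  (derive_pt_pow 3 (is_derive_ker i c x)).
by apply; rewrite /kerd coord3_basis eq_sym /=; ring.
Qed.

(** The divergence of [kerv] is concentrated near the origin; without the
    regularization it is [4 pi] times a Dirac mass. *)
Lemma kerd_div z : \sum_(j < 3) kerd j j z = 3 * e ^+ 2 * ker z ^+ 5.
Proof.
have -> : 3 * e ^+ 2 * ker z ^+ 5 = 3 * e ^+ 2 * ker z ^+ 5
  + 3 * ker z ^+ 3 * (1 - ker z ^+ 2 * (sq3 z + e ^+ 2)).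
  by rewrite ker_sqr subrr mulr0 addr0.
by rewrite sum3 /kerd !eqxx !mul1r sq3E sum3; ring.
Qed.

Lemma sq3N z : sq3 (- z) = sq3 z.
Proof. by rewrite /sq3 /=; ring. Qed.

Lemma kerN z : ker (- z) = ker z. Proof. by rewrite /ker sq3N. Qed.

Lemma coord3N i z : coord3 i (- z) = - coord3 i z.
Proof. by rewrite /coord3; case: (val i) => [|[|]]. Qed.

Lemma kerdN i j z : kerd i j (- z) = kerd i j z.
Proof. by rewrite /kerd kerN !coord3N mulrNN. Qed.

Lemma kerv_sqr z : \sum_(j < 3) kerv j z ^+ 2 <= (ker z ^+ 2) ^+ 2.
Proof.
have -> : \sum_(j < 3) kerv j z ^+ 2 = (ker z ^+ 2) ^+ 2 *
   (1 - e ^+ 2 * ker z ^+ 2).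
  rewrite (_ : 1 - e ^+ 2 * ker z ^+ 2 = sq3 z * ker z ^+ 2); last first.
    by rewrite -(ker_sqr z); ring.
  by rewrite sum3 /kerv sq3E sum3; ring.
by rewrite ler_piMr ?sqr_ge0// gerBl mulr_ge0 ?sqr_ge0.
Qed.

End Kernel.

(** * Radial integrals and rearrangement *)

Section RadialIntegrals.
Context {R : realType}.
Local Notation R3 := (R * R * R)%type.
Local Notation T3 := (measurableTypeR R * measurableTypeR R * measurableTypeR R)%type.
Local Notation V r := (4 / 3 * pi * r ^+ 3 : R).

(** Summing the two bounds over a uniform subdivision of [0, r], the total gap
    telescopes to (p 0 - p r) times the mesh. *)
Lemma increments_le (F G W p : R -> R) (C r : R) : 0 <= r ->
  (forall a b, 0 <= a -> a <= b -> b <= r -> p b <= p a) ->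
  (forall a b, 0 <= a -> a <= b -> b <= r -> 0 <= W b - W a <= C * (b - a)) ->
  (forall a b, 0 <= a -> a <= b -> b <= r -> F b - F a <= p a * (W b - W a)) ->
  (forall a b, 0 <= a -> a <= b -> b <= r -> p b * (W b - W a) <= G b - G a) ->
  F r - F 0 <= G r - G 0.
Proof.
move=> r0 pd WC Fp Gp.
have step n : (F r - F 0) - (G r - G 0) <= (p 0 - p r) * (C * (r / n.+1%:R)).
  pose h := r / n.+1%:R; have h0 : 0 <= h by rewrite divr_ge0.
  have hr k : (k <= n.+1)%N -> k%:R * h <= r.
    move=> kn; rewrite /h mulrCA -[leRHS]mulr1 ler_wpM2l//.
    by rewrite ler_pdivrMr// mul1r ler_nat.
  have key k : (k <= n.+1)%N ->
      (F (k%:R * h) - F 0) - (G (k%:R * h) - G 0) <=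
      (p 0 - p (k%:R * h)) * (C * h).
    elim: k => [|k IH] kn; first by rewrite !mul0r !subrr mul0r.
    have a0 : 0 <= k%:R * h by rewrite mulr_ge0.
    have hS : k.+1%:R * h - k%:R * h = h by rewrite -mulrBl -natrB// subSnn mul1r.
    have ab : k%:R * h <= k.+1%:R * h by rewrite -subr_ge0 hS.
    have br := hr _ kn.
    have := IH (ltnW kn); have := Fp _ _ a0 ab br; have := Gp _ _ a0 ab br.
    have := WC _ _ a0 ab br; have := pd _ _ a0 ab br; rewrite hS.
    move: (k.+1%:R * h) (k%:R * h) => b a {IH hS}.
    move=> h1 /andP[h2 h3] h4 h5 h6.
    have : (p a - p b) * (W b - W a) <= (p a - p b) * (C * h).
      by rewrite ler_wpM2l// subr_ge0.
    lra.
  have := key _ (leqnn _); rewrite (_ : n.+1%:R * h = r)//.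
  by rewrite /h mulrC divfK.
rewrite -subr_le0 leNgt; apply/negP => d0.
set d := _ - _ in d0 step; set c := (p 0 - p r) * (C * r).
have c0 : 0 <= c.
  have := WC _ _ (lexx 0) r0 (lexx r); have := pd _ _ (lexx 0) r0 (lexx r).
  rewrite subr0 => h1 /andP[h2 h3]; rewrite mulr_ge0 ?subr_ge0//.
  exact: le_trans h3.
have c1 : 0 < c + 1 by rewrite ltr_wpDl.
have [n] := ltr_add_invr (divr_gt0 d0 c1); rewrite add0r ltr_pdivlMr// => H.
have := step n; have -> : (p 0 - p r) * (C * (r / n.+1%:R)) = c / n.+1%:R.
  by rewrite /c -!mulrA.
rewrite mulrC => h2; have := lt_le_trans H h2.
by rewrite mulrDr mulr1 ltNge lerDl invr_ge0 ler0n.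
Qed.

Lemma mem_eball (y x : R3) (r : R) : (x \in eball y r) = (sq3 (x - y) < r ^+ 2).
Proof. by apply/idP/idP => [/set_mem//|h]; exact: mem_set. Qed.

Lemma itg_indic (A : set R3) : measurable (A : set T3) -> (vol3 A < +oo)%E ->
  itg vol3 (\1_A : R3 -> R).
Proof.
move=> mA A0; apply: (@itg_fin _ T3 R vol3 A 1) => //.
- by move=> x; rewrite indicE; case: (_ \in _); rewrite ?normr1 ?normr0.
- by move=> x Ax; rewrite indicE memNset.
Qed.

Lemma rint_indic (A : set R3) : measurable (A : set T3) ->
  \int[vol3]_x (\1_A x : R) = fine (vol3 A).
Proof. by move=> mA; rewrite /Rintegral integral_indic// setIT. Qed.

Lemma eball_lty (y : R3) (r : R) : (vol3 (eball y r) < +oo)%E.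
Proof.
have -> : eball y r = eball y `|r| by rewrite /eball real_normK ?num_real.
by rewrite vol3_eball// ltry.
Qed.

Lemma itg_eball (y : R3) (r : R) : itg vol3 (\1_(eball y r) : R3 -> R).
Proof. by apply: itg_indic; [exact: eball_measurable|exact: eball_lty]. Qed.

Lemma rint_eball (y : R3) (r : R) : 0 <= r ->
  \int[vol3]_x (\1_(eball y r) x : R) = V r.
Proof. by move=> r0; rewrite rint_indic ?vol3_eball//; exact: eball_measurable. Qed.

Lemma V_increment (a b r : R) : 0 <= a -> a <= b -> b <= r ->
  0 <= V b - V a <= (4 * pi * r ^+ 2) * (b - a).
Proof.
move=> a0 ab br; have p0 := pi_gt0 R.
have -> : V b - V a = 4 / 3 * pi * ((b - a) * (b ^+ 2 + a * b + a ^+ 2)) by ring.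
have -> : 4 * pi * r ^+ 2 * (b - a) = 4 / 3 * pi * ((b - a) * (3 * r ^+ 2)).
  by field.
have p1 : 0 <= 4 / 3 * pi :> R by rewrite mulr_ge0 ?divr_ge0 ?ltW.
apply/andP; split.
  by rewrite mulr_ge0// mulr_ge0 ?subr_ge0//; nra.
by rewrite ler_wpM2l// ler_wpM2l ?subr_ge0//; nra.
Qed.

Variables (q : R -> R) (B : R).
Hypothesis q_cont : forall y : R3, continuous (fun x : R3 => q (sq3 (x - y))).
Hypothesis q_noninc : forall s t, 0 <= s -> s <= t -> q t <= q s.
Hypothesis q_bound : forall t, 0 <= t -> `|q t| <= B.

Lemma itg_radial (A : set R3) (y : R3) : measurable (A : set T3) ->
  (vol3 A < +oo)%E -> itg vol3 (fun x => q (sq3 (x - y)) * \1_A x).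
Proof.
move=> mA A0; apply: (@itg_bdM _ T3 R vol3 B).
- by apply: cont_measurable3; exact: q_cont.
- by move=> x; apply: q_bound; exact: sq3_ge0.
- exact: itg_indic.
Qed.

Let Phi (y : R3) (r : R) := \int[vol3]_x (q (sq3 (x - y)) * \1_(eball y r) x).

(** On the shell between the radii [a] and [b] the integrand lies between its
    values at the two radii. *)
Lemma radial_increment (y : R3) (a b : R) : 0 <= a -> a <= b ->
  q (b ^+ 2) * (V b - V a) <= Phi y b - Phi y a <= q (a ^+ 2) * (V b - V a).
Proof.
move=> a0 ab; have b0 := le_trans a0 ab.
have ie r := @itg_eball y r.
have iq r : itg vol3 (fun x => q (sq3 (x - y)) * \1_(eball y r) x).
  by apply: itg_radial; [exact: eball_measurable|exact: eball_lty].
rewrite -!(rint_eball y)// -rintB// -rintB// -!rintZ; try exact: itgB.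
have ab2 : a ^+ 2 <= b ^+ 2 by rewrite ler_sqr ?nnegrE.
apply/andP; split; apply: rint_le;
  try (by apply: itgZ; exact: itgB); try (by apply: itgB) => x.
all: move=> x; rewrite -mulrBr !indicE !mem_eball.
all: have s0 := sq3_ge0 (x - y).
all: have [h1|h1] := ltP (sq3 (x - y)) (a ^+ 2);
  [by rewrite (lt_le_trans h1 ab2) !subrr !mulr0|].
all: rewrite subr0; have [h2|h2] := ltP (sq3 (x - y)) (b ^+ 2); rewrite ?mulr0//.
all: by rewrite !mulr1; apply: q_noninc; rewrite ?sqr_ge0// ltW.
Qed.

Let Phi0 (y : R3) : Phi y 0 = 0.
Proof.
rewrite -[RHS](rint0 vol3); apply: eq_Rintegral => x _.
by rewrite indicE mem_eball expr0n/= ltNge sq3_ge0 mulr0.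
Qed.

Let q_sqr a b : 0 <= a -> a <= b -> q (b ^+ 2) <= q (a ^+ 2).
Proof.
move=> a0 ab; apply: q_noninc; first exact: sqr_ge0.
by rewrite ler_sqr ?nnegrE// (le_trans a0).
Qed.

Lemma radial_le (G : R -> R) (y : R3) (r : R) : 0 <= r ->
  (forall a b, 0 <= a -> a <= b -> q (b ^+ 2) * (V b - V a) <= G b - G a) ->
  \int[vol3]_x (q (sq3 (x - y)) * \1_(eball y r) x) <= G r - G 0.
Proof.
move=> r0 Gq; suff : Phi y r - Phi y 0 <= G r - G 0 by rewrite Phi0 subr0.
apply: (@increments_le (Phi y) G (fun r => V r) (fun r => q (r ^+ 2))
  (4 * pi * r ^+ 2) r) => //.
- by move=> a b a0 ab _; exact: q_sqr.
- by move=> a b a0 ab br; exact: V_increment.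
- by move=> a b a0 ab _; have /andP[] := radial_increment y a0 ab.
- by move=> a b a0 ab _; exact: Gq.
Qed.

Lemma radial_ge (G : R -> R) (y : R3) (r : R) : 0 <= r ->
  (forall a b, 0 <= a -> a <= b -> G b - G a <= q (a ^+ 2) * (V b - V a)) ->
  G r - G 0 <= \int[vol3]_x (q (sq3 (x - y)) * \1_(eball y r) x).
Proof.
move=> r0 Gq; suff : G r - G 0 <= Phi y r - Phi y 0 by rewrite Phi0 subr0.
apply: (@increments_le G (Phi y) (fun r => V r) (fun r => q (r ^+ 2))
  (4 * pi * r ^+ 2) r) => //.
- by move=> a b a0 ab _; exact: q_sqr.
- by move=> a b a0 ab br; exact: V_increment.
- by move=> a b a0 ab _; exact: Gq.
- by move=> a b a0 ab _; have /andP[] := radial_increment y a0 ab.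
Qed.

(** The bathtub principle: the constant [q (r^2)] has the same integral over both
    sets, and [q] is above it inside the ball and below it outside. *)
Lemma bathtub (A : set R3) (y : R3) (r : R) : 0 <= r ->
  measurable (A : set T3) -> vol3 A = (V r)%:E ->
  \int[vol3]_x (q (sq3 (x - y)) * \1_A x) <=
  \int[vol3]_x (q (sq3 (x - y)) * \1_(eball y r) x).
Proof.
move=> r0 mA Ar; have A0 : (vol3 A < +oo)%E by rewrite Ar ltry.
have iA := itg_indic mA A0; have iB := itg_eball y r.
have iqA := itg_radial y mA A0.
have iqB : itg vol3 (fun x => q (sq3 (x - y)) * \1_(eball y r) x).
  by apply: itg_radial; [exact: eball_measurable|exact: eball_lty].
rewrite -subr_le0 -rintB//.
have E : \int[vol3]_x (q (r ^+ 2) * (\1_A x - \1_(eball y r) x)) = 0.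
  rewrite rintZ; last exact: itgB.
  by rewrite rintB// rint_eball// rint_indic// Ar/= subrr mulr0.
rewrite -E; apply: rint_le; [exact: itgB|by apply: itgZ; exact: itgB|move=> x].
rewrite -mulrBr !indicE mem_eball.
have s0 := sq3_ge0 (x - y).
have [h|h] := ltP (sq3 (x - y)) (r ^+ 2); case: (_ \in A);
  rewrite ?subrr ?mulr0// ?sub0r ?subr0 ?mulr1 ?mulrN1 ?lerN2.
  by apply: q_noninc => //; exact: ltW.
by apply: q_noninc => //; exact: sqr_ge0.
Qed.

End RadialIntegrals.

Section KernelIntegrals.
Context {R : realType}.
Local Notation R3 := (R * R * R)%type.
Local Notation T3 := (measurableTypeR R * measurableTypeR R * measurableTypeR R)%type.
Local Notation V r := (4 / 3 * pi * r ^+ 3 : R).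
Variable (e : R).
Hypothesis e0 : 0 < e.

Lemma rsqrt_noninc (s t : R) : 0 < s -> s <= t -> rsqrt t <= rsqrt s.
Proof.
move=> s0 st; have t0 := lt_le_trans s0 st.
by rewrite /rsqrt lef_pV2 ?posrE ?sqrtr_gt0// ler_wsqrtr.
Qed.

Lemma rsqrt_pow_bound n (t : R) : 0 <= t ->
  `|rsqrt (t + e ^+ 2) ^+ n| <= e^-1 ^+ n.
Proof.
move=> t0; have e20 : 0 < e ^+ 2 by rewrite exprn_gt0.
rewrite ger0_norm ?exprn_ge0 ?invr_ge0 ?sqrtr_ge0//.
rewrite lerXn2r ?nnegrE ?invr_ge0 ?sqrtr_ge0 ?(ltW e0)//.
have -> : e^-1 = rsqrt (e ^+ 2) by rewrite /rsqrt sqrtr_sqr gtr0_norm.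
by apply: rsqrt_noninc => //; rewrite lerDr.
Qed.

Lemma rsqrt_pow_noninc n (s t : R) : 0 <= s -> s <= t ->
  rsqrt (t + e ^+ 2) ^+ n <= rsqrt (s + e ^+ 2) ^+ n.
Proof.
move=> s0 st; rewrite lerXn2r ?nnegrE ?invr_ge0 ?sqrtr_ge0//.
by apply: rsqrt_noninc; rewrite ?lerD2r// ltr_wpDl// exprn_gt0.
Qed.

Lemma cont_rsqrt_pow n (y : R3) :
  continuous (fun x : R3 => rsqrt (sq3 (x - y) + e ^+ 2) ^+ n).
Proof. exact: (Ck_cont (Ck_pow n (Ck_ker e0 0 y))). Qed.

(** The unregularized integral of [|x - y|^(-2)] equals [4 pi r]. *)
Lemma ker2_ball (y : R3) (r : R) : 0 <= r ->
  \int[vol3]_x (ker e (x - y) ^+ 2 * \1_(eball y r) x) <= 4 * pi * r.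
Proof.
move=> r0; have p0 := pi_gt0 R.
have := @radial_le _ (fun t => rsqrt (t + e ^+ 2) ^+ 2) (e^-1 ^+ 2)
  (@cont_rsqrt_pow 2) (@rsqrt_pow_noninc 2) (@rsqrt_pow_bound 2)
  (fun r => 4 * pi * r) y r r0.
rewrite mulr0 subr0; apply => a b a0 ab.
have b0 : 0 < b ^+ 2 + e ^+ 2 by rewrite ltr_wpDl ?sqr_ge0// exprn_gt0.
rewrite rsqrt_sqr// mulrC ler_pdivrMr//.
have -> : V b - V a = 4 * pi * ((b - a) * ((b ^+ 2 + a * b + a ^+ 2) / 3)) by field.
have -> : (4 * pi * b - 4 * pi * a) * (b ^+ 2 + e ^+ 2) =
  4 * pi * ((b - a) * (b ^+ 2 + e ^+ 2)) by ring.
rewrite ler_pM2l ?mulr_gt0// ler_wpM2l ?subr_ge0//.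
by have := sqr_ge0 e; nra.
Qed.

(** By rearrangement the ball centred at [y] is the worst case; this is where the
    volume of the domain enters. *)
Lemma ker2_domain (A : set R3) (y : R3) (r : R) : 0 <= r ->
  measurable (A : set T3) -> vol3 A = (V r)%:E ->
  \int[vol3]_x (ker e (x - y) ^+ 2 * \1_A x) <= 4 * pi * r.
Proof.
move=> r0 mA Ar; apply: le_trans (ker2_ball y r0).
exact: (@bathtub _ (fun t => rsqrt (t + e ^+ 2) ^+ 2) (e^-1 ^+ 2)
  (@cont_rsqrt_pow 2) (@rsqrt_pow_noninc 2) (@rsqrt_pow_bound 2)).
Qed.

(** [G r = 4 pi r^3 (r^2 + e^2)^(-3/2)] is the flux of the regularized field
    through the sphere of radius [r], and [G' = 4 pi r^2 p]. *)
Let G (r : R) := 4 * pi * (r ^+ 3 * rsqrt (r ^+ 2 + e ^+ 2) ^+ 3).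
Let p (r : R) := 3 * e ^+ 2 * rsqrt (r ^+ 2 + e ^+ 2) ^+ 5.

Let is_derive_G (r : R) : is_derive r 1 G (4 * pi * r ^+ 2 * p r).
Proof.
have a0 : 0 < r ^+ 2 + e ^+ 2 by rewrite ltr_wpDl ?sqr_ge0// exprn_gt0.
have ds := @derive_pt_comp R _ rsqrt (fun r : R => r ^+ 2 + e ^+ 2) r 1 _ _
  (is_derive_rsqrt a0) (derive_pt_add (derive_pt_pow 2 (is_derive_id r 1))
    (is_derive_cst (e ^+ 2) r 1)).
have /derive_pt_eq := derive_pt_scale (4 * pi) (derive_pt_mul
  (derive_pt_pow 3 (is_derive_id r 1)) (derive_pt_pow 3 ds)).
apply; rewrite /p /=.
have := rsqrt_sqr a0; set s := rsqrt _ => sE.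
have E : s ^+ 2 * (r ^+ 2 + e ^+ 2) = 1 by rewrite sE mulVf// gt_eqF.
transitivity (12 * pi * r ^+ 2 * s ^+ 3 * (1 - r ^+ 2 * s ^+ 2)).
  by field.
have -> : 1 - r ^+ 2 * s ^+ 2 = e ^+ 2 * s ^+ 2 by rewrite -[X in X - _]E; ring.
ring.
Qed.

Let G_sandwich (a b : R) : 0 <= a -> a <= b ->
  p b * (V b - V a) <= G b - G a <= p a * (V b - V a).
Proof.
move=> a0; rewrite le_eqVlt => /predU1P[<-|ab]; first by rewrite !subrr !mulr0 lexx.
have dV (r : R) : is_derive r 1 (fun r : R => V r) (4 * pi * r ^+ 2).
  have /derive_pt_eq := derive_pt_scale (4 / 3 * pi)
    (derive_pt_pow 3 (is_derive_id r 1)).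
  by apply=> /=; field.
have dH (c r : R) := derive_pt_sub (is_derive_G r) (derive_pt_scale c (dV r)).
have pn (s t : R) : 0 <= s -> s <= t -> p t <= p s.
  move=> s0 st; apply: ler_wpM2l; first by rewrite mulr_ge0 ?sqr_ge0.
  apply: rsqrt_pow_noninc; first exact: sqr_ge0.
  by rewrite ler_sqr ?nnegrE// (le_trans s0).
have key (c : R) : exists2 t, a <= t <= b & G b - G a - c * (V b - V a) =
    4 * pi * t ^+ 2 * (b - a) * (p t - c).
  have [t] := MVT ab (fun t _ => dH c t)
    (continuous_subspaceT (is_derive_continuous (dH c))).
  rewrite in_itv/= => /andP[/ltW at_ /ltW tb] E; exists t; first exact/andP.
  by rewrite mulrBr -[LHS]/(_ - _); lra.
have nn (t : R) : 0 <= 4 * pi * t ^+ 2 * (b - a).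
  by rewrite mulr_ge0 ?subr_ge0 ?(ltW ab)// mulr_ge0 ?sqr_ge0// mulr_ge0 ?pi_ge0.
apply/andP; split.
  have [t /andP[at_ tb] E] := key (p b); rewrite -subr_ge0 E mulr_ge0// subr_ge0.
  by apply: pn => //; exact: le_trans at_.
have [t /andP[at_ tb] E] := key (p a); rewrite -subr_le0 E mulr_ge0_le0// subr_le0.
exact: pn.
Qed.

Lemma ker5_ball (y : R3) (r : R) : 0 <= r ->
  \int[vol3]_x (3 * e ^+ 2 * ker e (x - y) ^+ 5 * \1_(eball y r) x) =
  4 * pi * (r ^+ 3 * rsqrt (r ^+ 2 + e ^+ 2) ^+ 3).
Proof.
move=> r0; pose q t := 3 * e ^+ 2 * rsqrt (t + e ^+ 2) ^+ 5.
have c0 : 0 <= 3 * e ^+ 2 by rewrite mulr_ge0 ?sqr_ge0.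
have qc (z : R3) : continuous (fun x : R3 => q (sq3 (x - z))).
  by apply: cont_mul; [exact: cont_cst|exact: cont_rsqrt_pow].
have qn s t : 0 <= s -> s <= t -> q t <= q s.
  by move=> s0 st; rewrite ler_wpM2l//; exact: rsqrt_pow_noninc.
have qb t : 0 <= t -> `|q t| <= 3 * e ^+ 2 * e^-1 ^+ 5.
  by move=> t0; rewrite normrM ger0_norm// ler_wpM2l//; exact: rsqrt_pow_bound.
have G0 : G 0 = 0 by rewrite /G expr0n/= mul0r mulr0.
apply/eqP; rewrite eq_le; apply/andP; split.
  have := radial_le qc qn qb (G := G) y r0; rewrite G0 subr0; apply=> a b a0 ab.
  by have /andP[] := G_sandwich a0 ab.
have := radial_ge qc qn qb (G := G) y r0; rewrite G0 subr0; apply=> a b a0 ab.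
by have /andP[] := G_sandwich a0 ab.
Qed.

End KernelIntegrals.

(** * Completeness of L^2 *)

Section GeometricSequences.
Context {R : realType}.

Lemma geometric_small (r c eps : R) : 0 <= r < 1 -> 0 < eps ->
  exists n, c * r ^+ n <= eps.
Proof.
move=> /andP[r0 r1] e0.
have : (fun n => c * r ^+ n) @ \oo --> c * (0 : R).
  by apply: cvgM; [exact: cvg_cst|apply: cvg_expr; rewrite ger0_norm].
rewrite mulr0 => /cvgr0Pnorm_le /(_ eps e0) [n _ /(_ n (leqnn n)) H].
by exists n; apply: le_trans H; exact: ler_norm.
Qed.

(** The increments from the index [n] on sum to at most [2 c 2^(-n)]. *)
Lemma geometric_cvg (u : nat -> R) (c : R) :
  (forall n, `|u n.+1 - u n| <= c * 2^-1 ^+ n) ->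
  exists2 l, u @ \oo --> l & forall n, `|l - u n| <= 2 * c * 2^-1 ^+ n.
Proof.
move=> uc.
have tail n k : `|u (n + k)%N - u n| <= 2 * c * 2^-1 ^+ n * (1 - 2^-1 ^+ k).
  elim: k => [|k IH]; first by rewrite addn0 subrr normr0 subrr mulr0.
  rewrite addnS -(subrKA (u (n + k)%N)).
  apply: le_trans (ler_normD _ _) _; apply: le_trans (lerD (uc _) IH) _.
  by rewrite exprD exprS le_eqVlt; apply/orP; left; apply/eqP; field.
have c0 : 0 <= c by have := uc 0%N; rewrite expr0 mulr1; apply: le_trans.
have bnd n k : `|u (n + k)%N - u n| <= 2 * c * 2^-1 ^+ n.
  apply: le_trans (tail n k) _; rewrite -[leRHS]mulr1; apply: ler_wpM2l.
    by rewrite mulr_ge0 ?exprn_ge0// mulr_ge0.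
  by rewrite lerBlDr lerDl exprn_ge0.
have cu : cvgn u.
  apply/cauchy_cvgP/cauchy_exP => eps e0.
  have h01 : 0 <= (2^-1 : R) < 1 by apply/andP; split; lra.
  have e2 : 0 < eps / 2 by rewrite divr_gt0.
  have [n Hn] := geometric_small (2 * c) h01 e2.
  exists (u n); exists n => // m /= nm.
  rewrite /ball/= distrC -(subnKC nm); apply: le_lt_trans (bnd n (m - n)%N) _.
  by apply: le_lt_trans Hn _; lra.
exists (lim (u @ \oo)); first exact: cu.
move=> n; have cn : (fun m => `|u m - u n|) @ \oo --> `|lim (u @ \oo) - u n|.
  by apply: cvg_norm; apply: cvgB => //; exact: cvg_cst.
apply: (cvgr_to_le cn); exists n => // m /= nm.
by rewrite -(subnKC nm).
Qed.

End GeometricSequences.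

Section SquareIntegrable.
Context d (T : measurableType d) (R : realType).
Variable mu : {measure set T -> \bar R}.
Implicit Types f g : T -> R.

Definition sqitg f := measurable_fun setT f /\ itg mu (fun x => f x ^+ 2).

Lemma Lfun2E f : f \in Lfun mu 2%:E <-> sqitg f.
Proof.
split=> [fL|[mf sf]].
  split; last exact: Lfun2_integrable_sqr.
  by move: fL; rewrite inE => /andP[/[!inE]].
rewrite inE; apply/andP; split; rewrite inE//=.
rewrite /finite_norm unlock; apply: poweR_lty.
move/integrableP : sf => [_]; apply: le_lt_trans.
rewrite le_eqVlt; apply/orP; left; apply/eqP; apply: eq_integral => x _ /=.
by rewrite [in RHS]ger0_norm ?sqr_ge0// powR_mulrn// real_normK// num_real.
Qed.

Lemma sqitg_mul f g : sqitg f -> sqitg g -> itg mu (fun x => f x * g x).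
Proof.
move=> [mf sf] [mg sg]; apply: itg_le (itgD sf sg).
  exact: measurable_funM.
by move=> x; rewrite ler_norml; apply/andP; split; nra.
Qed.

Lemma sqitgD f g : sqitg f -> sqitg g -> sqitg (fun x => f x + g x).
Proof.
move=> Hf Hg; have [mf sf] := Hf; have [mg sg] := Hg.
split; first exact: measurable_funD.
apply: itg_eq (itgD (itgD sf sg) (itgZ 2 (sqitg_mul Hf Hg))) => x; ring.
Qed.

Lemma sqitgZ c f : sqitg f -> sqitg (fun x => c * f x).
Proof.
move=> [mf sf]; split; first by apply: measurable_funM.
by apply: itg_eq (itgZ (c ^+ 2) sf) => x; ring.
Qed.

Lemma sqitgB f g : sqitg f -> sqitg g -> sqitg (fun x => f x - g x).
Proof.
move=> Hf Hg; have := sqitgD Hf (sqitgZ (-1) Hg).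
by congr sqitg; apply/funext => x; rewrite mulN1r.
Qed.

(** Where [G = sum_k 4^k (f_(k+1) - f_k)^2] is finite, the increments are
    bounded by [G^(1/2) 2^(-k)], so the sequence converges at a geometric rate;
    and [G] is integrable by monotone convergence. *)
Lemma sqitg_complete (f : nat -> T -> R) : (forall n, sqitg (f n)) ->
  (forall n, \int[mu]_x ((f n.+1 x - f n x) ^+ 2) <= 8^-1 ^+ n) ->
  exists2 g, sqitg g &
    forall n, \int[mu]_x ((g x - f n x) ^+ 2) <= 8 * 4^-1 ^+ n.
Proof.
move=> Hf fc.
have Hd n := sqitgB (Hf n.+1) (Hf n).
pose a n x := 4 ^+ n * (f n.+1 x - f n x) ^+ 2 : R.
have a0 n x : 0 <= a n x by apply: mulr_ge0; [exact: exprn_ge0|exact: sqr_ge0].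
have ia n : itg mu (a n) by apply: itgZ; exact: (Hd n).2.
have ma n : measurable_fun setT (fun x => (a n x)%:E).
  by apply/measurable_EFinP; exact: itg_meas.
pose G x := (\sum_(0 <= n <oo) (a n x)%:E)%E.
have G0 x : (0 <= G x)%E by apply: nneseries_ge0 => n _ _; rewrite lee_fin; exact: a0.
have mG : measurable_fun setT G.
  by apply: ge0_emeasurable_sum => [n x _ _|n _]; [rewrite lee_fin; exact: a0|exact: ma].
have iG : (\int[mu]_x G x <= 2%:E)%E.
  rewrite integral_nneseries//; last by move=> n x _; rewrite lee_fin; exact: a0.
  apply: lime_le.
    by apply: is_cvg_nneseries => n _ _; apply: integral_ge0 => x _; rewrite lee_fin; exact: a0.
  apply: nearW => n; apply: (@le_trans _ _ (\sum_(0 <= k < n) (2^-1 ^+ k)%:E)%E).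
    apply: lee_sum => k _; rewrite rintE// lee_fin rintZ; last exact: (Hd k).2.
    apply: le_trans (ler_wpM2l _ (fc k)) _; first exact: exprn_ge0.
    by rewrite -exprMn (_ : 4 * 8^-1 = 2^-1 :> R)//; field.
  rewrite sumEFin lee_fin.
  suff -> : \sum_(0 <= k < n) 2^-1 ^+ k = 2 - 2 * 2^-1 ^+ n :> R.
    by rewrite lerBlDr lerDl mulr_ge0// exprn_ge0.
  elim: n => [|n IH]; first by rewrite big_geq// expr0 mulr1 subrr.
  by rewrite big_nat_recr//= IH exprS; field.
have aG n x : ((a n x)%:E <= G x)%E.
  apply: le_trans (nneseries_lim_ge n.+1 _); last by move=> k _ _; rewrite lee_fin.
  rewrite big_nat_recr//= leeDr// sume_ge0// => k _.
  by rewrite lee_fin; exact: a0.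
have conv x : (G x < +oo)%E -> exists2 l, (fun n => f n x) @ \oo --> l &
    forall n, (((l - f n x) ^+ 2)%:E <= (4 * 4^-1 ^+ n)%:E * G x)%E.
  move=> Gx; have GE : G x = (fine (G x))%:E by rewrite fineK// ge0_fin_numE.
  have M0 : 0 <= fine (G x) by rewrite fine_ge0.
  set M := fine (G x) in GE M0.
  have [n|l fl lb] := @geometric_cvg R (fun n => f n x) (Num.sqrt M).
    rewrite -ler_sqr ?nnegrE ?mulr_ge0 ?sqrtr_ge0 ?exprn_ge0//.
    rewrite real_normK ?num_real// exprMn sqr_sqrtr//.
    have := aG n x; rewrite GE lee_fin /a => H.
    have -> : (2^-1 ^+ n) ^+ 2 = (4 ^+ n)^-1 :> R.
      by rewrite -exprM mulnC exprM -exprVn; congr (_ ^+ _); field.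
    by rewrite ler_pdivlMr ?exprn_gt0// mulrC.
  exists l => // n; rewrite GE -EFinM lee_fin -real_normK ?num_real//.
  apply: le_trans (_ : (2 * Num.sqrt M * 2^-1 ^+ n) ^+ 2 <= _).
    by rewrite ler_sqr ?nnegrE ?mulr_ge0 ?sqrtr_ge0 ?exprn_ge0//.
  have -> : 4^-1 ^+ n = (2^-1 ^+ n) ^+ 2 :> R.
    by rewrite -exprM mulnC exprM; congr (_ ^+ _); field.
  by rewrite !exprMn sqr_sqrtr// le_eqVlt; apply/orP; left; apply/eqP; ring.
pose A := [set x | (G x < +oo)%E].
have mA : measurable A.
  by rewrite -[A]setTI; exact: emeasurable_fun_infty_o.
pose g x := if asbool (A x) then lim ((fun n => f n x) @ \oo) else 0.
have mg : measurable_fun setT g.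
  apply: (@measurable_fun_cvg _ _ _ setT (fun n x => f n x * \1_A x)).
    by move=> n; apply: measurable_funM => //; exact: (Hf n).1.
  move=> x _; rewrite /g indicE; case: asboolP => Ax.
    have [l fl _] := conv x Ax; rewrite mem_set//.
    have -> : (fun n => f n x * true%:R) = (fun n => f n x).
      by apply/funext => n; rewrite mulr1.
    by apply/cvg_ex; exists l.
  rewrite memNset//; have -> : (fun n => f n x * false%:R) = (fun=> 0).
    by apply/funext => n; rewrite mulr0.
  exact: cvg_cst.
have gb n x : (((g x - f n x) ^+ 2)%:E <= (4 * 4^-1 ^+ n)%:E * G x)%E.
  rewrite /g; case: asboolP => Ax.
    by have [l fl lb] := conv x Ax; rewrite (cvg_lim _ fl)//.
  have -> : G x = +oo%E by move/negP: Ax; rewrite -leNgt leye_eq => /eqP.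
  by rewrite gt0_muley ?leey// lte_fin mulr_gt0// exprn_gt0.
have ib n : (\int[mu]_x ((g x - f n x) ^+ 2)%:E <= (8 * 4^-1 ^+ n)%:E)%E.
  apply: (@le_trans _ _ (\int[mu]_x ((4 * 4^-1 ^+ n)%:E * G x))%E).
    apply: ge0_le_integral => //.
    - by move=> x _; rewrite lee_fin sqr_ge0.
    - by apply/measurable_EFinP; apply: measurable_funX;
        apply: measurable_funB => //; exact: (Hf n).1.
    - exact: measurable_funeM.
  have c0 : (0 <= (4 * 4^-1 ^+ n : R)%:E)%E by rewrite lee_fin mulr_ge0// exprn_ge0.
  rewrite ge0_integralZl//.
  apply: le_trans (lee_wpmul2l c0 iG) _.
  by rewrite -EFinM lee_fin le_eqVlt; apply/orP; left; apply/eqP; ring.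
have sgf n : sqitg (fun x => g x - f n x).
  split; first by apply: measurable_funB => //; exact: (Hf n).1.
  apply/integrableP; split.
    apply/measurable_EFinP; apply: measurable_funX.
    by apply: measurable_funB => //; exact: (Hf n).1.
  apply: le_lt_trans (ltry (8 * 4^-1 ^+ n)); apply: le_trans (ib n).
  by under eq_integral do rewrite /= ger0_norm ?sqr_ge0//.
exists g.
  have := sqitgD (sgf 0%N) (Hf 0%N); congr sqitg.
  by apply/funext => x; rewrite subrK.
by move=> n; rewrite -lee_fin -rintE//; exact: (sgf n).2.
Qed.

End SquareIntegrable.

(** * Orthogonal projection *)

Section Projection.
Context {R : realType} {E : lmodType R}.
Variables (P S : E -> Prop) (B : E -> E -> R) (C : R).
Hypothesis P_lin : forall (c : R) u v, P u -> P v -> P (u + c *: v).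
Hypothesis B_sym : forall u v, B u v = B v u.
Hypothesis B_lin : forall (c : R) u v w, P u -> P v -> P w ->
  B (u + c *: v) w = B u w + c * B v w.
Hypothesis B_ge0 : forall u, 0 <= B u u.
Hypothesis P_complete : forall u : nat -> E, (forall n, P (u n)) ->
  (forall n, B (u n.+1 - u n) (u n.+1 - u n) <= 8^-1 ^+ n) ->
  exists2 h, P h & forall n, B (h - u n) (h - u n) <= C * 4^-1 ^+ n.
Hypothesis SP : forall u, S u -> P u.
Hypothesis S0 : S 0.
Hypothesis S_lin : forall (c : R) u v, S u -> S v -> S (u + c *: v).

Let P_sub u v : P u -> P v -> P (u - v).
Proof. by move=> Pu Pv; rewrite -scaleN1r; exact: P_lin. Qed.

Let B_sqr (c : R) u v : P u -> P v ->
  B (u + c *: v) (u + c *: v) = B u u + 2 * c * B u v + c ^+ 2 * B v v.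
Proof.
move=> Pu Pv; have Puv := P_lin c Pu Pv.
rewrite B_lin// ![B _ (u + _)]B_sym !B_lin// (B_sym v u); ring.
Qed.

Lemma bilin_sub u v w : P u -> P v -> P w -> B (u - v) w = B u w - B v w.
Proof. by move=> Pu Pv Pw; rewrite -scaleN1r B_lin// mulN1r. Qed.

Lemma bilin_CS u v : P u -> P v -> B u v ^+ 2 <= B u u * B v v.
Proof.
move=> Pu Pv; have Huv t := B_ge0 (u + t *: v).
have {}Huv t : 0 <= B u u + 2 * t * B u v + t ^+ 2 * B v v by rewrite -B_sqr.
have := B_ge0 v; rewrite le_eqVlt => /predU1P[Bv|Bv].
  have {}Huv t : 0 <= B u u + 2 * t * B u v.
    by have := Huv t; rewrite -Bv mulr0 addr0.
  rewrite -Bv mulr0.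
  have [->|b0] := eqVneq (B u v) 0; first by rewrite expr0n.
  have := Huv (- (B u u + 1) / (2 * B u v)).
  rewrite (_ : _ * _ * _ = - (B u u + 1)); last by field.
  by rewrite opprD addrA subrr sub0r oppr_ge0 ler10.
have := Huv (- B u v / B v v).
have -> : B u u + 2 * (- B u v / B v v) * B u v + (- B u v / B v v) ^+ 2 * B v v
  = (B u u * B v v - B u v ^+ 2) / B v v by field; rewrite gt_eqF.
by rewrite pmulr_lge0 ?invr_gt0// subr_ge0.
Qed.

(** A minimizing sequence for the distance from [v] to [S] is Cauchy by the
    parallelogram law; the limit [h] of the residuals is orthogonal to [S]. *)
Lemma projection v : P v -> exists h, [/\ P h, (forall s, S s -> B h s = 0) &
  forall eps, 0 < eps -> exists2 s, S s & B (v - s - h) (v - s - h) <= eps].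
Proof.
move=> Pv.
pose D := [set r | exists2 s, S s & r = B (v - s) (v - s)].
have D0 : has_inf D.
  split; first by exists (B (v - 0) (v - 0)), 0.
  by exists 0 => _ [s _ ->]; exact: B_ge0.
pose d := inf D.
have dlb s : S s -> d <= B (v - s) (v - s).
  by move=> Ss; apply: ge_inf; [exact: D0.2|exists s].
pose del n : R := 8^-1 ^+ n / 4.
have del0 n : 0 < del n by rewrite divr_gt0 ?exprn_gt0.
have /choice[s Hs] : forall n, exists s, S s /\ B (v - s) (v - s) <= d + del n.
  move=> n; have [_ [s Ss ->] /ltW Hs] := inf_adherent (del0 n) D0.
  by exists s.
pose w n := v - s n.
have Pw n : P (w n) by apply: P_sub => //; exact/SP/(Hs n).1.
have lbw n (c : R) t : S t -> d <= B (w n + c *: t) (w n + c *: t).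
  move=> St; have -> : w n + c *: t = v - (s n + (- c) *: t).
    by rewrite /w opprD scaleNr opprK addrA.
  by apply: dlb; apply: S_lin => //; exact: (Hs n).1.
have bnd n t : S t -> B (w n) t ^+ 2 <= del n * B t t.
  move=> St; have Pt := SP St.
  have low c : d <= B (w n) (w n) + 2 * c * B (w n) t + c ^+ 2 * B t t.
    by rewrite -B_sqr//; exact: lbw.
  have := (Hs n).2; rewrite -/(w n) => up.
  have := B_ge0 t; rewrite le_eqVlt => /predU1P[Bt|Bt].
    by have := bilin_CS (Pw n) Pt; rewrite -Bt !mulr0.
  have := low (- B (w n) t / B t t).
  have -> : B (w n) (w n) + 2 * (- B (w n) t / B t t) * B (w n) t +
    (- B (w n) t / B t t) ^+ 2 * B t t =
    B (w n) (w n) - B (w n) t ^+ 2 / B t t by field; rewrite gt_eqF.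
  by rewrite -ler_pdivrMr// => h; lra.
have del_mono n : del n.+1 <= del n.
  rewrite /del ler_pM2r ?invr_gt0// exprS ler_piMl ?exprn_ge0//.
  by rewrite invf_le1// ler1n.
have cauchy n : B (w n.+1 - w n) (w n.+1 - w n) <= 8^-1 ^+ n.
  set t := w n.+1 - w n.
  have St : S t.
    have -> : t = s n + (-1) *: s n.+1.
      by rewrite /t /w scaleN1r opprB addrC subrKA.
    by apply: S_lin; [exact: (Hs n).1|exact: (Hs n.+1).1].
  have Pt := SP St.
  have h1 : d <= B (w n) (w n) + 2 * 2^-1 * B (w n) t + 2^-1 ^+ 2 * B t t.
    by rewrite -B_sqr//; exact: lbw.
  have h2 : B (w n) (w n) + 2 * 1 * B (w n) t + 1 ^+ 2 * B t t <= d + del n.+1.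
    by rewrite -B_sqr// scale1r /t subrKC; exact: (Hs n.+1).2.
  have h3 := (Hs n).2; rewrite -/(w n) in h3.
  have h4 := del_mono n.
  have -> : 8^-1 ^+ n = 4 * del n by rewrite /del mulrC divfK.
  by move: (B t t) (B (w n) t) (B (w n) (w n)) h1 h2 h3 => c b a; lra.
have [h Ph hw] := P_complete Pw cauchy.
have h14 : 0 <= (4^-1 : R) < 1 by apply/andP; split; lra.
exists h; split=> // [t St|eps e0]; last first.
  have [n Hn] := geometric_small C h14 e0.
  exists (s n); first exact: (Hs n).1.
  rewrite -/(w n); apply: le_trans Hn; apply: le_trans (hw n).
  have -> : w n - h = 0 + (-1) *: (h - w n) by rewrite add0r scaleN1r opprB.
  have Ph0 : P (h - w n) by exact: P_sub.
  have P0 : P 0 by exact: SP.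
  have B0 x : P x -> B 0 x = 0.
    by move=> Px; have := bilin_sub Px Px Px; rewrite !subrr.
  by rewrite B_sqr// !B0// !add0r mulr0 add0r sqrrN expr1n mul1r.
have Pt := SP St.
have small eps : 0 < eps -> B h t ^+ 2 <= eps.
  move=> e0.
  have [n Hn] := geometric_small (2 * B t t * (C + 1)) h14 e0.
  apply: le_trans Hn.
  have b1 := bilin_CS (P_sub Ph (Pw n)) Pt.
  have b2 := bnd n t St.
  have b3 : B (h - w n) t ^+ 2 <= C * 4^-1 ^+ n * B t t.
    by apply: le_trans b1 _; rewrite ler_wpM2r//; exact: hw.
  have b4 : del n * B t t <= 4^-1 ^+ n * B t t.
    rewrite ler_wpM2r// /del ler_pdivrMr//.
    apply: (@le_trans _ _ (4^-1 ^+ n)); last by rewrite ler_peMr ?exprn_ge0// ler1n.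
    by apply: lerXn2r; rewrite ?nnegrE; lra.
  have -> : B h t = B (h - w n) t + B (w n) t by rewrite bilin_sub// subrK.
  have -> : 2 * B t t * (C + 1) * 4^-1 ^+ n =
    2 * (C * 4^-1 ^+ n * B t t) + 2 * (4^-1 ^+ n * B t t) by ring.
  move: (B (h - w n) t) (B (w n) t) b2 b3 => x y b2 b3.
  have := sqr_ge0 (x - y); have -> : (x + y) ^+ 2 =
    2 * x ^+ 2 + 2 * y ^+ 2 - (x - y) ^+ 2 by ring.
  lra.
apply/eqP; rewrite -sqrf_eq0 eq_le sqr_ge0 andbT leNgt; apply/negP => hp.
have := small (B h t ^+ 2 / 2) (divr_gt0 hp (ltr0Sn _ 1)).
by lra.
Qed.

End Projection.

(** * Test functions and square-integrable fields *)

Section TestFunctions.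
Context {R : realType}.
Local Notation R3 := (R * R * R)%type.
Implicit Types (phi psi f g : R3 -> R) (U : set R3).

Lemma R3_hausdorff : hausdorff_space R3. Proof. exact: norm_hausdorff. Qed.

Lemma test_fun_intro U phi (K : set R3) : (forall k, Ck k phi) -> compact K ->
  K `<=` U -> (forall x, ~ K x -> phi x = 0) -> test_fun U phi.
Proof.
move=> Cphi cK KU phi0.
have sK : closure [set x | phi x != 0] `<=` K.
  rewrite (closure_id K).1; last exact: (compact_closed R3_hausdorff).
  apply: closure_subset => x /= /eqP px; apply: contrapT => /phi0; exact: px.
split=> //; last exact: subset_trans sK KU.
by apply: (subclosed_compact _ cK sK); exact: closed_closure.
Qed.

Lemma test_fun_supp U phi : test_fun U phi ->
  exists2 K, compact K /\ K `<=` U & forall x, ~ K x -> phi x = 0.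
Proof.
move=> [_ cK KU]; exists (closure [set x | phi x != 0]) => // x Kx.
by apply/eqP; apply: contrapT => /negP px; apply: Kx; exact: subset_closure.
Qed.

Lemma test_fun_lin U (c : R) phi psi : test_fun U phi -> test_fun U psi ->
  test_fun U (fun x => phi x + c * psi x).
Proof.
move=> tp tq; have [K [cK KU] K0] := test_fun_supp tp.
have [L [cL LU] L0] := test_fun_supp tq.
apply: (@test_fun_intro _ _ (K `|` L)).
- by move=> k; apply: Ck_add; [case: tp|apply: Ck_scale; case: tq].
- exact: compactU.
- by move=> x [/KU|/LU].
- by move=> x KL; rewrite K0 ?L0 ?mulr0 ?addr0// => ?; apply: KL; [right|left].
Qed.

Lemma test_fun0 U : test_fun U (fun=> 0).
Proof.
apply: (@test_fun_intro _ _ set0) => //; last exact: compact0.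
by move=> k; exact: Ck_cst.
Qed.

Lemma test_fun_bounded U phi : test_fun U phi -> bounded_support phi.
Proof.
move=> tp; have [K [cK KU] K0] := test_fun_supp tp.
have [M [_ KM]] := compact_bounded cK.
exists (`|M| + 1) => x Mx; apply: K0 => Kx.
have := KM (`|M| + 1) _ x Kx; rewrite (le_lt_trans (ler_norm M)) ?ltrDl//.
by move=> /(_ isT); rewrite /= leNgt Mx.
Qed.

Lemma test_fun_Ck U phi k : test_fun U phi -> Ck k phi. Proof. by case. Qed.

Lemma test_fun_partial_cont U phi i : test_fun U phi -> continuous (partial i phi).
Proof. by move=> tp; apply: Ck_cont; exact: (Ck_partial i (test_fun_Ck 1 tp)). Qed.

Lemma test_fun_itg U phi : test_fun U phi -> itg vol3 phi.
Proof.
move=> tp; apply: itg_cont; last exact: test_fun_bounded tp.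
exact: (Ck_cont (test_fun_Ck 0 tp)).
Qed.

Lemma test_fun_partial_itg U phi i : test_fun U phi -> itg vol3 (partial i phi).
Proof.
move=> tp; apply: itg_cont; first exact: (test_fun_partial_cont tp).
exact: bounded_support_partial (test_fun_bounded tp).
Qed.

Lemma partial_lin (c : R) phi psi i : Ck 1 phi -> Ck 1 psi ->
  partial i (fun x => phi x + c * psi x) =
  (fun x => partial i phi x + c * partial i psi x).
Proof.
move=> Cp Cq; apply/funext => x; apply: partial_val.
exact: (derive_pt_add (Ck_isder i Cp x) (derive_pt_scale c (Ck_isder i Cq x))).
Qed.

Lemma rint_by_parts U f phi i : Ck 1 f -> test_fun U phi ->
  \int[vol3]_x (f x * partial i phi x) = - \int[vol3]_x (partial i f x * phi x).
Proof.
move=> Cf tp; have Cp := test_fun_Ck 1 tp.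
have [M pM] := test_fun_bounded tp.
have cf := Ck_cont Cf; have cp := Ck_cont Cp.
have cdf := Ck_cont (Ck_partial i Cf); have cdp := test_fun_partial_cont (i := i) tp.
have i1 : itg vol3 (fun x => f x * partial i phi x).
  apply: itg_cont; first exact: cont_mul.
  by exists M => x /(support_partial i pM) ->; rewrite mulr0.
have i2 : itg vol3 (fun x => partial i f x * phi x).
  apply: itg_cont; first exact: cont_mul.
  by exists M => x /pM ->; rewrite mulr0.
apply/eqP; rewrite -addr_eq0 -rintD//.
have E : partial i (fun x => f x * phi x) =
    (fun x => f x * partial i phi x + partial i f x * phi x).
  apply/funext => x; rewrite [partial i f x * _]mulrC; apply: partial_val.
  exact: (derive_pt_mul (Ck_isder i Cf x) (Ck_isder i Cp x)).
rewrite -E; apply/eqP; apply: rint_partial.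
- exact: cont_mul.
- by exists M => x /pM ->; rewrite mulr0.
- by move=> x; have [] := derive_pt_mul (Ck_isder i Cf x) (Ck_isder i Cp x).
- by rewrite E; apply: cont_add; exact: cont_mul.
Qed.

End TestFunctions.

Section VectorFields.
Context {R : realType}.
Local Notation R3 := (R * R * R)%type.
Local Notation T3 := (measurableTypeR R * measurableTypeR R * measurableTypeR R)%type.
Local Notation i0 := (@Ordinal 3 0 isT).
Local Notation i1 := (@Ordinal 3 1 isT).
Local Notation i2 := (@Ordinal 3 2 isT).
Variable Omega : set R3.
Hypothesis mO : measurable (Omega : set T3).
Hypothesis finO : (vol3 Omega < +oo)%E.
Implicit Types (v w : R3 -> R3).

(** Only the values on [Omega] matter in the inner product, and the extension by
    [0] turns it into an integral over the whole space. *)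
Definition ext v (i : 'I_3) : R3 -> R := (coord3 i \o v) \_ Omega.

Lemma extE v i x : ext v i x = \1_Omega x * coord3 i (v x).
Proof.
by rewrite /ext patchE indicE; case: (x \in Omega); rewrite ?mul1r ?mul0r.
Qed.

Lemma L2_fieldE v : L2_field Omega v <-> forall i, sqitg vol3 (ext v i).
Proof. by split=> H i; apply/Lfun2E; exact: H. Qed.

Lemma innerE v w :
  inner Omega v w = \int[vol3]_x (\sum_(i < 3) ext v i x * ext w i x).
Proof.
rewrite /inner Rintegral_mkcond; apply: eq_Rintegral => x _.
rewrite patchE /dot3; case: ifPn => xO.
  by apply: eq_bigr => i _; rewrite !extE indicE xO !mul1r.
by rewrite big1// => i _; rewrite extE indicE (negPf xO) !mul0r.
Qed.

Lemma innerS v w : L2_field Omega v -> L2_field Omega w ->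
  inner Omega v w = \sum_(i < 3) \int[vol3]_x (ext v i x * ext w i x).
Proof.
move=> /L2_fieldE Hv /L2_fieldE Hw; rewrite innerE rint_sum// => i _.
exact: sqitg_mul.
Qed.

Lemma inner_sym v w : inner Omega v w = inner Omega w v.
Proof.
rewrite !innerE; apply: eq_Rintegral => x _.
by apply: eq_bigr => i _; rewrite mulrC.
Qed.

Lemma inner_ge0 v : 0 <= inner Omega v v.
Proof.
rewrite innerE; apply: rint_ge0 => x.
by apply: sumr_ge0 => i _; rewrite -expr2 sqr_ge0.
Qed.

Lemma ext_lin (c : R) v w i : ext (v + c *: w) i =
  (fun x => ext v i x + c * ext w i x).
Proof.
apply/funext => x; rewrite !extE.
rewrite (_ : (v + c *: w) x = v x + c *: w x)// coord3D coord3Z; ring.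
Qed.

Lemma L2_lin (c : R) v w : L2_field Omega v -> L2_field Omega w ->
  L2_field Omega (v + c *: w).
Proof.
move=> /L2_fieldE Hv /L2_fieldE Hw; apply/L2_fieldE => i.
by rewrite ext_lin; apply: sqitgD => //; exact: sqitgZ.
Qed.

Lemma inner_lin (c : R) u v w : L2_field Omega u -> L2_field Omega v ->
  L2_field Omega w ->
  inner Omega (u + c *: v) w = inner Omega u w + c * inner Omega v w.
Proof.
move=> Hu Hv Hw; rewrite !innerS//; last exact: L2_lin.
rewrite big_distrr -big_split /=; apply: eq_bigr => i _.
move/L2_fieldE: Hu => Hu; move/L2_fieldE: Hv => Hv; move/L2_fieldE: Hw => Hw.
rewrite ext_lin -rintZ; last exact: sqitg_mul.
rewrite -rintD; [|exact: sqitg_mul|by apply: itgZ; exact: sqitg_mul].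
by apply: eq_Rintegral => x _; ring.
Qed.

Lemma L2_cont v : (forall i, continuous (coord3 i \o v)) ->
  (forall i, bounded_support (coord3 i \o v)) -> L2_field Omega v.
Proof.
move=> cv bv; apply/L2_fieldE => i.
have [B B0 vB] := cont_bounded (cv i) (bv i).
have mv : measurable_fun setT (ext v i : T3 -> R).
  rewrite (_ : ext v i = (fun x => \1_Omega x * coord3 i (v x))); last first.
    by apply/funext => x; rewrite extE.
  apply: measurable_funM; first exact: measurable_indic.
  exact: (cont_measurable3 (cv i)).
split=> //.
apply: (@itg_fin _ T3 R vol3 Omega (B ^+ 2)) => //.
- exact: measurable_funX.
- move=> x; rewrite normrX; apply: lerXn2r; rewrite ?nnegrE// extE indicE.
  by case: (_ \in _); rewrite ?mul1r ?mul0r ?normr0//; exact: vB.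
- by move=> x Ox; rewrite extE indicE memNset// mul0r expr0n.
Qed.

Lemma ext_itg v i : L2_field Omega v -> itg vol3 (ext v i).
Proof.
move=> /L2_fieldE /(_ i) Hv.
have H1 : sqitg vol3 (\1_Omega : R3 -> R).
  have mI : measurable_fun setT (\1_Omega : T3 -> R) by exact: measurable_indic.
  split=> //; apply: (@itg_fin _ T3 R vol3 Omega 1) => //.
  - exact: measurable_funX.
  - by move=> x; rewrite indicE; case: (_ \in _); rewrite ?expr1n ?expr0n ?normr1 ?normr0.
  - by move=> x Ox; rewrite indicE memNset// expr0n.
apply: itg_eq (sqitg_mul H1 Hv) => x; rewrite extE indicE.
by case: (_ \in _); rewrite ?mul1r ?mul0r.
Qed.

(** The limit is taken in each component; increments that decrease geometrically
    are all that the projection theorem produces. *)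
Lemma L2_complete (v : nat -> R3 -> R3) : (forall n, L2_field Omega (v n)) ->
  (forall n, inner Omega (v n.+1 - v n) (v n.+1 - v n) <= 8^-1 ^+ n) ->
  exists2 h, L2_field Omega h &
    forall n, inner Omega (h - v n) (h - v n) <= 24 * 4^-1 ^+ n.
Proof.
move=> Hv vc.
have Hs i n : sqitg vol3 (ext (v n) i) by exact: (L2_fieldE _).1.
have extB u w i x : ext (u - w) i x = ext u i x - ext w i x.
  by rewrite -scaleN1r ext_lin mulN1r.
have L2B u w : L2_field Omega u -> L2_field Omega w -> L2_field Omega (u - w).
  by move=> Hu Hw; rewrite -scaleN1r; exact: L2_lin.
have fast i n : \int[vol3]_x ((ext (v n.+1) i x - ext (v n) i x) ^+ 2) <= 8^-1 ^+ n.
  apply: le_trans (vc n); rewrite innerS; [|exact: L2B|exact: L2B].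
  rewrite (bigD1 i)//= -[leLHS]addr0; apply: lerD.
    by rewrite le_eqVlt; apply/orP; left; apply/eqP; apply: eq_Rintegral => x _;
      rewrite extB expr2.
  by apply: sumr_ge0 => j _; apply: rint_ge0 => x; rewrite -expr2 sqr_ge0.
have lims i := sqitg_complete (Hs i) (fast i).
have [g0 s0 c0] := lims i0; have [g1 s1 c1] := lims i1; have [g2 s2 c2] := lims i2.
pose g (i : 'I_3) : R3 -> R :=
  match val i with 0%N => g0 | 1%N => g1 | _ => g2 end.
have [sg cg] : (forall i, sqitg vol3 (g i)) /\ (forall i n,
    \int[vol3]_x ((g i x - ext (v n) i x) ^+ 2) <= 8 * 4^-1 ^+ n).
  have gE i : [\/ i = i0, i = i1 | i = i2].
    by case: i => [[|[|[|?]]] ?] //; [apply: Or31|apply: Or32|apply: Or33];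
      exact: val_inj.
  by split=> [i|i n]; have [->|->|->] := gE i.
pose h : R3 -> R3 := fun x => (g0 x, g1 x, g2 x).
have hE i x : coord3 i (h x) = g i x by case: i => [[|[|[|?]]] ?].
have mI : measurable_fun setT (\1_Omega : T3 -> R) by exact: measurable_indic.
have b1 (x : R3) : `|\1_Omega x| <= 1 :> R.
  by rewrite indicE; case: (_ \in _); rewrite ?normr1 ?normr0.
have Hh : L2_field Omega h.
  apply/L2_fieldE => i; split.
    rewrite (_ : ext h i = fun x => \1_Omega x * g i x); last first.
      by apply/funext => x; rewrite extE hE.
    by apply: measurable_funM => //; exact: (sg i).1.
  apply: itg_eq (itg_bdM mI b1 (sg i).2) => x.
  by rewrite extE hE indicE; case: (_ \in _); rewrite ?mul1r ?mul0r ?expr0n.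
exists h => // n; rewrite innerS; [|exact: L2B|exact: L2B].
have -> : 24 * 4^-1 ^+ n = \sum_(i < 3) 8 * 4^-1 ^+ n :> R.
  by rewrite sum3; ring.
apply: ler_sum => i _; apply: le_trans (cg i n); apply: rint_le.
- by apply: sqitg_mul; exact: (L2_fieldE _).1 (L2B _ _ Hh (Hv n)) i.
- by have [] := sqitgB (sg i) (Hs i n).
- move=> x; rewrite extB -expr2 !extE hE indicE.
  by case: (_ \in _); rewrite ?mul1r ?mul0r// subrr expr0n sqr_ge0.
Qed.

End VectorFields.

(** * Convolution with the kernel *)

Section Mollification.
Context {R : realType}.
Local Notation R3 := (R * R * R)%type.
Local Notation T3 := (measurableTypeR R * measurableTypeR R * measurableTypeR R)%type.

Lemma norm_sqr_le_sq3 (z : R3) : `|z| ^+ 2 <= sq3 z.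
Proof.
have h1 := sqr_ge0 z.1.1; have h2 := sqr_ge0 z.1.2; have h3 := sqr_ge0 z.2.
have E (t : R) : `|t| ^+ 2 = t ^+ 2 by rewrite real_normK ?num_real.
rewrite prod_normE /= prod_normE /= /sq3.
by rewrite !maxEle; repeat case: ifP => _; rewrite E; lra.
Qed.

Lemma sq3_le_norm (z : R3) : sq3 z <= 3 * `|z| ^+ 2.
Proof.
have [h1 h2 h3] := norm_coord_le z.
have E (t : R) : `|t| <= `|z| -> t ^+ 2 <= `|z| ^+ 2.
  by move=> tz; rewrite -[leLHS]real_normK ?num_real// ler_sqr ?nnegrE.
by have := E _ h1; have := E _ h2; have := E _ h3; rewrite /sq3; lra.
Qed.

Lemma lipschitz_coord (f : R3 -> R) (B : R) (j : 'I_3) (h : R) (x : R3) :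
  Ck 1 f -> (forall x, `|partial j f x| <= B) ->
  `|f (h *: basis3 j + x) - f x| <= B * `|h|.
Proof.
move=> Cf fB; have df := Ck_isder j Cf.
wlog h0 : h x / 0 < h.
  move=> H; have [h0|h0|->] := ltgtP h 0; last first.
  - by rewrite scale0r add0r subrr normr0 mulr0.
  - exact: H.
  - have := H (- h) (h *: basis3 j + x) _; rewrite oppr_gt0 => /(_ h0).
    by rewrite addrA -scalerDl addNr scale0r add0r distrC normrN.
have [t _ ->] := MVT_line x h0 df.
by rewrite normrM mulrC ler_wpM2r.
Qed.

Lemma lipschitz (f : R3 -> R) (B : R) : Ck 1 f ->
  (forall j x, `|partial j f x| <= B) ->
  forall x y, `|f x - f y| <= 3 * B * `|x - y|.
Proof.
move=> Cf fB x y.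
have B0 : 0 <= B by apply: le_trans (fB ord0 0).
pose z := x - y; have [n1 n2 n3] := norm_coord_le z.
pose i0 := @Ordinal 3 0 isT; pose i1 := @Ordinal 3 1 isT; pose i2 := @Ordinal 3 2 isT.
pose y1 := z.1.1 *: basis3 i0 + y; pose y2 := z.1.2 *: basis3 i1 + y1.
have xE : x = z.2 *: basis3 i2 + y2.
  rewrite /y2 /y1 addrA addrA -[LHS](subrK y) -/z; congr (_ + y).
  by case: z {n1 n2 n3 y1 y2} => [[a b] c]; congr (_, _, _) => /=;
    rewrite /GRing.scale/=; ring.
have h1 : `|f y1 - f y| <= B * `|z.1.1| by exact: lipschitz_coord.
have h2 : `|f y2 - f y1| <= B * `|z.1.2| by exact: lipschitz_coord.
have h3 : `|f x - f y2| <= B * `|z.2| by rewrite xE; exact: lipschitz_coord.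
have -> : f x - f y = (f x - f y2) + ((f y2 - f y1) + (f y1 - f y)).
  by rewrite addrA subrKA addrA addrNK.
apply: le_trans (ler_normD _ _) _; apply: le_trans (lerD h3 (ler_normD _ _)) _.
have := ler_wpM2l B0 n1; have := ler_wpM2l B0 n2; have := ler_wpM2l B0 n3.
rewrite -/z; lra.
Qed.

(** Convolution with the reflected kernel [z |-> k (- z)]. *)
Definition conv (k f : R3 -> R) (y : R3) : R := \int[vol3]_x (k (x - y) * f x).

Lemma comp_sub0 (f : R3 -> R) : (fun x => f (x - 0)) = f.
Proof. by apply/funext => x; rewrite subr0. Qed.

Lemma ker_cont (e : R) : 0 < e -> continuous (ker e).
Proof. by move=> e0; rewrite -(comp_sub0 (ker e)); exact: (Ck_cont (Ck_ker e0 0 0)). Qed.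

Lemma kerv_cont (e : R) j : 0 < e -> continuous (kerv e j).
Proof. by move=> e0; rewrite -(comp_sub0 (kerv e j)); exact: (Ck_cont (Ck_kerv e0 0 j 0)). Qed.

Lemma kerd_cont (e : R) i j : 0 < e -> continuous (kerd e i j).
Proof. by move=> e0; rewrite -(comp_sub0 (kerd e i j)); exact: (Ck_cont (Ck_kerd e0 0 i j 0)). Qed.

Lemma cont_sub3 (k : R3 -> R) (y : R3) : continuous k ->
  continuous (fun x : R3 => k (x - y)).
Proof.
move=> ck x; apply: (@continuous_comp _ _ _ (fun x : R3 => x - y) k).
  by apply: cvgB; [exact: cvg_id|exact: cvg_cst].
exact: ck.
Qed.

Lemma measurable_sub3 : measurable_fun setT
  (fun z : T3 * T3 => ((z.2 : R3) - z.1) : T3).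
Proof.
pose T1 := measurableTypeR R.
have mf := @measurable_fst _ _ T3 T3; have ms := @measurable_snd _ _ T3 T3.
have c0 : measurable_fun setT (fun x : T3 => x.1.1 : T1).
  exact: measurableT_comp (@measurable_fst _ _ T1 T1) (@measurable_fst _ _ _ T1).
have c1 : measurable_fun setT (fun x : T3 => x.1.2 : T1).
  exact: measurableT_comp (@measurable_snd _ _ T1 T1) (@measurable_fst _ _ _ T1).
have c2 : measurable_fun setT (fun x : T3 => x.2 : T1).
  exact: measurable_snd.
apply: measurable_fun_pair; first apply: measurable_fun_pair.
- exact: (measurable_funB (measurableT_comp c0 ms) (measurableT_comp c0 mf)).
- exact: (measurable_funB (measurableT_comp c1 ms) (measurableT_comp c1 mf)).
- exact: (measurable_funB (measurableT_comp c2 ms) (measurableT_comp c2 mf)).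
Qed.

Lemma conv_swap (k f g : R3 -> R) (M : R) : continuous k ->
  (forall z, `|k z| <= M) -> itg vol3 f -> itg vol3 g ->
  [/\ itg vol3 (fun y => g y * conv k f y),
      itg vol3 (fun x => f x * \int[vol3]_y (k (x - y) * g y)) &
      \int[vol3]_y (g y * conv k f y) =
      \int[vol3]_x (f x * \int[vol3]_y (k (x - y) * g y))].
Proof.
move=> ck kM iF ig.
have mK : measurable_fun setT (fun z : T3 * T3 => k ((z.2 : R3) - z.1)).
  exact: (measurableT_comp (cont_measurable3 ck) measurable_sub3).
exact: (@rint_swap _ _ T3 T3 R vol3s vol3s M _ g f mK (fun z => kM _) ig iF).
Qed.

Lemma conv_itg (k f : R3 -> R) (M : R) y : continuous k ->
  (forall z, `|k z| <= M) -> itg vol3 f -> itg vol3 (fun x => k (x - y) * f x).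
Proof.
move=> ck kM iF.
apply: (@itg_bdM _ T3 R vol3 M (fun x : R3 => k (x - y)) f).
- by apply: cont_measurable3; exact: cont_sub3.
- by move=> x; exact: kM.
- exact: iF.
Qed.

Section FixedScale.
Variable (e : R).
Hypothesis e0 : 0 < e.

Lemma ker_pow_bound n (z : R3) : `|ker e z ^+ n| <= e^-1 ^+ n.
Proof. by apply: rsqrt_pow_bound => //; exact: sq3_ge0. Qed.

Lemma kerv_bound j (z : R3) : `|kerv e j z| <= e^-1 ^+ 2.
Proof.
apply: le_trans (ker_pow_bound 2 z).
rewrite (ger0_norm (sqr_ge0 _)) -ler_sqr ?nnegrE ?sqr_ge0//.
rewrite real_normK ?num_real//; apply: le_trans (kerv_sqr e0 z).
by rewrite (bigD1 j)//= lerDl; apply: sumr_ge0 => i _; exact: sqr_ge0.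
Qed.

Lemma kerd_bound i j (z : R3) : `|kerd e i j z| <= 4 * e^-1 ^+ 3.
Proof.
have k0 := ker_gt0 e0 z; have kE := ker_sqr e0 z.
have k3 := ker_pow_bound 3 z; rewrite ger0_norm ?exprn_ge0 ?(ltW k0)// in k3.
have zz : `|coord3 i z * coord3 j z| <= sq3 z + e ^+ 2.
  have Ez l : coord3 l z ^+ 2 <= sq3 z.
    rewrite sq3E (bigD1 l)//= lerDl; apply: sumr_ge0 => m _; exact: sqr_ge0.
  have := Ez i; have := Ez j; have := sqr_ge0 e.
  by rewrite ler_norml => h1 h2 h3; apply/andP; split; nra.
have b1 : `|(i == j)%:R * ker e z ^+ 3| <= e^-1 ^+ 3.
  case: (i == j); first by rewrite mul1r ger0_norm ?exprn_ge0 ?(ltW k0).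
  by rewrite mul0r normr0 exprn_ge0// invr_ge0 ltW.
have b2 : `|3 * (coord3 i z * coord3 j z) * ker e z ^+ 5| <= 3 * e^-1 ^+ 3.
  rewrite -mulrA normrM ger0_norm// ler_wpM2l// normrM.
  apply: le_trans k3; rewrite (ger0_norm (exprn_ge0 5 (ltW k0))).
  have -> : ker e z ^+ 3 = (sq3 z + e ^+ 2) * ker e z ^+ 5.
    by rewrite -[LHS]mul1r -kE; ring.
  by rewrite ler_wpM2r// exprn_ge0// ltW.
rewrite /kerd; apply: le_trans (ler_normB _ _) _; apply: le_trans (lerD b1 b2) _.
by rewrite le_eqVlt; apply/orP; left; apply/eqP; ring.
Qed.

(** The divergence of [kerv e], by [kerd_div]. *)
Definition moll (z : R3) : R := 3 * e ^+ 2 * ker e z ^+ 5.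

Lemma moll_ge0 z : 0 <= moll z.
Proof.
apply: mulr_ge0; first by rewrite mulr_ge0 ?sqr_ge0.
by apply: exprn_ge0; apply: ltW; exact: ker_gt0.
Qed.

Lemma moll_cont : continuous moll.
Proof.
by apply: cont_mul; [exact: cont_cst|apply: cont_pow; exact: ker_cont].
Qed.

Lemma moll_bound z : `|moll z| <= 3 * e ^+ 2 * e^-1 ^+ 5.
Proof.
have c0 : 0 <= 3 * e ^+ 2 by rewrite mulr_ge0 ?sqr_ge0.
rewrite /moll normrM (ger0_norm c0); apply: ler_wpM2l => //.
exact: ker_pow_bound.
Qed.

(** Integration by parts, the derivative of the kernel being [kerd]. *)
Lemma conv_kerv_partial U (phi : R3 -> R) i j y : test_fun U phi ->
  conv (kerv e j) (partial i phi) y = - conv (kerd e i j) phi y.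
Proof.
move=> tp; rewrite /conv (rint_by_parts i (Ck_kerv e0 1 j y) tp); congr (- _).
apply: eq_Rintegral => x _; congr (_ * _); apply: partial_val.
exact: is_derive_kerv.
Qed.

Lemma moll_ball_bounds (y : R3) (D : R) : 0 < D ->
  let m := \int[vol3]_x (moll (x - y) * \1_(eball y D) x) in
  m <= 4 * pi /\ 4 * pi - m <= 8 * pi * (e ^+ 2 / D ^+ 2).
Proof.
move=> D0 m; have mE : m = _ := ker5_ball e0 y (ltW D0).
have p0 := pi_gt0 R.
have a0 : 0 < D ^+ 2 + e ^+ 2 by rewrite ltr_wpDl ?sqr_ge0// exprn_gt0.
have s0 := rsqrt_gt0 a0; have sE := rsqrt_sqr a0.
set s := rsqrt _ in mE s0 sE.
pose u := D * s; have u0 : 0 < u by rewrite mulr_gt0.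
have {}sE : s ^+ 2 * (D ^+ 2 + e ^+ 2) = 1 by rewrite sE mulVf// gt_eqF.
have uE : 1 - u ^+ 2 = e ^+ 2 * s ^+ 2 by rewrite /u -[X in X - _]sE; ring.
have es0 : 0 <= e ^+ 2 * s ^+ 2 by rewrite mulr_ge0 ?sqr_ge0.
have u1 : u <= 1 by rewrite -(expr1n _ 2) in uE *; nra.
have {}mE : m = 4 * pi * u ^+ 3 by rewrite mE /u; ring.
have esD : e ^+ 2 * s ^+ 2 <= e ^+ 2 / D ^+ 2.
  rewrite ler_pdivlMr ?exprn_gt0// -mulrA ler_piMr ?sqr_ge0//.
  by rewrite -sE ler_wpM2l ?sqr_ge0// lerDl sqr_ge0.
split; first by rewrite mE ler_piMr ?mulr_ge0 ?(ltW p0)// exprn_ile1 ?(ltW u0).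
have -> : 4 * pi - m = 4 * pi * (1 - u ^+ 3) by rewrite mE; ring.
have : 1 - u ^+ 3 <= 2 * (e ^+ 2 / D ^+ 2).
  apply: (@le_trans _ _ ((1 - u ^+ 2) * (1 + u ^+ 2))).
    have : u ^+ 4 <= u ^+ 3 by rewrite exprS ler_piMl// exprn_ge0// ltW.
    have -> : (1 - u ^+ 2) * (1 + u ^+ 2) = 1 - u ^+ 4 by ring.
    lra.
  rewrite uE mulrC; apply: ler_pM => //; first by rewrite addr_ge0 ?sqr_ge0.
  by have : u ^+ 2 <= 1 by [rewrite exprn_ile1 ?(ltW u0)]; lra.
have -> : 8 * pi * (e ^+ 2 / D ^+ 2) = 4 * pi * (2 * (e ^+ 2 / D ^+ 2)) by ring.
by rewrite ler_pM2l// mulr_gt0.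
Qed.

(** Since [e^2 (|z|^2 + e^2)^(-5/2) |z|^2 <= e (|z|^2 + e^2)^(-1)], the mass of
    [moll e] away from the origin vanishes with [e]. *)
Lemma moll_moment (y : R3) (D : R) : 0 <= D ->
  \int[vol3]_x (moll (x - y) * sq3 (x - y) * \1_(eball y D) x) <=
  12 * pi * e * D.
Proof.
move=> D0; have iB := itg_eball y D.
have i2 : itg vol3 (fun x => ker e (x - y) ^+ 2 * \1_(eball y D) x).
  have ck : continuous (fun z : R3 => ker e z ^+ 2).
    by apply: cont_pow; exact: ker_cont.
  exact: (conv_itg y ck (@ker_pow_bound 2) iB).
have pt (z : R3) : moll z * sq3 z <= 3 * e * ker e z ^+ 2.
  have k0 := ker_gt0 e0 z; have kE := ker_sqr e0 z; have kl := ker_le e0 z.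
  have b1 : ker e z ^+ 2 * sq3 z <= 1.
    by rewrite -kE ler_wpM2l ?sqr_ge0// lerDl sqr_ge0.
  have b2 : e * ker e z <= 1 by rewrite -(divff (lt0r_neq0 e0)) ler_pM2l.
  have -> : moll z * sq3 z = 3 * e * ker e z ^+ 2 *
    ((e * ker e z) * (ker e z ^+ 2 * sq3 z)) by rewrite /moll; ring.
  apply: ler_piMr; first by rewrite !mulr_ge0 ?sqr_ge0 ?(ltW e0) ?(ltW k0).
  apply: mulr_ile1 => //; first by rewrite mulr_ge0 ?(ltW e0) ?(ltW k0).
  by rewrite mulr_ge0 ?sqr_ge0 ?sq3_ge0.
have i5 : itg vol3 (fun x => moll (x - y) * sq3 (x - y) * \1_(eball y D) x).
  apply: (@itg_bdM _ T3 R vol3 (3 * e * e^-1 ^+ 2)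
    (fun x : R3 => moll (x - y) * sq3 (x - y)) _ _ _ iB).
  - apply: cont_measurable3; apply: cont_mul; last exact: sq3_cont.
    by apply: cont_sub3; exact: moll_cont.
  - move=> x; rewrite ger0_norm; last first.
      by apply: mulr_ge0; [exact: moll_ge0|exact: sq3_ge0].
    apply: le_trans (pt _) _; apply: ler_wpM2l; first by rewrite mulr_ge0 ?(ltW e0).
    by apply: le_trans (ler_norm _) _; exact: ker_pow_bound.
apply: (@le_trans _ _ (\int[vol3]_x (3 * e * (ker e (x - y) ^+ 2 * \1_(eball y D) x)))).
  apply: (@rint_le _ T3 R vol3 _ _ i5 (itgZ _ i2)) => x.
  rewrite [leRHS]mulrA indicE; case: (_ \in _); rewrite ?mulr0 ?mulr1//.
rewrite (rintZ _ i2).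
have -> : 12 * pi * e * D = 3 * e * (4 * pi * D) by ring.
by rewrite ler_wpM2l ?mulr_ge0 ?(ltW e0)//; exact: ker2_ball.
Qed.

End FixedScale.

(** [moll e] is an approximate identity of mass [4 pi]. With a Lipschitz constant
    [L] of [phi], [|phi x - phi y| <= 3 L |x - y| <= 3 L (eta + |x - y|^2 / eta)],
    and the second moment of [moll (eta^2)] is of order [eta^2]. *)
Lemma mollify (A : set R3) (D : R) (phi : R3 -> R) : 0 < D ->
  (forall x y, A x -> A y -> eball y D x) -> test_fun A phi ->
  exists2 C, 0 <= C & forall eta y, 0 < eta -> eta <= 1 -> A y ->
    `|conv (moll (eta ^+ 2)) phi y - 4 * pi * phi y| <= C * eta.
Proof.
move=> D0 AD tp; have p0 := pi_gt0 R.
have Cp := test_fun_Ck 1 tp; have bp := test_fun_bounded tp.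
have [F F0 pF] := cont_bounded (Ck_cont Cp) bp.
have [L L0 pL] : exists2 L, 0 <= L & forall j x, `|partial j phi x| <= L.
  have bd j := cont_bounded (test_fun_partial_cont (i := j) tp)
    (bounded_support_partial j bp).
  have /choice[b Hb] : forall j, exists b, 0 <= b /\ forall x, `|partial j phi x| <= b.
    by move=> j; have [b] := bd j; exists b.
  exists (\sum_j b j) => [|j x]; first by apply: sumr_ge0 => j _; exact: (Hb j).1.
  apply: le_trans ((Hb j).2 x) _; rewrite (bigD1 j)//= lerDl.
  by apply: sumr_ge0 => l _; exact: (Hb l).1.
pose C := 3 * L * (4 * pi + 12 * pi * D) + F * (8 * pi / D ^+ 2).
have p8 : 0 <= 8 * pi / D ^+ 2 by rewrite divr_ge0 ?sqr_ge0// mulr_ge0// ltW.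
exists C; first by rewrite /C addr_ge0// mulr_ge0// ?mulr_ge0// addr_ge0// ?mulr_ge0// ltW.
move=> eta y n0 n1 Ay.
pose e := eta ^+ 2; have e0 : 0 < e by rewrite exprn_gt0.
rewrite -/e.
have [K [cK KA] K0] := test_fun_supp tp.
pose B := eball y D.
have iB : itg vol3 (\1_B : R3 -> R) := itg_eball y D.
have ip := test_fun_itg tp.
have im f : itg vol3 f -> itg vol3 (fun x => moll e (x - y) * f x).
  exact: (conv_itg y (moll_cont e0) (moll_bound e0)).
have [m1 m2] := moll_ball_bounds e0 y D0; rewrite -/B in m1 m2.
set m := \int[vol3]_x _ in m1 m2.
have phiB x : phi x = phi x * \1_B x.
  have [Kx|/K0 ->] := pselect (K x); last by rewrite mul0r.
  by rewrite indicE mem_set ?mulr1//; apply: AD => //; exact: KA.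
have E1 : conv (moll e) phi y - phi y * m =
    \int[vol3]_x (moll e (x - y) * ((phi x - phi y) * \1_B x)).
  rewrite /m -rintZ; last exact: im.
  rewrite /conv -rintB; [|exact: im|by apply: itgZ; exact: im].
  by apply: eq_Rintegral => x _; rewrite {1}phiB; ring.
have iq : itg vol3 (fun x => moll e (x - y) * sq3 (x - y) * \1_B x).
  have ci : itg vol3 (fun x => sq3 (x - y) * \1_B x).
    apply: (@itg_fin _ T3 R vol3 B (D ^+ 2)).
    - exact: eball_measurable.
    - exact: eball_lty.
    - apply: measurable_funM; first exact: (cont_measurable3 (@sq3_cont R y)).
      by apply: measurable_indic; exact: eball_measurable.
    - move=> x; rewrite indicE mem_eball.
      have [h|h] := ltP (sq3 (x - y)) (D ^+ 2); rewrite ?mulr1 ?mulr0 ?normr0 ?sqr_ge0//.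
      by rewrite ger0_norm ?sq3_ge0// ltW.
    - by move=> x Bx; rewrite indicE memNset// mulr0.
  by apply: itg_eq (im _ ci) => x; ring.
have bound1 : `|conv (moll e) phi y - phi y * m| <=
    3 * L * (eta * (4 * pi) + eta^-1 * (12 * pi * e * D)).
  rewrite E1.
  pose g x := 3 * L * (eta * (moll e (x - y) * \1_B x) +
      eta^-1 * (moll e (x - y) * sq3 (x - y) * \1_B x)).
  have ig1 : itg vol3 (fun x => eta * (moll e (x - y) * \1_B x)) by apply/itgZ/im.
  have ig2 : itg vol3 (fun x => eta^-1 * (moll e (x - y) * sq3 (x - y) * \1_B x)).
    exact: itgZ.
  apply: (@le_trans _ _ (\int[vol3]_x g x)).
    apply: rint_norm_le.
    - have := im _ (itgB ip (itgZ (phi y) iB)); apply: itg_eq => x.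
      by rewrite {1}phiB; ring.
    - by apply: itgZ; exact: itgD.
    - move=> x; rewrite /g indicE; case: (x \in B); last first.
        by rewrite !mulr0 normr0 addr0 mulr0.
      rewrite !mulr1 normrM (ger0_norm (moll_ge0 e0 _)).
      have -> : 3 * L * (eta * moll e (x - y) + eta^-1 * (moll e (x - y) * sq3 (x - y)))
        = moll e (x - y) * (3 * L * (eta + eta^-1 * sq3 (x - y))) by ring.
      rewrite ler_wpM2l ?moll_ge0//; apply: le_trans (lipschitz Cp pL x y) _.
      rewrite ler_wpM2l ?mulr_ge0//.
      apply: (@le_trans _ _ (eta + eta^-1 * `|x - y| ^+ 2)).
        have [h|h] := leP `|x - y| eta.
          by rewrite (le_trans h)// lerDl mulr_ge0 ?sqr_ge0// invr_ge0 ltW.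
        rewrite -[leLHS]add0r lerD ?(ltW n0)// ler_pdivlMl// expr2.
        by rewrite ler_wpM2r// ltW.
      by rewrite lerD2l ler_wpM2l ?invr_ge0 ?(ltW n0)//; exact: norm_sqr_le_sq3.
  rewrite /g rintZ; last exact: itgD.
  rewrite ler_wpM2l ?mulr_ge0// rintD// !rintZ//; last exact: im.
  apply: lerD; first by rewrite ler_wpM2l ?(ltW n0).
  rewrite ler_wpM2l ?invr_ge0 ?(ltW n0)//.
  exact: (moll_moment e0 y (ltW D0)).
have bound2 : `|phi y * m - 4 * pi * phi y| <= F * (8 * pi * (e ^+ 2 / D ^+ 2)).
  have -> : phi y * m - 4 * pi * phi y = - (phi y * (4 * pi - m)) by ring.
  rewrite normrN normrM; apply: ler_pM => //.
  by rewrite ger0_norm// subr_ge0.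
have -> : conv (moll e) phi y - 4 * pi * phi y =
  (conv (moll e) phi y - phi y * m) + (phi y * m - 4 * pi * phi y) by ring.
apply: le_trans (ler_normD _ _) _; apply: le_trans (lerD bound1 bound2) _.
have -> : C * eta = 3 * L * (4 * pi + 12 * pi * D) * eta +
  F * (8 * pi / D ^+ 2) * eta by rewrite /C; ring.
apply: lerD.
  rewrite le_eqVlt; apply/orP; left; apply/eqP; rewrite /e; field.
  exact: lt0r_neq0.
have -> : F * (8 * pi * (e ^+ 2 / D ^+ 2)) = F * (8 * pi / D ^+ 2) * e ^+ 2 by ring.
apply: ler_wpM2l; first by rewrite mulr_ge0.
by rewrite /e -exprM exprS ler_piMr ?(ltW n0)// exprn_ile1// ltW.
Qed.

End Mollification.

(** * Preliminaries to the bilinear estimate *)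

Section BilinearPreliminaries.
Context {R : realType}.
Local Notation R3 := (R * R * R)%type.
Local Notation T3 := (measurableTypeR R * measurableTypeR R * measurableTypeR R)%type.
Local Notation i0 := (@Ordinal 3 0 isT).
Local Notation i1 := (@Ordinal 3 1 isT).
Local Notation i2 := (@Ordinal 3 2 isT).

Lemma ord3P (j : 'I_3) : [\/ j = i0, j = i1 | j = i2].
Proof.
case: j => [[|[|[|?]]] ?] //.
- by apply: Or31; exact: val_inj.
- by apply: Or32; exact: val_inj.
- by apply: Or33; exact: val_inj.
Qed.

Lemma coord3_grad i (f : R3 -> R) x : coord3 i (grad f x) = partial i f x.
Proof. by have [->|->|->] := ord3P i. Qed.

(** For an antisymmetric matrix [c] the sum is a triple product [V . (w x k)],
    where [w] lists the off-diagonal entries of [c]; it is at most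
    [|V| |w| |k|], and Young's inequality splits this product. *)
Lemma antisymmetric_sum_bound (V k : 'I_3 -> R) (c : 'I_3 -> 'I_3 -> R) (m : R) :
  0 < m -> \sum_(j < 3) k j ^+ 2 <= m ^+ 2 -> (forall i j, c i j = - c j i) ->
  `| \sum_(i < 3) \sum_(j < 3) V i * (k j * c i j) | <=
  m / 2 * (\sum_(i < 3) V i ^+ 2 +
           (c i2 i1 ^+ 2 + c i0 i2 ^+ 2 + c i1 i0 ^+ 2)).
Proof.
move=> m0 km cA.
have cD i : c i i = 0 by have := cA i i; lra.
move: km; rewrite !sum3 !cD (cA i0 i1) (cA i1 i2) (cA i2 i0).
move: (V i0) (V i1) (V i2) (k i0) (k i1) (k i2) (c i2 i1) (c i0 i2) (c i1 i0).
move=> a b c' x y z p q r km.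
pose S := a * (z * q - y * r) + b * (x * r - z * p) + c' * (y * p - x * q).
have H (s : R) : s ^+ 2 = 1 ->
    s * S <= m / 2 * (a ^+ 2 + b ^+ 2 + c' ^+ 2 + (p ^+ 2 + q ^+ 2 + r ^+ 2)).
  move=> s1; rewrite -subr_ge0 -(pmulr_rge0 _ m0).
  have e1 : 0 <= (m * a - s * (z * q - y * r)) ^+ 2 + (m * b - s * (x * r - z * p)) ^+ 2
    + (m * c' - s * (y * p - x * q)) ^+ 2 by rewrite !addr_ge0 ?sqr_ge0.
  have e2 : 0 <= (m ^+ 2 - (x ^+ 2 + y ^+ 2 + z ^+ 2)) * (p ^+ 2 + q ^+ 2 + r ^+ 2).
    by rewrite mulr_ge0 ?subr_ge0// !addr_ge0 ?sqr_ge0.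
  have e3 := sqr_ge0 (x * p + y * q + z * r).
  have -> : m * (m / 2 * (a ^+ 2 + b ^+ 2 + c' ^+ 2 + (p ^+ 2 + q ^+ 2 + r ^+ 2)) - s * S)
    = 2^-1 * (((m * a - s * (z * q - y * r)) ^+ 2 + (m * b - s * (x * r - z * p)) ^+ 2
    + (m * c' - s * (y * p - x * q)) ^+ 2) +
    (m ^+ 2 - (x ^+ 2 + y ^+ 2 + z ^+ 2)) * (p ^+ 2 + q ^+ 2 + r ^+ 2) +
    (x * p + y * q + z * r) ^+ 2 + (1 - s ^+ 2) * ((z * q - y * r) ^+ 2 +
     (x * r - z * p) ^+ 2 + (y * p - x * q) ^+ 2)).
    by rewrite /S; field.
  by rewrite s1 subrr mul0r addr0; apply: mulr_ge0 => //; apply: addr_ge0 => //; exact: addr_ge0.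
have s1 : (-1 : R) ^+ 2 = 1 by rewrite sqrrN expr1n.
rewrite [X in `|X|](_ : _ = S); last by rewrite /S; ring.
rewrite ler_norml; apply/andP; split; first by have := H _ s1; rewrite mulN1r lerNl.
by have := H 1 (expr1n _ 2); rewrite mul1r.
Qed.

Variable Omega : set R3.
Hypothesis oO : open Omega.
Hypothesis bO : bounded_set Omega.

Let mO : measurable (Omega : set T3). Proof. exact: open_measurable3. Qed.
Let finO : (vol3 Omega < +oo)%E. Proof. exact: bounded_vol3_lty. Qed.

Lemma domain_in_ball : exists2 D, 0 < D &
  (forall y, Omega y -> sq3 y <= D ^+ 2) /\
  (forall x y, Omega x -> Omega y -> eball y D x).
Proof.
have [M [_ OM]] := bO.
have {}OM x : Omega x -> `|x| <= `|M| + 1.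
  by move=> Ox; apply: OM; rewrite // (le_lt_trans (ler_norm M))// ltrDl.
pose N := `|M| + 1; have N1 : 1 <= N by rewrite lerDr.
exists (4 * N); first by lra.
split=> [y /OM yN|x y /OM xN /OM yN].
  apply: le_trans (sq3_le_norm y) _; rewrite -/N in yN.
  by have := normr_ge0 y; nra.
apply: le_lt_trans (sq3_le_norm _) _.
have : `|x - y| <= 2 * N.
  by apply: le_trans (ler_normB _ _) _; rewrite -/N in xN yN; lra.
by have := normr_ge0 (x - y); nra.
Qed.

Lemma test_fun_partial_outside (phi : R3 -> R) i x : test_fun Omega phi ->
  ~ Omega x -> partial i phi x = 0.
Proof.
move=> /test_fun_supp[K [cK KO] K0] Ox.
rewrite /partial -(derive_cst (0 : R) x (basis3 i)); apply: near_eq_derive.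
have oK : open (~` K) by apply: closed_openC; exact: compact_closed (@R3_hausdorff R) cK.
have : \forall y \near x, ~ K y by apply: oK => /KO.
by apply: filterS => y /K0.
Qed.

(** A translate of the kernel, cut off away from [Omega], is an admissible
    potential, so a tangent field is orthogonal to its gradient. *)
Lemma tangent_kerd (e : R) (v : R3 -> R3) (j : 'I_3) (x : R3) : 0 < e ->
  tangent_to_boundary Omega v ->
  \int[vol3]_y (\sum_(i < 3) kerd e i j (x - y) * ext Omega v i y) = 0.
Proof.
move=> e0 tv; have [D D0 [OD _]] := domain_in_ball.
have [chi [Cchi chi1 chi0]] := cutoff_exists D0.
pose psi (y : R3) : R := chi y * kerv e j (y - x).
have tp : test_fun setT psi.
  apply: (@test_fun_intro _ _ _ [set y : R3 | `|y| <= 2 * D]) => //.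
  - by move=> k; apply: Ck_mul; [exact: Cchi|exact: Ck_kerv].
  - exact: compact_box.
  - move=> y /negP; rewrite -ltNge /psi => yD; rewrite chi0 ?mul0r//.
    apply: le_trans (norm_sqr_le_sq3 y); rewrite ler_sqr ?nnegrE ?(ltW yD)//.
    by rewrite mulr_ge0// ltW.
transitivity (inner Omega v (grad psi)); last exact: tv.
rewrite innerE; apply: eq_Rintegral => y _.
apply: eq_bigr => i _; rewrite !extE indicE.
have [Oy|Oy] := pselect (Omega y); last by rewrite memNset// !mul0r mulr0.
rewrite mem_set// !mul1r mulrC; congr (_ * _).
rewrite coord3_grad.
rewrite -[x - y]opprB kerdN; apply/esym.
have dk := is_derive_kerv e0 i j x y.
apply: partial_val; apply: (near_eq_is_derive _ dk).
have := oO Oy; apply: filterS => z Oz.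
by rewrite /psi chi1 ?mul1r//; exact: OD.
Qed.

End BilinearPreliminaries.

(** * The bilinear estimate *)

Section BilinearEstimate.
Context {R : realType}.
Local Notation R3 := (R * R * R)%type.
Local Notation T3 := (measurableTypeR R * measurableTypeR R * measurableTypeR R)%type.
Local Notation i0 := (@Ordinal 3 0 isT).
Local Notation i1 := (@Ordinal 3 1 isT).
Local Notation i2 := (@Ordinal 3 2 isT).
Variable Omega : set R3.
Hypothesis oO : open Omega.
Hypothesis bO : bounded_set Omega.

(* Stated for variables, because [ring] would compare the unfolded integrands. *)
Let half_split (k a b : R) : k / 2 * (a + b) = 2^-1 * (a * k + k * b).
Proof. by ring. Qed.

Let mO : measurable (Omega : set T3). Proof. exact: open_measurable3. Qed.
Let finO : (vol3 Omega < +oo)%E. Proof. exact: bounded_vol3_lty. Qed.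

Section FixedFields.
Variables (r : R) (v phi : R3 -> R3).
Hypothesis r0 : 0 <= r.
Hypothesis volO : vol3 Omega = (4 / 3 * pi * r ^+ 3)%:E.
Hypothesis Lv : L2_field Omega v.
Hypothesis tv : tangent_to_boundary Omega v.
Hypothesis tphi : test_field Omega phi.

Let V i := ext Omega v i.
(* [c] is the antisymmetrized derivative of [phi], whose three independent
   entries are the components [w] of [curl phi]. *)
Let p i : R3 -> R := coord3 i \o phi.
Let c i j (x : R3) : R := partial j (p i) x - partial i (p j) x.
Let w i (x : R3) : R := coord3 i (curl phi x).

Let iV i : itg vol3 (V i). Proof. exact: ext_itg. Qed.
Let tp i : test_fun Omega (p i). Proof. exact: tphi. Qed.
Let ip i : itg vol3 (p i). Proof. exact: test_fun_itg (tp i). Qed.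
Let idp i j : itg vol3 (partial j (p i)).
Proof. exact: test_fun_partial_itg (tp i). Qed.
Let ic i j : itg vol3 (c i j). Proof. exact: itgB. Qed.

Lemma L2_test_field : L2_field Omega phi.
Proof.
apply: L2_cont => // i; first exact: (Ck_cont (test_fun_Ck 0 (tp i))).
exact: test_fun_bounded (tp i).
Qed.

Let wE : [/\ w i0 = c i2 i1, w i1 = c i0 i2 & w i2 = c i1 i0].
Proof. by []. Qed.

Let cA i j x : c i j x = - c j i x. Proof. by rewrite /c opprB. Qed.

Let w_cont i : continuous (w i).
Proof.
have cc k l : continuous (c k l).
  by apply: cont_sub; exact: test_fun_partial_cont.
by have [h0 h1 h2] := wE; have [->|->|->] := ord3P i; rewrite ?h0 ?h1 ?h2; exact: cc.
Qed.

Let c_bounded k l : bounded_support (c k l).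
Proof.
have [M1 H1] := bounded_support_partial l (test_fun_bounded (tp k)).
have [M2 H2] := bounded_support_partial k (test_fun_bounded (tp l)).
exists (Num.max M1 M2) => x; rewrite gt_max => /andP[x1 x2].
by rewrite /c H1// H2// subrr.
Qed.

Let w_bounded i : bounded_support (w i).
Proof.
by have [h0 h1 h2] := wE; have [->|->|->] := ord3P i; rewrite ?h0 ?h1 ?h2;
  exact: c_bounded.
Qed.

Let w_outside i x : ~ Omega x -> w i x = 0.
Proof.
move=> Ox; have c0 k l : c k l x = 0.
  by rewrite /c (test_fun_partial_outside _ (tp k) Ox) (test_fun_partial_outside _ (tp l) Ox) subrr.
by have [h0 h1 h2] := wE; have [->|->|->] := ord3P i; rewrite ?h0 ?h1 ?h2; exact: c0.
Qed.

Lemma L2_curl : L2_field Omega (curl phi).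
Proof. exact: (L2_cont mO finO w_cont w_bounded). Qed.

Let W (x : R3) : R := \sum_(i < 3) w i x ^+ 2.
Let N (y : R3) : R := \sum_(i < 3) V i y ^+ 2.

Let iW : itg vol3 W.
Proof.
apply: itg_sum => i _; apply: itg_cont; first by apply: cont_pow; exact: w_cont.
by have [M H] := w_bounded i; exists M => x /H ->; rewrite expr0n.
Qed.

Let iN : itg vol3 N.
Proof. by apply: itg_sum => i _; exact: ((L2_fieldE _ _).1 Lv i).2. Qed.

Let normW : \int[vol3]_x W x = inner Omega (curl phi) (curl phi).
Proof.
rewrite innerE; apply: eq_Rintegral => x _; apply: eq_bigr => i _.
have -> : ext Omega (curl phi) i x = w i x; last by rewrite expr2.
rewrite extE indicE; have [Ox|Ox] := pselect (Omega x).
  by rewrite mem_set// mul1r.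
by rewrite memNset// mul0r w_outside.
Qed.

Let normN : \int[vol3]_y N y = inner Omega v v.
Proof.
rewrite innerE; apply: eq_Rintegral => x _.
by apply: eq_bigr => i _; rewrite expr2.
Qed.

Let iO : itg vol3 (\1_Omega : R3 -> R). Proof. exact: itg_indic. Qed.

Section Scale.
Variable (e : R).
Hypothesis e0 : 0 < e.

(* The product of [v] with the regularized Biot-Savart integral of [curl phi],
   up to sign. *)
Let Q (y : R3) : R :=
  \sum_(i < 3) \sum_(j < 3) V i y * conv (kerv e j) (c i j) y.

Let iQ : itg vol3 Q.
Proof.
apply: itg_sum => i _; apply: itg_sum => j _.
by have [] := conv_swap (@kerv_cont R e j e0) (kerv_bound e0 j) (ic i j) (iV i).
Qed.

Let iM i : itg vol3 (fun y => V i y * conv (moll e) (p i) y).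
Proof. by have [] := conv_swap (moll_cont e0) (moll_bound e0) (ip i) (iV i). Qed.

Let iD i j : itg vol3 (fun y => V i y * conv (kerd e i j) (p j) y).
Proof.
by have [] := conv_swap (@kerd_cont R e i j e0) (kerd_bound e0 i j) (ip j) (iV i).
Qed.

(* In [kerv e j * (partial j (p i) - partial i (p j))] both derivatives move onto
   the kernel; the first one gives its divergence, that is [moll e]. *)
Let QE y : Q y = \sum_(i < 3) \sum_(j < 3) V i y * conv (kerd e i j) (p j) y -
  \sum_(i < 3) V i y * conv (moll e) (p i) y.
Proof.
have convB j f g : itg vol3 f -> itg vol3 g ->
    conv (kerv e j) (fun x => f x - g x) y = conv (kerv e j) f y - conv (kerv e j) g y.
  move=> hf hg; rewrite /conv -rintB.
  - by apply: eq_Rintegral => x _; rewrite mulrBr.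
  - exact: (conv_itg y (@kerv_cont R e j e0) (kerv_bound e0 j) hf).
  - exact: (conv_itg y (@kerv_cont R e j e0) (kerv_bound e0 j) hg).
have mollE i : conv (moll e) (p i) y = \sum_(j < 3) conv (kerd e j j) (p i) y.
  rewrite /conv -rint_sum; last first.
    by move=> j _; exact: (conv_itg y (@kerd_cont R e j j e0) (kerd_bound e0 j j)).
  apply: eq_Rintegral => x _; rewrite -mulr_suml; congr (_ * _).
  by rewrite kerd_div.
rewrite -sumrB; apply: eq_bigr => i _; rewrite mollE mulr_sumr -sumrB.
apply: eq_bigr => j _; rewrite convB// !(conv_kerv_partial e0 _ _ _ (tp _)).
by ring.
Qed.

(* For fixed [x] and [j] the vector [kerd e i j (x - y)], indexed by [i], is a
   gradient in [y], to which [v] is orthogonal. *)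
Let gradient_part :
  \int[vol3]_y (\sum_(i < 3) \sum_(j < 3) V i y * conv (kerd e i j) (p j) y) = 0.
Proof.
rewrite rint_sum; last by move=> i _; apply: itg_sum => j _; exact: iD.
under eq_bigr => i _ do rewrite rint_sum//.
rewrite exchange_big /= big1// => j _.
have sw i := conv_swap (@kerd_cont R e i j e0) (kerd_bound e0 i j) (ip j) (iV i).
transitivity (\sum_(i < 3) \int[vol3]_x (p j x *
    \int[vol3]_y (kerd e i j (x - y) * V i y))).
  by apply: eq_bigr => i _; have [] := sw i.
rewrite -rint_sum; last by move=> i _; have [] := sw i.
rewrite -[RHS](rint0 vol3); apply: eq_Rintegral => x _.
rewrite -mulr_sumr -rint_sum; last first.
  move=> i _; apply: (@itg_bdM _ T3 R vol3 (4 * e^-1 ^+ 3)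
    (fun y : R3 => kerd e i j (x - y)) _ _ _ (iV i)).
    apply: cont_measurable3.
    rewrite (_ : (fun y => _) = (fun y => kerd e i j (y - x))).
      exact/cont_sub3/kerd_cont.
    by apply/funext => y; rewrite -[x - y]opprB kerdN.
  by move=> y; exact: kerd_bound.
by rewrite (tangent_kerd oO bO j x e0 tv) mulr0.
Qed.

(* Young's inequality makes the bound symmetric in [v y] and [curl phi x]; each
   of the two double integrals is at most [4 pi r] times a squared norm. *)
Let Q_bound : `|\int[vol3]_y Q y| <=
  2 * pi * r * (inner Omega v v + inner Omega (curl phi) (curl phi)).
Proof.
pose k2 (z : R3) : R := ker e z ^+ 2.
have ck2 : continuous k2 by apply: cont_pow; exact: ker_cont.
have k20 z : 0 < k2 z by rewrite exprn_gt0// ker_gt0.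
have bk2 : forall z, `|k2 z| <= e^-1 ^+ 2 := ker_pow_bound e0 2.
have [jN _ _] := conv_swap ck2 bk2 iO iN.
have [jO jW EW] := conv_swap ck2 bk2 iW iO.
pose G (y : R3) : R := 2^-1 * (N y * conv k2 \1_Omega y + \1_Omega y * conv k2 W y).
have iG : itg vol3 G by apply: itgZ; exact: itgD.
have QG y : `|Q y| <= G y.
  have icv i j : itg vol3 (fun x => V i y * (kerv e j (x - y) * c i j x)).
    by apply: itgZ; exact: (conv_itg y (@kerv_cont R e j e0) (kerv_bound e0 j)).
  have iq2 : itg vol3 (fun x => N y * (k2 (x - y) * \1_Omega x)).
    by apply: itgZ; exact: (conv_itg y ck2 bk2).
  have iq3 : itg vol3 (fun x => \1_Omega y * (k2 (x - y) * W x)).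
    by apply: itgZ; exact: (conv_itg y ck2 bk2).
  have -> : Q y = \int[vol3]_x (\sum_(i < 3) \sum_(j < 3)
      V i y * (kerv e j (x - y) * c i j x)).
    rewrite rint_sum; last by move=> i _; exact: itg_sum.
    apply: eq_bigr => i _; rewrite rint_sum; last by move=> j _; exact: icv.
    apply: eq_bigr => j _.
    by rewrite (rintZ _ (conv_itg y (@kerv_cont R e j e0) (kerv_bound e0 j) (ic i j))).
  have -> : G y = \int[vol3]_x (2^-1 * (N y * (k2 (x - y) * \1_Omega x) +
      \1_Omega y * (k2 (x - y) * W x))).
    rewrite (rintZ _ (itgD iq2 iq3)) (rintD iq2 iq3).
    by rewrite (rintZ _ (conv_itg y ck2 bk2 iO)) (rintZ _ (conv_itg y ck2 bk2 iW)).
  apply: (@rint_norm_le _ T3 R vol3).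
  - by apply: itg_sum => i _; exact: itg_sum.
  - by apply: itgZ; exact: itgD.
  move=> x.
  have N0 : 0 <= N y by apply: sumr_ge0 => i _; exact: sqr_ge0.
  have W0 : 0 <= W x by apply: sumr_ge0 => i _; exact: sqr_ge0.
  have I0 t : 0 <= \1_Omega t :> R by rewrite indicE ler0n.
  have [Oy|Oy] := pselect (Omega y); last first.
    have V0 i : V i y = 0 by rewrite /V extE indicE (memNset Oy) mul0r.
    rewrite big1; last by move=> i _; apply: big1 => j _; rewrite V0 mul0r.
    rewrite normr0 /N big1; last by move=> i _; rewrite V0 expr0n.
    have -> : \1_Omega y = 0 :> R by rewrite indicE (memNset Oy).
    by rewrite !mul0r addr0 mulr0.
  have [Ox|Ox] := pselect (Omega x); last first.
    have c0 k l : c k l x = 0 by rewrite /c (test_fun_partial_outside _ (tp k) Ox) (test_fun_partial_outside _ (tp l) Ox) subrr.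
    rewrite big1; last by move=> i _; apply: big1 => j _; rewrite c0 !mulr0.
    have k0 := ltW (k20 (x - y)); have h2 : 0 <= 2^-1 :> R by rewrite invr_ge0.
    rewrite normr0.
    exact: (mulr_ge0 h2 (addr_ge0 (mulr_ge0 N0 (mulr_ge0 k0 (I0 x)))
      (mulr_ge0 (I0 y) (mulr_ge0 k0 W0)))).
  have Ix : \1_Omega x = 1 :> R by rewrite indicE (mem_set Ox).
  have Iy : \1_Omega y = 1 :> R by rewrite indicE (mem_set Oy).
  rewrite Ix Iy mulr1 mul1r.
  have := @antisymmetric_sum_bound R (V ^~ y) (kerv e ^~ (x - y))
    (fun i j => c i j x) _ (k20 (x - y)) (kerv_sqr e0 (x - y))
    (fun i j => cA i j x).
  move/le_trans; apply.
  have [h0 h1 h2] := wE.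
  have -> : W x = c i2 i1 x ^+ 2 + c i0 i2 x ^+ 2 + c i1 i0 x ^+ 2.
    by rewrite /W sum3 h0 h1 h2.
  rewrite le_eqVlt; apply/orP; left; apply/eqP.
  exact: half_split.
have conv_O y : conv k2 \1_Omega y <= 4 * pi * r by exact: ker2_domain.
apply: (@le_trans _ _ (\int[vol3]_y G y)); first exact: rint_norm_le.
rewrite rintZ; last exact: itgD.
rewrite (rintD jN jO) EW -normN -normW.
have b1 : \int[vol3]_y (N y * conv k2 \1_Omega y) <= 4 * pi * r * \int[vol3]_y N y.
  rewrite -(rintZ _ iN); apply: (@rint_le _ T3 R vol3 _ _ jN (itgZ _ iN)) => y.
  rewrite mulrC; apply: ler_wpM2r (conv_O y).
  by apply: sumr_ge0 => i _; exact: sqr_ge0.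
have b2 : \int[vol3]_x (W x * \int[vol3]_y (k2 (x - y) * \1_Omega y)) <=
    4 * pi * r * \int[vol3]_y W y.
  rewrite -(rintZ _ iW); apply: (@rint_le _ T3 R vol3 _ _ jW (itgZ _ iW)) => x.
  rewrite mulrC; apply: ler_wpM2r.
    by apply: sumr_ge0 => i _; exact: sqr_ge0.
  apply: le_trans (conv_O x); rewrite le_eqVlt; apply/orP; left; apply/eqP.
  by apply: eq_Rintegral => y _; rewrite /k2 -kerN opprB.
have -> : 2 * pi * r * (\int[vol3]_y N y + \int[vol3]_x W x) =
  2^-1 * (4 * pi * r * \int[vol3]_y N y + 4 * pi * r * \int[vol3]_x W x) by field.
by apply: ler_wpM2l; [rewrite invr_ge0|exact: lerD b1 b2].
Qed.

Lemma mollified_bound :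
  `|\sum_(i < 3) \int[vol3]_y (V i y * conv (moll e) (p i) y)| <=
  2 * pi * r * (inner Omega v v + inner Omega (curl phi) (curl phi)).
Proof.
rewrite -rint_sum//; apply: le_trans Q_bound; rewrite le_eqVlt; apply/orP; left.
rewrite -normrN; apply/eqP; congr (`| _ |).
have -> : \int[vol3]_y Q y = \int[vol3]_y (\sum_(i < 3) \sum_(j < 3)
  V i y * conv (kerd e i j) (p j) y - \sum_(i < 3) V i y * conv (moll e) (p i) y).
  by apply: eq_Rintegral => y _; exact: QE.
rewrite rintB; [|by apply: itg_sum => i _; exact: itg_sum|exact: itg_sum].
by rewrite gradient_part sub0r.
Qed.

End Scale.

(** The weak form of the bound by [r] on the inverse of the curl. The convolution
    in [mollified_bound] tends to [4 pi phi] as the scale tends to [0]. *)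
Lemma bilinear_estimate : `|inner Omega v phi| <=
  r / 2 * (inner Omega v v + inner Omega (curl phi) (curl phi)).
Proof.
have [D D0 [_ OD]] := domain_in_ball bO; have p0 := pi_gt0 R.
have /choice[C HC] : forall i, exists C, 0 <= C /\ forall eta y, 0 < eta ->
    eta <= 1 -> Omega y ->
    `|conv (moll (eta ^+ 2)) (p i) y - 4 * pi * p i y| <= C * eta.
  by move=> i; have [C] := mollify D0 OD (tp i); exists C.
pose T := inner Omega v v + inner Omega (curl phi) (curl phi).
pose A := \sum_(i < 3) C i * \int[vol3]_y `|V i y|.
have A0 : 0 <= A.
  by apply: sumr_ge0 => i _; rewrite mulr_ge0 ?(HC i).1//; exact: rint_ge0.
have iVp i : itg vol3 (fun y => V i y * p i y).
  have [B B0 pB] := cont_bounded (Ck_cont (test_fun_Ck 0 (tp i))) (test_fun_bounded (tp i)).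
  have mp := cont_measurable3 (Ck_cont (test_fun_Ck 0 (tp i))).
  by apply: itg_eq (itg_bdM mp pB (iV i)) => y; rewrite mulrC.
have innE : inner Omega v phi = \sum_(i < 3) \int[vol3]_y (V i y * p i y).
  rewrite innerS//; last exact: L2_test_field.
  apply: eq_bigr => i _; apply: eq_Rintegral => y _; rewrite /V /p !extE indicE.
  by case: (_ \in _); rewrite ?mul1r ?mul0r.
have key eta : 0 < eta -> eta <= 1 ->
    4 * pi * `|inner Omega v phi| <= 2 * pi * r * T + A * eta.
  move=> n0 n1; have e0 : 0 < eta ^+ 2 by rewrite exprn_gt0.
  have mb := mollified_bound e0.
  have iM i : itg vol3 (fun y => V i y * conv (moll (eta ^+ 2)) (p i) y).
    by have [] := conv_swap (moll_cont e0) (moll_bound e0) (ip i) (iV i).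
  have p4 : 0 <= 4 * pi :> R by rewrite mulr_ge0 ?ltW.
  rewrite -{1}(ger0_norm p4) -normrM innE.
  set S := \sum_(i < 3) \int[vol3]_y (V i y * conv (moll (eta ^+ 2)) (p i) y) in mb.
  have -> : 4 * pi * \sum_(i < 3) \int[vol3]_y (V i y * p i y) =
    S - \sum_(i < 3) \int[vol3]_y (V i y * (conv (moll (eta ^+ 2)) (p i) y - 4 * pi * p i y)).
    rewrite /S mulr_sumr -sumrB; apply: eq_bigr => i _.
    rewrite -rintZ// -rintB//; last first.
      by apply: itg_eq (itgB (iM i) (itgZ (4 * pi) (iVp i))) => y; ring.
    by apply: eq_Rintegral => y _; ring.
  apply: le_trans (ler_normB _ _) _; apply: lerD => //.
  rewrite /A mulr_suml; apply: le_trans (ler_norm_sum _ _ _) _.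
  apply: ler_sum => i _.
  rewrite mulrAC -rintZ; last exact: itg_norm.
  apply: (@rint_norm_le _ T3 R vol3).
  - by apply: itg_eq (itgB (iM i) (itgZ (4 * pi) (iVp i))) => y; ring.
  - by apply: itgZ; exact: itg_norm.
  move=> y; rewrite normrM mulrC.
  have [Oy|Oy] := pselect (Omega y); first by rewrite ler_wpM2r//; exact: (HC i).2.
  by rewrite /V extE indicE memNset// mul0r normr0 !mulr0.
have {}key : 4 * pi * `|inner Omega v phi| <= 2 * pi * r * T.
  apply/ler_addgt0Pr => eps eps0.
  pose eta := Num.min 1 (eps / (A + 1)).
  have A1 : 0 < A + 1 by rewrite ltr_wpDl.
  have n0 : 0 < eta by rewrite lt_min ltr01 divr_gt0.
  apply: le_trans (key eta n0 _) _; first by rewrite ge_min lexx.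
  rewrite lerD2l; apply: (@le_trans _ _ ((A + 1) * eta)).
    by rewrite ler_wpM2r ?(ltW n0)// lerDl.
  by rewrite mulrC -ler_pdivlMr// ge_min lexx orbT.
rewrite -/T -(ler_pM2l (_ : 0 < 4 * pi)) ?mulr_gt0//.
by apply: le_trans key _; rewrite le_eqVlt; apply/orP; left; apply/eqP; field.
Qed.

End FixedFields.

End BilinearEstimate.

(** * Symmetry of mixed partial derivatives *)

Section MixedPartials.
Context {R : realType}.
Local Notation R3 := (R * R * R)%type.
Implicit Types (f : R3 -> R) (x : R3).

(** Two applications of the mean value theorem, along [basis3 i] and then along
    [basis3 j]. *)
Lemma second_difference f (i j : 'I_3) x (h : R) : 0 < h -> Ck 2 f ->
  exists2 y, `|y - x| <= 2 * h &
    f (h *: basis3 j + (h *: basis3 i + x)) - f (h *: basis3 i + x) -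
      (f (h *: basis3 j + x) - f x) = h ^+ 2 * partial j (partial i f) y.
Proof.
move=> h0 Cf; have C1 := Ck_partial i Cf.
have dg y : is_derive y (basis3 i) (fun y => f (h *: basis3 j + y) - f y)
    (partial i f (h *: basis3 j + y) - partial i f y).
  apply: derive_pt_sub; last exact: (Ck_isder i (CkS Cf)).
  apply: (derive_pt_line _ _ _ _).2.
  rewrite (_ : (fun t : R => _) = fun t : R => f (t *: basis3 i + (h *: basis3 j + y))).
    exact: (derive_pt_line _ _ _ _).1 (Ck_isder i (CkS Cf) _).
  by apply/funext => t; rewrite addrCA.
have [t /andP[t0 th] Et] := MVT_line x h0 dg.
have [s /andP[s0 sh] Es] := MVT_line (t *: basis3 i + x) h0 (Ck_isder j C1).
exists (s *: basis3 j + (t *: basis3 i + x)).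
  rewrite addrA addrK; apply: le_trans (ler_normD _ _) _.
  have nb (c : R) k : 0 <= c <= h -> `|c *: basis3 k : R3| <= h.
    move=> /andP[c0 ch]; rewrite normrZ (ger0_norm c0).
    by have := norm_basis3 (R := R) k; nra.
  by have := nb s j; have := nb t i; rewrite s0 sh t0 th => /(_ isT) ? /(_ isT) ?; lra.
by rewrite Et Es; ring.
Qed.

Let half_triangle (a b c eps : R) :
  `|a - c| < eps / 2 -> `|b - c| < eps / 2 -> `|b - a| <= eps.
Proof.
by rewrite !ltr_norml ler_norml => /andP[? ?] /andP[? ?]; apply/andP; split; lra.
Qed.

Let swap_differences (a b c d : R) : a - b - (c - d) = a - c - (b - d).
Proof. by ring. Qed.

(** The second difference is symmetric in the two directions, and both second
    derivatives are continuous. *)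
Lemma mixed_partials f (i j : 'I_3) x : Ck 2 f ->
  partial i (partial j f) x = partial j (partial i f) x.
Proof.
move=> Cf.
have near_x k l (eps : R) : 0 < eps -> exists2 d : R, 0 < d & forall y,
    `|y - x| < d -> `|partial k (partial l f) x - partial k (partial l f) y| < eps.
  move=> e0; have cc : continuous (partial k (partial l f)).
    exact: (Ck_cont (Ck_partial k (Ck_partial l Cf))).
  have /cvgrPdist_lt/(_ _ e0) := cc x.
  move=> /nbhs_ballP[d /= d0 H]; exists d => // y yx; apply: H.
  by rewrite -ball_normE /ball_ /= distrC.
apply/eqP; rewrite -subr_eq0 -normr_le0; apply/ler_addgt0Pr => eps e0.
rewrite add0r; have e2 : 0 < eps / 2 by rewrite divr_gt0.
have [d d0 Hd] := near_x i j _ e2; have [d' d0' Hd'] := near_x j i _ e2.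
pose h := Num.min d d' / 4.
have h0 : 0 < h by rewrite divr_gt0// lt_min d0 d0'.
have hd : 2 * h < d.
  have : Num.min d d' <= d by rewrite ge_min lexx.
  by rewrite /h; lra.
have hd' : 2 * h < d'.
  have : Num.min d d' <= d' by rewrite ge_min lexx orbT.
  by rewrite /h; lra.
have [y yx Ey] := second_difference i j x h0 Cf.
have [z zx Ez] := second_difference j i x h0 Cf.
have yz : partial j (partial i f) y = partial i (partial j f) z.
  apply: (mulfI (lt0r_neq0 (exprn_gt0 2 h0))).
  rewrite (addrCA (h *: basis3 j) (h *: basis3 i) x) in Ey.
  apply: etrans (esym Ey) (etrans _ Ez).
  exact: swap_differences.
have := Hd _ (le_lt_trans zx hd); rewrite -yz.
exact: half_triangle (Hd' _ (le_lt_trans yx hd')).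
Qed.

End MixedPartials.

(** * Lower bound for curl eigenvalues *)

Section CurlEigenvalues.
Context {R : realType}.
Local Notation R3 := (R * R * R)%type.
Local Notation T3 := (measurableTypeR R * measurableTypeR R * measurableTypeR R)%type.
Local Notation i0 := (@Ordinal 3 0 isT).
Local Notation i1 := (@Ordinal 3 1 isT).
Local Notation i2 := (@Ordinal 3 2 isT).
Implicit Types (phi : R3 -> R3) (psi : R3 -> R).

Lemma coord3_ext (x y : R3) : (forall i, coord3 i x = coord3 i y) -> x = y.
Proof.
case: x => [[x0 x1] x2]; case: y => [[y0 y1] y2] H.
by have := H i0; have := H i1; have := H i2; rewrite /coord3 /= => -> -> ->.
Qed.

Lemma grad_lin (c : R) psi psi' : Ck 1 psi -> Ck 1 psi' ->
  grad (fun x => psi x + c * psi' x) = grad psi + c *: grad psi'.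
Proof.
move=> C1 C2; apply/funext => x; apply: coord3_ext => i.
rewrite (_ : (grad psi + c *: grad psi') x = grad psi x + c *: grad psi' x)//.
by rewrite coord3D coord3Z !coord3_grad partial_lin.
Qed.

Lemma curl_lin (c : R) phi phi' : (forall i, Ck 1 (coord3 i \o phi)) ->
  (forall i, Ck 1 (coord3 i \o phi')) ->
  curl (phi + c *: phi') = curl phi + c *: curl phi'.
Proof.
move=> C1 C2; apply/funext => x; apply: coord3_ext => i.
rewrite (_ : (curl phi + c *: curl phi') x = curl phi x + c *: curl phi' x)//.
have E k l : partial k (coord3 l \o (phi + c *: phi')) x =
    partial k (coord3 l \o phi) x + c * partial k (coord3 l \o phi') x.
  rewrite (_ : coord3 l \o _ = fun x => (coord3 l \o phi) x + c * (coord3 l \o phi') x).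
    by rewrite partial_lin.
  by apply/funext => y /=; rewrite -coord3Z -coord3D.
by rewrite coord3D coord3Z /curl !E; have [->|->|->] := ord3P i;
  rewrite /coord3 /=; ring.
Qed.

Lemma curlE phi x : let d i j := partial i (coord3 j \o phi) x in
  [/\ coord3 i0 (curl phi x) = d i1 i2 - d i2 i1,
      coord3 i1 (curl phi x) = d i2 i0 - d i0 i2
    & coord3 i2 (curl phi x) = d i0 i1 - d i1 i0].
Proof. by []. Qed.

Lemma test_field_lin U (c : R) phi phi' : test_field U phi ->
  test_field U phi' -> test_field U (phi + c *: phi').
Proof.
move=> t1 t2 i; rewrite (_ : coord3 i \o _ =
  fun x => (coord3 i \o phi) x + c * (coord3 i \o phi') x).
  exact: test_fun_lin.
by apply/funext => y /=; rewrite -coord3Z -coord3D.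
Qed.

Lemma test_field0 U : test_field U (0 : R3 -> R3).
Proof.
move=> i; rewrite (_ : _ \o _ = fun=> 0); first exact: test_fun0.
by apply/funext => x; have [->|->|->] := ord3P i.
Qed.

Lemma grad0 : grad (fun=> 0 : R) = 0.
Proof.
have := @grad_lin (-1) (fun=> 0) (fun=> 0) (Ck_cst 1 0) (Ck_cst 1 0).
by rewrite scaleN1r subrr => <-; congr grad; apply/funext => x; rewrite mulr0 addr0.
Qed.

Lemma curl0 : curl (0 : R3 -> R3) = 0.
Proof.
have C1 i : Ck 1 (coord3 i \o (0 : R3 -> R3)) := test_fun_Ck 1 (test_field0 setT i).
by have := curl_lin (-1) C1 C1; rewrite !scaleN1r !subrr.
Qed.

Lemma test_fun_sub (U U' : set R3) psi : U `<=` U' -> test_fun U psi ->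
  test_fun U' psi.
Proof. by move=> UU' [? ? ?]; split=> //; exact: subset_trans UU'. Qed.

(** Both integrals equal minus that of [a] times the mixed second derivative
    of [psi]. *)
Lemma rint_partial_swap U a psi (i j : 'I_3) : test_fun U a -> Ck 2 psi ->
  \int[vol3]_x (partial i psi x * partial j a x) =
  \int[vol3]_x (partial j psi x * partial i a x).
Proof.
move=> ta Cp.
have H1 := rint_by_parts j (Ck_partial i Cp) ta.
have H2 := rint_by_parts i (Ck_partial j Cp) ta.
have E : partial j (partial i psi) = partial i (partial j psi).
  by apply/funext => x; exact: mixed_partials.
rewrite E in H1.
exact: etrans H1 (esym H2).
Qed.

Variable Omega : set R3.
Hypothesis oO : open Omega.
Hypothesis bO : bounded_set Omega.

Let mO : measurable (Omega : set T3). Proof. exact: open_measurable3. Qed.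
Let finO : (vol3 Omega < +oo)%E. Proof. exact: bounded_vol3_lty. Qed.

Lemma L2_grad psi : test_fun setT psi -> L2_field Omega (grad psi).
Proof.
move=> tp; have E i : coord3 i \o grad psi = partial i psi.
  by apply/funext => x; exact: coord3_grad.
apply: (L2_cont mO finO) => i; rewrite E; first exact: test_fun_partial_cont tp.
exact: bounded_support_partial (test_fun_bounded tp).
Qed.

(** Integration by parts moves the second derivatives together, where they cancel
    by symmetry. *)
Lemma curl_grad_orthogonal phi psi : test_field Omega phi -> test_fun setT psi ->
  inner Omega (curl phi) (grad psi) = 0.
Proof.
move=> tphi tp; have cE := curlE phi.
have [p [pE {}tphi]] : exists p : 'I_3 -> R3 -> R,
    (fun i => coord3 i \o phi) = p /\ forall i, test_fun Omega (p i).
  by exists (fun i => coord3 i \o phi).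
have {pE}cE x : let d i j := partial i (p j) x in
    [/\ coord3 i0 (curl phi x) = d i1 i2 - d i2 i1,
        coord3 i1 (curl phi x) = d i2 i0 - d i0 i2
      & coord3 i2 (curl phi x) = d i0 i1 - d i1 i0].
  by rewrite -pE; exact: cE.
have Cp := test_fun_Ck 2 tp.
pose P i k l x := partial i psi x * partial k (p l) x.
have iP i k l : itg vol3 (P i k l).
  have [B B0 HB] := cont_bounded (test_fun_partial_cont (i := i) tp)
    (bounded_support_partial i (test_fun_bounded tp)).
  apply: (@itg_bdM _ T3 R vol3 B _ _ _ HB (test_fun_partial_itg k (tphi l))).
  by apply: cont_measurable3; exact: test_fun_partial_cont tp.
have PS i k l : \int[vol3]_x P i k l x = \int[vol3]_x P k i l x.
  exact: rint_partial_swap (tphi l) Cp.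
transitivity (\int[vol3]_x ((P i0 i1 i2 x - P i1 i0 i2 x) +
  (P i1 i2 i0 x - P i2 i1 i0 x) + (P i2 i0 i1 x - P i0 i2 i1 x))).
  rewrite innerE; apply: eq_Rintegral => x _.
  rewrite sum3 !extE !coord3_grad.
  have [-> -> ->] := cE x; rewrite /P.
  have [Ox|Ox] := pselect (Omega x); last first.
    have z k l : partial k (p l) x = 0 by exact: test_fun_partial_outside (tphi l) Ox.
    have -> : \1_Omega x = 0 :> R by rewrite indicE (memNset Ox) mulr0n.
    rewrite (z i0 i1) (z i0 i2) (z i1 i0) (z i1 i2) (z i2 i0) (z i2 i1).
    move: (partial i0 psi x) (partial i1 psi x) (partial i2 psi x) => *.
    by ring.
  have -> : \1_Omega x = 1 :> R by rewrite indicE (mem_set Ox) mulr1n.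
  move: (partial i0 psi x) (partial i1 psi x) (partial i2 psi x)
    (partial i0 (p i1) x) (partial i0 (p i2) x) (partial i1 (p i0) x)
    (partial i1 (p i2) x) (partial i2 (p i0) x) (partial i2 (p i1) x) => *.
  by ring.
have z i k l : \int[vol3]_x (P i k l x - P k i l x) = 0.
  apply: etrans (rintB (iP i k l) (iP k i l)) _.
  by apply/eqP; rewrite subr_eq0; apply/eqP; exact: PS.
have i2' i k l : itg vol3 (fun x => P i k l x - P k i l x).
  exact: itgB (iP i k l) (iP k i l).
apply: etrans (rintD (itgD (i2' i0 i1 i2) (i2' i1 i2 i0)) (i2' i2 i0 i1)) _.
rewrite (z i2 i0 i1) addr0.
apply: etrans (rintD (i2' i0 i1 i2) (i2' i1 i2 i0)) _.
by rewrite (z i0 i1 i2) (z i1 i2 i0) addr0.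
Qed.

Lemma inner_eq0 v : L2_field Omega v -> inner Omega v v = 0 ->
  {ae vol3, forall x, Omega x -> v x = 0}.
Proof.
move=> Lv; rewrite innerE.
pose F (x : T3) : R := \sum_(i < 3) ext Omega v i x * ext Omega v i x.
have F0 x : 0 <= F x by apply: sumr_ge0 => i _; rewrite -expr2 sqr_ge0.
have iF : itg vol3 F.
  by apply: itg_sum => i _; apply: sqitg_mul; exact: (L2_fieldE _ _).1 Lv i.
move=> IF.
have : (\int[vol3]_x `|(F x)%:E| = 0)%E.
  under eq_integral => x _ do rewrite gee0_abs ?lee_fin//.
  by rewrite rintE// IF.
move=> /(ae_eq_integral_abs _ measurableT (measurable_int _ iF)).1.
apply: filterS => x /(_ I) /= [Fx] Ox; apply: coord3_ext => i.
have /eqP : ext Omega v i x * ext Omega v i x = 0.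
  apply: (psumr_eq0P (P := xpredT) (F := fun i => ext Omega v i x * ext Omega v i x)) => //.
  by move=> k _; rewrite -expr2 sqr_ge0.
rewrite mulf_eq0 orbb extE indicE (mem_set Ox) mulr1n mul1r => /eqP ->.
by have [->|->|->] := ord3P i.
Qed.

(** The residual of the projection of [v] on the fields [curl phi + grad psi]
    is harmonic, hence orthogonal to [v] and to all these fields, hence zero. *)
Lemma K_space_approx v (eps : R) : K_space Omega v -> 0 < eps ->
  exists phi psi, [/\ test_field Omega phi, test_fun setT psi &
    inner Omega (v - (curl phi + grad psi)) (v - (curl phi + grad psi)) <= eps].
Proof.
move=> [Lv _ tv hv] eps0.
pose S (s : R3 -> R3) := exists phi psi,
  [/\ test_field Omega phi, test_fun setT psi & s = curl phi + grad psi].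
have Llin := @L2_lin R Omega.
have SL s : S s -> L2_field Omega s.
  move=> [phi [psi [tp ts ->]]]; rewrite -[grad psi]scale1r; apply: Llin.
    exact: L2_curl.
  exact: L2_grad.
have S0 : S 0.
  exists 0, (fun=> 0); split; [exact: test_field0|exact: test_fun0|].
  by rewrite curl0 grad0 addr0.
have S_lin (c : R) s s' : S s -> S s' -> S (s + c *: s').
  move=> [phi [psi [tp ts ->]]] [phi' [psi' [tp' ts' ->]]].
  exists (phi + c *: phi'), (fun x => psi x + c * psi' x); split.
  - exact: test_field_lin.
  - exact: test_fun_lin.
  - rewrite curl_lin; [|by move=> i; exact: test_fun_Ck (tp i)|
      by move=> i; exact: test_fun_Ck (tp' i)].
    rewrite grad_lin; [|exact: test_fun_Ck ts|exact: test_fun_Ck ts'].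
    by rewrite scalerDr addrACA.
have Bl := @inner_lin R Omega; have Bs := @inner_sym R Omega.
have B0 := @inner_ge0 R Omega.
have [h [Lh hS happ]] := @projection R _ (L2_field Omega) S (inner Omega) 24
  Llin Bs Bl B0 (L2_complete mO) SL S0 S_lin v Lv.
have Sgrad psi : test_fun setT psi -> S (grad psi).
  by exists 0, psi; split=> //; [exact: test_field0|rewrite curl0 add0r].
have Scurl phi : test_field Omega phi -> S (curl phi).
  by exists phi, (fun=> 0); split=> //; [exact: test_fun0|rewrite grad0 addr0].
have harm : harmonic_field Omega h.
  split=> //.
  - move=> psi ts; apply: hS; apply: Sgrad.
    exact: test_fun_sub ts.
  - move=> phi tp; rewrite (hS _ (Scurl _ tp)).
    have Lp := L2_test_field oO bO tp.
    have := Bl (-1) _ _ _ Lp Lp Lp; rewrite scaleN1r subrr mulN1r subrr.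
    exact: esym.
  - by move=> psi ts; apply: hS; exact: Sgrad.
have vh := hv _ harm.
have Bsub := @bilin_sub R _ (L2_field Omega) (inner Omega) Bl.
have Lsub u w : L2_field Omega u -> L2_field Omega w -> L2_field Omega (u - w).
  by move=> Lu Lw; rewrite -scaleN1r; exact: Llin.
have CS u w := @bilin_CS R _ (L2_field Omega) (inner Omega) Llin Bs Bl B0 u w.
have hh s : S s -> inner Omega (v - s - h) h = - inner Omega h h.
  move=> Ss; have Ls := SL _ Ss.
  rewrite (Bsub _ _ _ (Lsub _ _ Lv Ls) Lh Lh) (Bsub _ _ _ Lv Ls Lh).
  by rewrite vh (Bs s) (hS _ Ss) subrr sub0r.
have h0 : inner Omega h h = 0.
  apply/eqP; rewrite eq_le B0 andbT leNgt; apply/negP => hp.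
  have [s Ss Hs] := happ _ (divr_gt0 hp (ltr0Sn _ 1)).
  have := CS _ h (Lsub _ _ (Lsub _ _ Lv (SL _ Ss)) Lh) Lh.
  rewrite hh// sqrrN expr2 ler_pM2r// => H.
  by have := le_trans H Hs; lra.
have [s Ss Hs] := happ _ eps0; have Ls := SL _ Ss.
have Lvs := Lsub _ _ Lv Ls.
have E : inner Omega (v - s) (v - s) = inner Omega (v - s - h) (v - s - h).
  have h0' w : L2_field Omega w -> inner Omega w h = 0.
    move=> Lw; apply/eqP; rewrite -sqrf_eq0 eq_le sqr_ge0 andbT.
    by have := CS _ _ Lw Lh; rewrite h0 mulr0.
  have Lvsh := Lsub _ _ Lvs Lh.
  rewrite [RHS](Bsub _ _ _ Lvs Lh Lvsh) (Bs h) (h0' _ Lvsh) subr0.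
  by rewrite [RHS]Bs (Bsub _ _ _ Lvs Lh Lvs) (Bs h) (h0' _ Lvs) subr0.
have [phi [psi [tp ts Es]]] := Ss.
by exists phi, psi; split=> //; rewrite -Es E.
Qed.

(** [|v|^2] is close to [inner v (curl phi) = mu * inner v phi], which the
    bilinear estimate bounds by [|mu| r / 2 * (|v|^2 + |curl phi|^2)], and
    [|curl phi|] is at most about [|v|] by orthogonality to [grad psi]. *)
Lemma curl_eigenvalue_bound (r mu : R) : 0 <= r ->
  vol3 Omega = (4 / 3 * pi * r ^+ 3)%:E -> curl_eigenvalue Omega mu ->
  1 <= `|mu| * r.
Proof.
move=> r0 volO [v [[Kv _] vn0 cv]]; have [Lv _ tv _] := Kv.
have Bl := @inner_lin R Omega; have Bs := @inner_sym R Omega.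
have B0 := @inner_ge0 R Omega.
have Bsub := @bilin_sub R _ (L2_field Omega) (inner Omega) Bl.
have CS u w := @bilin_CS R _ (L2_field Omega) (inner Omega) (@L2_lin R Omega) Bs Bl B0 u w.
pose N := inner Omega v v.
have N0 : 0 < N.
  rewrite lt_def B0 andbT; apply/eqP => NE; apply: vn0; exact: inner_eq0.
rewrite leNgt; apply/negP => mur.
pose k := 1 - `|mu| * r.
have k0 : 0 < k by rewrite subr_gt0.
have m0 : 0 <= `|mu| * r by rewrite mulr_ge0.
have kN : 0 < k * N / 4 by rewrite divr_gt0// mulr_gt0.
have [phi [psi [tp ts Hs]]] := K_space_approx Kv kN.
pose c := curl phi; pose g := grad psi.
have Lc : L2_field Omega c by exact: L2_curl.
have Lg : L2_field Omega g by exact: L2_grad.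
have Lp : L2_field Omega phi by exact: L2_test_field.
have Lcg : L2_field Omega (c + g) by rewrite -[g]scale1r; exact: L2_lin.
have BD u w z : L2_field Omega u -> L2_field Omega w -> L2_field Omega z ->
    inner Omega (u + w) z = inner Omega u z + inner Omega w z.
  by move=> Lu Lw Lz; rewrite -{1}[w]scale1r Bl// mul1r.
pose d := v - (c + g).
have Ld : L2_field Omega d by rewrite /d -scaleN1r; exact: L2_lin.
have vc : inner Omega v c = mu * inner Omega v phi.
  rewrite (cv _ tp) (_ : (fun x => mu *: v x) = v + (mu - 1) *: v).
    by rewrite Bl// mulrBl mul1r addrC subrK.
  by rewrite -{2}[v]scale1r -scalerDl subrKC.
have vg : inner Omega v g = 0 by exact: tv.
have cg : inner Omega c g = 0 by exact: curl_grad_orthogonal.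
have Es : v = (c + g) + d by rewrite /d subrKC.
have Ed : inner Omega v d = N - mu * inner Omega v phi.
  rewrite /N Bs [in LHS]/d Bsub// BD// (Bs c) (Bs g) vc vg addr0; ring.
have Ess : inner Omega d d = inner Omega c c + inner Omega g g - N + 2 * inner Omega v d.
  have h1 : inner Omega d d = inner Omega v d - (inner Omega c d + inner Omega g d).
    by rewrite {1}/d Bsub// BD.
  have h2 w : L2_field Omega w -> inner Omega w d =
      inner Omega v w - (inner Omega c w + inner Omega g w).
    by move=> Lw; rewrite Bs /d Bsub// BD.
  have gc : inner Omega g c = 0 by rewrite Bs.
  have := h2 _ Lv; have := h2 _ Lc; have := h2 _ Lg.
  by rewrite h1 (Bs c v) (Bs g v) -/N vg cg gc => -> -> ->; ring.
have best := bilinear_estimate oO bO r0 volO Lv tv tp.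
have dd := B0 d; have gg := B0 g; have vd := CS _ _ Lv Ld.
rewrite -/N -/c -/g -/d in best Hs vd.
have aB : `|mu * inner Omega v phi| <= `|mu| * r / 2 * (N + inner Omega c c).
  by rewrite normrM -!mulrA ler_wpM2l// mulrA.
have {}aB := le_trans (ler_norm _) aB.
move: (inner Omega v d) (mu * inner Omega v phi) (inner Omega d d)
  (inner Omega c c) (inner Omega g g) Ed Ess dd gg vd Hs aB {best cg vg vc}.
move=> b a e cc gg Eb Ee e0 gg0 be eN aB.
have k1 : k <= 1 by rewrite /k; lra.
have b2 : b <= N / 2.
  have [//|bN] := leP b (N / 2).
  have : (N / 2) ^+ 2 < b ^+ 2 by rewrite ltr_pXn2r// ?nnegrE; lra.
  have : N * e <= N * (N / 4) by rewrite ler_wpM2l ?(ltW N0)//; nra.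
  by rewrite !expr2 => *; nra.
have mk : `|mu| * r = 1 - k by rewrite /k; ring.
rewrite mk in aB.
have : k * (N / 2) <= e / 2.
  apply: (@le_trans _ _ (k * (N - b))); first by rewrite ler_wpM2l ?(ltW k0)//; lra.
  have : a <= (1 - k) / 2 * (2 * N - 2 * b + e).
    apply: le_trans aB _; rewrite ler_wpM2l//; first by lra.
    lra.
  have : 0 <= k * e by rewrite mulr_ge0// ltW.
  by nra.
lra.
Qed.

End CurlEigenvalues.

Unset Implicit Arguments.

Theorem theoremA1 (R : realType) (Omega : set (R * R * R)%type) (mu1 mum1 : R)
  (hOmega : bounded_C2_domain Omega)
  (hmu1 : first_positive_curl_eigenvalue Omega mu1)
  (hmum1 : first_negative_curl_eigenvalue Omega mum1) :
  Num.min mu1 (- mum1) >= (4 * pi / (3 * fine (vol3 Omega))) `^ (3^-1).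
Proof.
have [oO _ bO _] := hOmega; have [mu1_gt0 ev1 _] := hmu1.
have [mum1_lt0 ev2 _] := hmum1.
have finO : (vol3 Omega < +oo)%E.
  by apply: bounded_vol3_lty => //; exact: open_measurable3.
have volF : vol3 Omega = (fine (vol3 Omega))%:E.
  by rewrite fineK// ge0_fin_numE// measure_ge0.
(* Both eigenvalues are covered by a bound on the modulus of any eigenvalue. *)
have min_ge (q : R) : 0 <= q -> (forall mu, curl_eigenvalue Omega mu -> q <= `|mu|) ->
    q <= Num.min mu1 (- mum1).
  move=> q0 H; rewrite le_min -[in mu1](gtr0_norm mu1_gt0).
  by rewrite -(ltr0_norm mum1_lt0) !H.
(* For a null set the inverse is [0], and so is its power. *)
have [V0|V0] := eqVneq (fine (vol3 Omega)) 0.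
  by rewrite V0 mulr0 invr0 mulr0 powR0 ?invr_eq0// le_min !ltW// oppr_gt0.
set V := fine (vol3 Omega) in V0 volF *.
have {}V0 : 0 < V by rewrite lt_def V0 fine_ge0.
have p0 := pi_gt0 R.
(* [q^-1] is the radius of the ball of volume [V]. *)
pose q := (4 * pi / (3 * V)) `^ (3^-1).
have x0 : 0 < 4 * pi / (3 * V) by rewrite divr_gt0 ?mulr_gt0.
have q0 : 0 < q by exact: powR_gt0.
have q3 : q ^+ 3 = 4 * pi / (3 * V).
  by rewrite -powR_mulrn ?(ltW q0)// -powRrM mulVf// powRr1// ltW.
apply: (min_ge q (ltW q0)) => mu ev.
rewrite -[q]mul1r -ler_pdivlMr//.
apply: (curl_eigenvalue_bound oO bO _ _ ev); first by rewrite invr_ge0 ltW.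
rewrite volF exprVn q3; congr (_%:E).
move: {x0 q q0 q3 ev min_ge} V (pi : R) V0 p0 {volF} => W P /lt0r_neq0 W0 /lt0r_neq0 P0.
by field; rewrite W0 P0.
Qed.
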